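(* Let $k$ be a field, $U$ a $4$-dimensional $k$-vector space, $P=\mathrm{Sym}_\bullet U$, $\Phi_3\in D_3U^*$, and $\mathfrak A=P/\operatorname{ann}\Phi_3$. Assume that $\operatorname{ann}\Phi_3$ contains no nonzero linear form and that $x\in U$ is a weak Lefschetz element on $\mathfrak A$. Fix $x^*\in U^*$ with $x^*(x)=1$ and put $U_0=\ker x^*$. Let $\mathrm{SM}$ be the $3\times3$ symmetric matrix over $k$ defined in the context, and assume that $\mathrm{SM}$ has rank one. Choose a pair of dual bases $y,z,w$ of $U_0$ and $y^*,z^*,w^*$ of $U_0^*$ so that $$\mathrm{SM}=\begin{bmatrix}\alpha&0&0\\0&0&0\\0&0&0\end{bmatrix}\quad\text{for some unit }\alpha\in k.$$ Then the defining ideal $\operatorname{ann}\Phi_3$ of $\mathfrak A$ is the sum of two linked codimension three perfect ideals of $P$.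
   Context: $U^*=\mathrm{Hom}_k(U,k)$. $P=\mathrm{Sym}_\bullet U$ is the standard graded polynomial ring and $D_\bullet U^*$ is the divided power algebra, with $D_iU^*=\mathrm{Hom}_k(\mathrm{Sym}_iU,k)$. $D_\bullet U^*$ is a $P$-module: for $u\in\mathrm{Sym}_aU$, $\nu\in D_bU^*$, $u\nu=u(\nu)\in D_{b-a}U^*$ is given by $(u\nu)(u')=\nu(uu')$ for $u'\in\mathrm{Sym}_{b-a}U$ (and $u\nu=0$ if $a>b$). $\operatorname{ann}\Phi=\{f\in P: f\Phi=0\}$. An element $\ell\in U$ is a weak Lefschetz element on $\mathfrak A$ if multiplication by $\ell$, $\mathfrak A_i\to\mathfrak A_{i+1}$, has maximal rank for every $i$. Let $p:U\to U^*$ be $p(u)=u(x\Phi_3)$; under the hypotheses it is an isomorphism. $U_0^*=\{f\in U^*: f(x)=0\}$. Let $\langle u,u'\rangle=[u\,p^{-1}(u'\Phi_3)](\Phi_3)\in k$ for $u,u'\in\mathrm{Sym}_2U_0$ (a symmetric bilinear form). With respect to a basis $y,z,w$ of $U_0$, $$\mathrm{SM}=\begin{bmatrix}\langle z^2,w^2\rangle-\langle zw,zw\rangle&\langle zw,yw\rangle-\langle yz,w^2\rangle&\langle yz,zw\rangle-\langle z^2,yw\rangle\\ \langle yw,zw\rangle-\langle yz,w^2\rangle&\langle y^2,w^2\rangle-\langle yw,yw\rangle&\langle yz,yw\rangle-\langle y^2,zw\rangle\\ \langle yz,zw\rangle-\langle yw,z^2\rangle&\langle yw,yz\rangle-\langle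 y^2,zw\rangle&\langle y^2,z^2\rangle-\langle yz,yz\rangle\end{bmatrix}.$$ The rank of $\mathrm{SM}$ does not depend on the basis, and when the rank is one a basis putting $\mathrm{SM}$ in the displayed form exists. A proper ideal $I$ of $P$ is perfect if $\operatorname{grade}I=\operatorname{pd}_P(P/I)$. Grade $g$ ideals $I$ and $J$ of $P$ are linked if there is a regular sequence $\alpha_1,\dots,\alpha_g$ in $I\cap J$ with $(\alpha_1,\dots,\alpha_g):I=J$ and $(\alpha_1,\dots,\alpha_g):J=I$. *)

(* Defs.v *)
From HB Require Import structures.
From mathcomp Require Import all_boot all_order all_algebra.
From mathcomp Require Import mpoly.

Set Implicit Arguments.
Unset Strict Implicit.
Unset Printing Implicit Defensive.

Import GRing.Theory.
Local Open Scope ring_scope.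

Section CommutativeAlgebra.
Variable R : comNzRingType.
Implicit Types (I J K : R -> Prop) (s : seq R).

Definition is_ideal I : Prop :=
  [/\ I 0, forall f g, I f -> I g -> I (f + g) & forall f g, I g -> I (f * g)].

Definition ideal_gen s : R -> Prop :=
  fun f => exists c : nat -> R, f = \sum_(i < size s) c i * s`_i.

Definition ideal_add I J : R -> Prop :=
  fun f => exists g h, [/\ I g, J h & f = g + h].

Definition ideal_colon I J : R -> Prop :=
  fun f => forall g, J g -> I (f * g).

Definition regular_seq s : Prop :=
  ~ ideal_gen s 1 /\
  forall i, (i < size s)%N ->
    forall f, ideal_gen (take i s) (s`_i * f) -> ideal_gen (take i s) f.

Definition grade I (g : nat) : Prop :=
  (exists s, [/\ size s = g, forall f, f \in s -> I f & regular_seq s]) /\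
  (forall s, (forall f, f \in s -> I f) -> regular_seq s -> (size s <= g)%N).

Definition projective (E : lmodType R) : Prop :=
  forall (A B : lmodType R) (q : {linear A -> B}) (h : {linear E -> B}),
    (forall b, exists a, q a = b) ->
    exists h' : {linear E -> A}, forall e, q (h' e) = h e.

(* M has a projective resolution of length at most n:
   0 -> F n -> ... -> F 1 -> F 0 -> M -> 0 *)
Definition has_proj_resolution (M : lmodType R) (n : nat) : Prop :=
  exists (F : nat -> lmodType R) (d : forall i, {linear F i.+1 -> F i})
         (eps : {linear F 0%N -> M}),
    (forall i, projective (F i)) /\
    (forall i (v : F i), (n < i)%N -> v = 0) /\
    (forall m, exists v, eps v = m) /\
    (forall v, eps v = 0 <-> exists w, d 0%N w = v) /\
    (forall i v, d i v = 0 <-> exists w, d i.+1 w = v).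

Definition projdim (M : lmodType R) (n : nat) : Prop :=
  has_proj_resolution M n /\
  forall m, has_proj_resolution M m -> (n <= m)%N.

(* The module M is R/I, with quotient map pi. *)
Definition is_quotient I (M : lmodType R) (pi : {linear R^o -> M}) : Prop :=
  (forall m, exists f, pi f = m) /\ (forall f, pi f = 0 <-> I f).

Definition perfect_ideal I : Prop :=
  [/\ is_ideal I, ~ I 1 &
      exists (M : lmodType R) (pi : {linear R^o -> M}) (g : nat),
        [/\ is_quotient I pi, grade I g & projdim M g]].

Definition linked I J : Prop :=
  exists g, [/\ grade I g, grade J g &
    exists s, [/\ size s = g, forall f, f \in s -> I f /\ J f, regular_seq s,
      forall f, ideal_colon (ideal_gen s) I f <-> J f &
      forall f, ideal_colon (ideal_gen s) J f <-> I f]].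

End CommutativeAlgebra.

Section Macaulay.
Variables (k : fieldType) (n : nat).
Local Notation P := {mpoly k[n.+1]}.

(* Sym_d U, for dim U = n + 1 *)
Definition Sym (d : nat) := dhomog n.+1 k d.

Definition hcomp d (f : P) : Sym d := DHomog (pihomogP mdeg d f).

Lemma hcomp_is_linear d : linear (hcomp d).
Proof. by move=> a f g; apply: val_inj; rewrite /= linearP. Qed.
HB.instance Definition _ d :=
  GRing.isLinear.Build k P (Sym d) _ (hcomp d) (hcomp_is_linear d).

Definition divpow (d : nat) := 'Hom(Sym d, k^o).

(* The component in D_c U^* of f nu, for nu in D_b U^* and an arbitrary f in P.
   When f is homogeneous of degree a it vanishes for a + c <> b, and it is
   g |-> nu (f g) for a + c = b. *)
Definition act b c (f : P) (nu : divpow b) : divpow c :=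
  linfun (fun g : Sym c => nu (hcomp b (f * val g))).

Fact act_fun_is_linear b c (f : P) (nu : divpow b) :
  linear (fun g : Sym c => nu (hcomp b (f * val g)) : k^o).
Proof. by move=> a g h; rewrite !linearP /= mulrDr -scalerAr !linearP. Qed.

Lemma actE b c f (nu : divpow b) (g : Sym c) :
  act c f nu g = nu (hcomp b (f * val g)).
Proof.
pose L := GRing.isLinear.Build k (Sym c) k^o _ _ (@act_fun_is_linear b c f nu).
pose l : {linear Sym c -> k^o} := HB.pack (fun g : Sym c => nu (hcomp b (f * val g)) : k^o) L.
exact: (lfunE l).
Qed.

Fact act_is_linear b c (nu : divpow b) : linear (fun f => act c f nu).
Proof.
move=> a f g; apply/lfunP=> h.
by rewrite add_lfunE scale_lfunE !actE mulrDl -scalerAl !linearP.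
Qed.

Definition ann b (nu : divpow b) : P -> Prop := fun f => forall c, act c f nu = 0.

(* ann nu :&: Sym_i U as a subspace of Sym_i U, see annvP; for i > b the
   truncated b - i is 0 and the kernel is the whole of Sym_i U. *)
Definition annv b (nu : divpow b) (i : nat) : {vspace Sym i} :=
  lker (linfun (fun f : Sym i => act (b - i) (val f) nu)).

Lemma annvP b (nu : divpow b) i (f : Sym i) :
  f \in annv nu i <-> ann nu (val f).
Proof.
have lin : linear (fun f : Sym i => act (b - i) (val f) nu).
  by move=> a g h; rewrite linearP act_is_linear.
pose L := GRing.isLinear.Build k (Sym i) (divpow (b - i)) _ _ lin.
pose l : {linear Sym i -> divpow (b - i)} := HB.pack (fun f : Sym i => act (b - i) (val f) nu) L.
rewrite memv_ker (lfunE l) /=; split=> [/eqP e c|/(_ (b - i)%N) ->//].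
apply/lfunP=> g; rewrite zero_lfunE actE.
have fgh : val f * val g \is (i + c).-homog by apply: dhomogM; apply: valP.
have [ic|ne] := eqVneq (i + c)%N b; last first.
  rewrite (_ : hcomp b _ = 0) ?linear0 //; apply: val_inj.
  by rewrite /= (pihomog_ne0 ne fgh).
have ec : c = (b - i)%N by rewrite -ic addKn.
by rewrite {}ec in g fgh ic *; rewrite -actE e zero_lfunE.
Qed.

Variables (U : vectType k) (dimU : \dim {:U} = n.+1).

(* U as the linear forms of its symmetric algebra: P is the polynomial ring on
   a basis of U. *)
Definition symv (u : U) : P :=
  \sum_(i < n.+1) coord (tcast dimU (vbasis {:U})) i u *: 'X_i.

Lemma symv_is_linear : linear symv.
Proof.
move=> a u v; rewrite /symv scaler_sumr -big_split /=; apply: eq_bigr => i _.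
by rewrite linearP scalerDl scalerA.
Qed.
HB.instance Definition _ := GRing.isLinear.Build k U P _ symv symv_is_linear.

(* Multiplication by l, Sym_i U -> Sym_(i+1) U. *)
Definition mulsym (l : U) i : 'Hom(Sym i, Sym i.+1) :=
  linfun (fun f : Sym i => hcomp i.+1 (symv l * val f)).

Lemma mulsymE l i (f : Sym i) : val (mulsym l i f) = symv l * val f.
Proof.
have lin : linear (fun f : Sym i => hcomp i.+1 (symv l * val f)).
  by move=> a g h; rewrite !linearP /= mulrDr -scalerAr linearP.
pose L := GRing.isLinear.Build k (Sym i) (Sym i.+1) _ _ lin.
pose m : {linear Sym i -> Sym i.+1} :=
  HB.pack (fun f : Sym i => hcomp i.+1 (symv l * val f)) L.
rewrite (lfunE m) /= pihomog_dE // -[i.+1]add1n.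
apply: dhomogM; last exact: valP.
by apply: rpred_sum => j _; apply: rpredZ; rewrite dhomogX; apply/eqP; exact: mdeg1.
Qed.

(* Here A = P / ann nu: quot_dim is the dimension of
   A_i = Sym_i U / (ann nu :&: Sym_i U), and mul_rank is the rank of
   multiplication by l, A_i -> A_(i+1). *)
Definition quot_dim b (nu : divpow b) i : nat :=
  (\dim {:Sym i} - \dim (annv nu i))%N.

Definition mul_rank b (nu : divpow b) (l : U) i : nat :=
  (\dim (limg (mulsym l i) + annv nu i.+1) - \dim (annv nu i.+1))%N.

Definition weak_lefschetz b (nu : divpow b) (l : U) : Prop :=
  forall i, mul_rank nu l i = minn (quot_dim nu i) (quot_dim nu i.+1).

(* D_1 U^* = U^* *)
Definition to_dual (nu : divpow 1) : 'Hom(U, k^o) :=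
  linfun (fun v : U => nu (hcomp 1 (symv v))).

Lemma to_dualE (nu : divpow 1) (v : U) : to_dual nu v = nu (hcomp 1 (symv v)).
Proof.
have lin : linear (fun v : U => nu (hcomp 1 (symv v)) : k^o).
  by move=> a g h; rewrite !linearP.
pose L := GRing.isLinear.Build k U k^o _ _ lin.
pose m : {linear U -> k^o} := HB.pack (fun v : U => nu (hcomp 1 (symv v)) : k^o) L.
exact: (lfunE m).
Qed.

Section Form.
Variables (Phi3 : divpow 3) (x : U).

Definition pmap : 'Hom(U, 'Hom(U, k^o)) :=
  linfun (fun u : U => to_dual (act 1 (symv u) (act 2 (symv x) Phi3))).

Lemma pmapE (u v : U) :
  pmap u v = Phi3 (hcomp 3 (symv x * (symv u * symv v))).
Proof.
set F := fun u : U => to_dual (act 1 (symv u) (act 2 (symv x) Phi3)).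
have deg1 (w : U) : symv w \is 1.-homog.
  by apply: rpred_sum => j _; apply: rpredZ; rewrite dhomogX; apply/eqP; exact: mdeg1.
have lin : linear F.
  move=> a g h; apply/lfunP=> t.
  by rewrite add_lfunE scale_lfunE !to_dualE linearP act_is_linear add_lfunE
             scale_lfunE.
pose L := GRing.isLinear.Build k U 'Hom(U, k^o) _ _ lin.
pose m : {linear U -> 'Hom(U, k^o)} := HB.pack F L.
rewrite (lfunE m) /= to_dualE !actE /= (pihomog_dE (deg1 v)).
by rewrite pihomog_dE // -[2%N]/(1 + 1)%N dhomogM.
Qed.

(* The value at Phi3 of the cubic form u p^-1(u' Phi3). *)
Definition pairing (u u' : P) : k :=
  Phi3 (hcomp 3 (u * symv (pmap^-1%VF (to_dual (act 1 u' Phi3))))).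

Definition SM (y z w : U) : 'M[k]_3 :=
  let q a b c d := pairing (symv a * symv b) (symv c * symv d) in
  \matrix_(i, j) nth 0 (nth [::]
    [:: [:: q z z w w - q z w z w; q z w y w - q y z w w; q y z z w - q z z y w];
        [:: q y w z w - q y z w w; q y y w w - q y w y w; q y z y w - q y y z w];
        [:: q y z z w - q y w z z; q y w y z - q y y z w; q y y z z - q y z y z]]
    i) j.

End Form.
End Macaulay.

(* Main.v *)
(* Since x is weak Lefschetz, p : U -> U^* is an isomorphism, and
   u o v = p^-1(u v Phi3) makes U a commutative, not necessarily associative,
   algebra with unit x, for which B(u, v) = Phi3(x u v) is a nondegenerate
   associative form. The entries of SM are the values B(a o b, c o d) of second
   minors, and SM having rank one forces a vector y of U_0 to lie in the nucleus
   of (U, o); subtracting a multiple of x gives an e with e o u = lam(u) e, where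
   lam = B(e, -)/B(e, x) is then a homomorphism from (U, o) to k.

   If v = (v1, v2, v3) is a basis of ker lam, then for a suitable 3 x 3 matrix M
   of linear forms
     ann Phi3 = (e v1, e v2, e v3) + (M v) + (det M).
   With u = M v, the ideals I = (e v1, e v2, e v3, u1, u2) and J = (u, det M)
   have explicit free resolutions of length three and are linked by
   (u1, u2, e u3), provided that v, u and (u1, u2, e) have exact Koszul
   complexes; this follows from regular sequences of elements of these ideals
   that are monic in one variable after the other. *)
Require Import Defs.
From HB Require Import structures.
From mathcomp Require Import all_boot all_order all_algebra.
From mathcomp Require Import mpoly freeg boolp ring ring_quotient.

Set Implicit Arguments.
Unset Strict Implicit.
Unset Printing Implicit Defensive.

Import GRing.Theory.
Local Open Scope ring_scope.

(** * Projective resolutions and regular sequences *)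

(** [ann Phi3] is generated by the quadrics [u v - x (u o v)] and the cubics [x^2 w] with
    [B(x, w) = 0]. Comparing two bracketings of a cubic monomial puts [x^2] times every associator
    into the ideal of the quadrics, and two associators of [s] and [t] span the vectors orthogonal
    to both [x] and [e]. So a single further cubic suffices, and [det M] serves as soon as
    [Phi3(det M) = 0] and [det M] does not vanish at the point [lam]. These two conditions dictate
    [M]: adding to a quadric [e] times an element of [ker lam] leaves a scalar free, which is tuned
    to get the first. The choice splits according to whether [e] can be scaled to an idempotent or
    has square zero, because [e] lies in [ker lam] only in the second case.

    The delicate Koszul complex is that of [u]: [u1] and [u2] are monic in [s] and [t], but [u3],
    which starts with [s t], is not monic in either. What is missing is a nonzero element of
    [k[e, x]] in [(u)]. It comes from the finiteness of [P/J] over [k[e]], which in turn rests on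
    the description of [ann Phi3]. *)

Section Projective.
Variable R : comNzRingType.
Implicit Types (E A B : lmodType R) (s : seq R).

Section FreegLift.
Variables (K : choiceType) (E : lmodType R) (f : K -> E).

Fact fglift_is_linear : linear (fglift f : {freeg K / R} -> E).
Proof.
have addf : {morph fglift f : D1 D2 / D1 + D2 >-> D1 + D2}.
  pose L := GRing.isZmodMorphism.Build {freeg K / R} E _ (@lift_is_additive R K E f).
  pose l : {additive {freeg K / R} -> E} := HB.pack (fglift f) L.
  exact: (raddfD l).
move=> c D1 D2; rewrite addf; congr (_ + _).
have sumf (r : seq K) (g : K -> R) :
    fglift f (\sum_(z <- r) << g z *g z >>) = \sum_(z <- r) g z *: f z.
  elim: r => [|z r IHr]; last by rewrite !big_cons addf liftU IHr.
  rewrite !big_nil; apply: (addrI (fglift f 0)).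
  by rewrite -addf !addr0.
transitivity (\sum_(z <- dom D1) (c * coeff z D1) *: f z); first exact: sumf.
rewrite -[in RHS](freeg_sumE D1) sumf scaler_sumr.
by apply: eq_bigr => z _; rewrite scalerA.
Qed.

HB.instance Definition _ :=
  GRing.isLinear.Build R {freeg K / R} E _ (fglift f) fglift_is_linear.

End FreegLift.

Lemma projective_retract E : projective E ->
  exists sg : {linear E -> {freeg E / R}}, forall u, fglift id (sg u) = u.
Proof.
move=> /(_ {freeg E / R} E (fglift (id : E -> E)) idfun) [b|sg sgK]; last by exists sg.
by exists << b >>; rewrite /= liftU scale1r.
Qed.

(** [projective] lifts along surjections only. Through a free module of which [E] is a retract, the
    lift is chosen basis element by basis element, so it is enough that the image of [g] lies in
    that of [q], and no image submodule has to be formed. *)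
Lemma projective_lift E A B (q : {linear A -> B}) (g : {linear E -> B}) :
  projective E -> (forall u, exists a, q a = g u) ->
  exists h : {linear E -> A}, forall u, q (h u) = g u.
Proof.
move=> /projective_retract[sg sgK] /choice[c qc].
exists (fglift c \o sg) => u /=; rewrite -{2}[u]sgK.
elim/freeg_ind_dom0: (sg u) => [|k x D _ _ IH]; first by rewrite !linear0.
by rewrite !linearD /= !liftU !linearZ /= qc IH.
Qed.

Definition in_gen E s (u : E) : Prop :=
  exists w : nat -> E, u = \sum_(i < size s) s`_i *: w i.

Lemma in_genP s (f : R) : ideal_gen s f <-> in_gen s (f : R^o).
Proof.
by split=> -[c ->]; exists c; apply: eq_bigr => i _; rewrite [LHS]mulrC.
Qed.

Lemma in_gen0 E s : in_gen s (0 : E).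
Proof. by exists (fun=> 0); rewrite big1 // => i _; rewrite scaler0. Qed.

Lemma in_genD E s (u v : E) : in_gen s u -> in_gen s v -> in_gen s (u + v).
Proof.
move=> [c ->] [d ->]; exists (fun i => c i + d i).
by rewrite -big_split; apply: eq_bigr => i _; rewrite scalerDr.
Qed.

Lemma in_genZ E s a (u : E) : in_gen s u -> in_gen s (a *: u).
Proof.
move=> [c ->]; exists (fun i => a *: c i).
by rewrite scaler_sumr; apply: eq_bigr => i _; rewrite !scalerA mulrC.
Qed.

Lemma in_genN E s (u : E) : in_gen s u -> in_gen s (- u).
Proof. by rewrite -scaleN1r; apply: in_genZ. Qed.

Lemma in_gen_sum E s (I : Type) (r : seq I) (F : I -> E) :
  (forall i, in_gen s (F i)) -> in_gen s (\sum_(i <- r) F i).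
Proof. by move=> Fs; elim/big_ind: _ => //; [exact: in_gen0 | exact: in_genD]. Qed.

Lemma in_gen_linear E A s (g : {linear E -> A}) u : in_gen s u -> in_gen s (g u).
Proof.
move=> [c ->]; exists (fun i => g (c i)).
by rewrite linear_sum; apply: eq_bigr => i _; rewrite linearZ.
Qed.

Lemma in_gen_rcons E s a (u : E) :
  in_gen (rcons s a) u <-> exists w, in_gen s (u - a *: w).
Proof.
split=> [[c ->]|[w [c uE]]].
  exists (c (size s)); exists c; rewrite size_rcons big_ord_recr /=.
  by rewrite nth_rcons ltnn eqxx addrK; apply: eq_bigr => i _; rewrite nth_rcons ltn_ord.
exists (fun i => if (i < size s)%N then c i else w).
rewrite size_rcons big_ord_recr /= ltnn nth_rcons ltnn eqxx -[LHS](subrK (a *: w)) uE.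
by congr (_ + _); apply: eq_bigr => i _; rewrite nth_rcons ltn_ord.
Qed.

(** In a free module this is read on coefficients, and [E] is a retract of one. *)
Lemma projective_regular E s r : projective E ->
  (forall f, ideal_gen s (r * f) -> ideal_gen s f) ->
  forall u : E, in_gen s (r *: u) -> in_gen s u.
Proof.
move=> /projective_retract[sg sgK] reg u ru.
rewrite -[u]sgK -[sg u]freeg_sumE linear_sum; apply: in_gen_sum => z /=.
rewrite liftU; have : ideal_gen s (r * coeff z (sg u)).
  rewrite -coeffZ -linearZ; apply/in_genP; case: (in_gen_linear sg ru) => c ->.
  exists (fun i => coeff z (c i)); rewrite raddf_sum.
  by apply: eq_bigr => i _; rewrite /= coeffZ.
move=> /reg [c ->]; exists (fun i => c i *: z).
by rewrite scaler_suml; apply: eq_bigr => i _; rewrite scalerA mulrC.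
Qed.

(** As [r] kills the cokernel of the first differential, multiplication by [r] is null-homotopic.
    The homotopy is delivered in consecutive pairs, which is the form that the induction
    produces. *)
Lemma has_proj_resolution_annihilator_homotopy (F : nat -> lmodType R)
    (d : forall i, {linear F i.+1 -> F i}) (r : R) :
  (forall i, projective (F i)) ->
  (forall i v, d i v = 0 <-> exists w, d i.+1 w = v) ->
  (forall v, exists w, d 0%N w = r *: v) ->
  (exists h : {linear F 0%N -> F 1%N}, forall v, d 0%N (h v) = r *: v) /\
  forall j, exists (h : {linear F j -> F j.+1}) (h' : {linear F j.+1 -> F j.+2}),
    forall v, d j.+1 (h' v) = r *: v - h (d j v).
Proof.
move=> projF exF d0.
have [h0 h0E] : exists h : {linear F 0%N -> F 1%N}, forall v, d 0%N (h v) = r *: v.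
  pose rl : {linear F 0%N -> F 0%N} := r \*: (idfun : F 0%N -> F 0%N).
  by apply: (@projective_lift _ _ _ (d 0%N) rl).
split; first by exists h0.
have step j (h : {linear F j -> F j.+1}) :
    (forall v, d j (h (d j v)) = r *: d j v) ->
    exists h' : {linear F j.+1 -> F j.+2}, forall v, d j.+1 (h' v) = r *: v - h (d j v).
  move=> hE; pose g : {linear F j.+1 -> F j.+1} := (r \*: (idfun : F j.+1 -> F j.+1)) \- (h \o d j).
  apply: (@projective_lift _ _ _ (d j.+1) g) => // u.
  by apply/exF; rewrite /= linearB linearZ /= hE subrr.
have dd j v : d j (d j.+1 v) = 0 by apply/exF; exists v.
elim=> [|j [h [h' hE]]].
  by have [h' h'E] := step _ h0 (fun v => h0E _); exists h0, h'.
have [v|h'' h''E] := step _ h'; first by rewrite hE dd linear0 subr0.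
by exists h', h''.
Qed.

(** An element [r] of [I] acts as zero on the homology of [F/(s_1, ..., s_i)F]. If [r = s_(i+1)],
    the long exact sequence makes [H_j] at stage [i] a quotient of [H_(j+1)] at stage [i+1].
    Starting in degrees above [m], where [F] vanishes, a sequence longer than [m] would lead down to
    [H_0] at stage 0, that is, to [M = 0]. *)
Theorem size_regular_seq_le_projdim (I : R -> Prop) (M : lmodType R)
    (pi : {linear R^o -> M}) m s :
  is_quotient I pi -> ~ I 1 -> has_proj_resolution M m ->
  (forall f, f \in s -> I f) -> regular_seq s -> (size s <= m)%N.
Proof.
move=> [pi_surj kerpi] I1 [F [d [eps [projF [F0 [eps_surj [ex0 exF]]]]]]] sI [_ regs].
rewrite leqNgt; apply/negP => lt_ms.
(* The vanishing of [H_j(F/(s_1, ..., s_i)F)], expressed on representatives. *)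
pose acyclic i j := match j return Prop with
  | 0%N => forall v : F 0%N, exists w, in_gen (take i s) (v - d 0%N w)
  | j.+1 => forall v : F j.+1, in_gen (take i s) (d j v) ->
              exists w, in_gen (take i s) (v - d j.+1 w) end.
(* [c] counts the remaining elements of [s]. Lowering [i] and [j] together preserves
   [m + i < size s + j], which for [i = size s] says that [j > m]. *)
suff acyc c i j : (i + c = size s)%N -> (m + i < size s + j)%N -> acyclic i j.
  apply: I1; apply/kerpi; have [v epsv] := eps_surj (pi 1).
  have [|w] := acyc (size s) 0%N 0%N (add0n _) _ v; first by rewrite addn0 addn0.
  rewrite take0 => -[c]; rewrite big_ord0 => /eqP; rewrite subr_eq0 => /eqP vE.
  by rewrite -epsv; apply/ex0; exists w.
elim: c i j => [|c IHc] i j => [|eq_ic lt_m].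
  rewrite addn0 => ->; rewrite addnC ltn_add2l => lt_mj.
  case: j lt_mj => // j lt_mj v _; exists 0.
  by rewrite (F0 _ v lt_mj) linear0 subr0; apply: in_gen0.
have lt_is : (i < size s)%N by rewrite -eq_ic -addSnnS leq_addr.
set r := s`_i; have Ir : I r by apply: sI; rewrite mem_nth.
have takeS : take i.+1 s = rcons (take i s) r by rewrite (take_nth 0 lt_is).
have {}IHc : acyclic i.+1 j.+1 by apply: IHc; rewrite ?addSnnS // !addnS ltnS.
have regF k (u : F k) : in_gen (take i s) (r *: u) -> in_gen (take i s) u.
  exact: (projective_regular (projF k) (regs i lt_is)).
have [|[h0 h0E] hE] := has_proj_resolution_annihilator_homotopy projF exF (r := r).
  move=> v; apply/ex0; rewrite linearZ /=; have [f <-] := pi_surj (eps v).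
  have rf : r *: f = (f : R) *: (r : R^o) by exact: mulrC.
  rewrite -linearZ /= rf; move: (linearZ_LR pi f (r : R^o)) => ->.
  by rewrite (proj2 (kerpi r)) // scaler0.
(* The connecting map: [h] is a cycle modulo [s_1, ..., s_(i+1)]. Written as a boundary plus [r w'],
   it shows that [r (v - d w')] lies in [(s_1, ..., s_i)F], and [r] cancels. *)
have key k (v : F k) (h : F k.+1) (b : F k) : in_gen (take i s) b ->
    d k h = r *: v - b -> acyclic i.+1 k.+1 ->
    exists w, in_gen (take i s) (v - d k w).
  move=> sb dh /(_ h)[|w].
    by rewrite dh takeS; apply/in_gen_rcons; exists v; rewrite addrAC subrr sub0r; apply: in_genN.
  rewrite takeS => /in_gen_rcons[w' sw']; exists w'; apply: regF.
  have /(in_genD sb) := in_gen_linear (d k) sw'.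
  rewrite !linearB /= linearZ /= (proj2 (exF k (d k.+1 w))); last by exists w.
  by rewrite subr0 dh addrA [b + _]addrC subrK.
case: j lt_m IHc => [|j] lt_m IHc v.
  by apply: (key _ _ (h0 v) 0) => //; [exact: in_gen0 | rewrite h0E subr0].
have [h [h' hh']] := hE j => sdv.
by apply: (key _ _ (h' v) (h (d j v))) => //; apply: in_gen_linear.
Qed.

End Projective.

(** * The quotient by an ideal as a module *)

Section Quotient.
Variables (R : comNzRingType) (I : R -> Prop).
Hypotheses (idI : is_ideal I) (I1 : ~ I 1).

Definition ideal_pred (f : R) : bool := `[< I f >].

Fact ideal_pred_closed : idealr_closed ideal_pred.
Proof.
have [I0 ID IM] := idI; split; rewrite ?unfold_in.
- exact/asboolP.
- by apply/asboolP.
- move=> a f g; rewrite !unfold_in => /asboolP If /asboolP Ig.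
  by apply/asboolP; apply: ID => //; apply: IM.
Qed.

HB.instance Definition _ := isIdealr.Build R ideal_pred ideal_pred_closed.

Definition quotient_module := @Quotient.quot R (ideal_pred : idealr R).
HB.instance Definition _ := GRing.ComNzRing.on quotient_module.

Local Notation pr := (\pi_quotient_module%qT).

Definition quotient_scale (a : R) (f : quotient_module) : quotient_module := pr a * f.

Let prM : {morph pr : a b / a * b}. Proof. exact: Quotient.pi_mul. Qed.
Let prD : {morph pr : a b / a + b}. Proof. exact: Quotient.pi_add. Qed.

Fact quotient_scaleA a b f :
  quotient_scale a (quotient_scale b f) = quotient_scale (a * b) f.
Proof. by rewrite /quotient_scale prM mulrA. Qed.
Fact quotient_scale1 f : quotient_scale 1 f = f.
Proof. by elim/quotW: f => f; rewrite /quotient_scale -prM mul1r. Qed.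
Fact quotient_scaleDr : right_distributive quotient_scale +%R.
Proof. by move=> a f g; exact: mulrDr. Qed.
Fact quotient_scaleDl f : {morph quotient_scale^~ f : a b / a + b}.
Proof. by move=> a b; rewrite /quotient_scale prD mulrDl. Qed.

HB.instance Definition _ := GRing.Zmodule_isLmodule.Build R quotient_module
  quotient_scaleA quotient_scale1 quotient_scaleDr quotient_scaleDl.

Definition quotient_proj (f : R^o) : quotient_module := pr f.

Fact quotient_proj_is_linear : linear quotient_proj.
Proof. by move=> a f g; rewrite /quotient_proj prD prM. Qed.
HB.instance Definition _ :=
  GRing.isLinear.Build R R^o quotient_module _ quotient_proj quotient_proj_is_linear.

Lemma quotient_proj_is_quotient : is_quotient I quotient_proj.
Proof.
split=> [m|f]; first by elim/quotW: m => f; exists f.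
have prE : (pr f == pr 0) = ideal_pred f.
  by rewrite -[in RHS](subr0 f) -[RHS]Quotient.equivE; exact: eqmodE.
have <- : quotient_proj 0 = 0 by rewrite linear0.
by split=> [/eqP|If]; [rewrite prE => /asboolP | apply/eqP; rewrite prE; apply/asboolP].
Qed.

End Quotient.

Lemma quotient_exists (R : comNzRingType) (I : R -> Prop) : is_ideal I -> ~ I 1 ->
  exists (M : lmodType R) (pi : {linear R^o -> M}), is_quotient I pi.
Proof.
by move=> idI I1; exists (quotient_module idI I1), (quotient_proj idI I1);
   exact: quotient_proj_is_quotient.
Qed.

(** * Koszul complexes *)

Section Koszul.
Variables (R : comNzRingType) (u1 u2 u3 : R).
Implicit Types (I : R -> Prop).

(* Exactness of the Koszul complex of u1, u2, u3 with coefficients in R/I, in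
   homological degrees 3, 2 and 1. *)
Definition koszul3 I := forall f, I (u1 * f) -> I (u2 * f) -> I (u3 * f) -> I f.

Definition koszul2 I := forall f1 f2 f3,
  I (u2 * f3 - u3 * f2) -> I (u3 * f1 - u1 * f3) -> I (u1 * f2 - u2 * f1) ->
  exists h, [/\ I (f1 - h * u1), I (f2 - h * u2) & I (f3 - h * u3)].

Definition koszul1 I := forall f1 f2 f3, I (f1 * u1 + f2 * u2 + f3 * u3) ->
  exists g1 g2 g3, [/\ I (f1 - (u2 * g3 - u3 * g2)), I (f2 - (u3 * g1 - u1 * g3)) &
                       I (f3 - (u1 * g2 - u2 * g1))].

Definition regular_mod I s := forall f, I (s * f) -> I f.
Definition adjoin I s : R -> Prop := fun f => exists g, I (f - s * g).

Lemma adjoin_ideal I s : is_ideal I -> is_ideal (adjoin I s).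
Proof.
move=> [I0 ID IM]; split=> [|f g [a Ia] [b Ib]|f g [a Ia]].
- by exists 0; rewrite mulr0 subr0.
- by exists (a + b); rewrite mulrDr opprD addrACA; apply: ID.
- by exists (f * a); rewrite mulrCA -mulrBr; apply: IM.
Qed.

Lemma ideal_eq I f g : I f -> f = g -> I g. Proof. by move=> ? <-. Qed.

Section Step.
Variables (I : R -> Prop) (s c1 c2 c3 : R).
Hypotheses (idI : is_ideal I) (regs : regular_mod I s).
Hypothesis sE : s = c1 * u1 + c2 * u2 + c3 * u3.

Let ID f g : I f -> I g -> I (f + g). Proof. by have [_ + _] := idI; apply. Qed.
Let IM f g : I g -> I (f * g). Proof. by have [_ _] := idI; apply. Qed.

Lemma koszul3_regular : koszul3 I.
Proof.
move=> f I1 I2 I3; apply: regs.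
by apply: (ideal_eq (ID (ID (IM c1 I1) (IM c2 I2)) (IM c3 I3))); rewrite sE; ring.
Qed.

(** The identity [s f = (c.f) u - c x (u x f)] shows that [(c.f) u] vanishes modulo [(I, s)]. Hence
    [c.f = h s] modulo [I], and [s] cancels in [s f = h s u]. *)
Lemma koszul2_regular : koszul3 (adjoin I s) -> koszul2 I.
Proof.
move=> K3 f1 f2 f3 I1 I2 I3; pose g := c1 * f1 + c2 * f2 + c3 * f3.
have [|||h Ih] := K3 g.
- by exists f1; apply: (ideal_eq (ID (IM c2 I3) (IM (- c3) I2))); rewrite sE /g; ring.
- by exists f2; apply: (ideal_eq (ID (IM (- c1) I3) (IM c3 I1))); rewrite sE /g; ring.
- by exists f3; apply: (ideal_eq (ID (IM c1 I2) (IM (- c2) I1))); rewrite sE /g; ring.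
exists h; split; apply: regs.
- by apply: (ideal_eq (ID (ID (IM (- c2) I3) (IM c3 I2)) (IM u1 Ih))); rewrite sE /g; ring.
- by apply: (ideal_eq (ID (ID (IM c1 I3) (IM (- c3) I1)) (IM u2 Ih))); rewrite sE /g; ring.
- by apply: (ideal_eq (ID (ID (IM (- c1) I2) (IM c2 I1)) (IM u3 Ih))); rewrite sE /g; ring.
Qed.

(* (c.u) f = u x (f x c) + c (u.f) *)
Lemma koszul1_regular : koszul2 (adjoin I s) -> koszul1 I.
Proof.
move=> K2 f1 f2 f3 If.
have [|||h [[g1 I1] [g2 I2] [g3 I3]]] := K2 (f2 * c3 - f3 * c2) (f3 * c1 - f1 * c3) (f1 * c2 - f2 * c1).
- by exists f1; apply: (ideal_eq (IM (- c1) If)); rewrite sE; ring.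
- by exists f2; apply: (ideal_eq (IM (- c2) If)); rewrite sE; ring.
- by exists f3; apply: (ideal_eq (IM (- c3) If)); rewrite sE; ring.
exists g1, g2, g3; split; apply: regs.
- by apply: (ideal_eq (ID (ID (IM u2 I3) (IM (- u3) I2)) (IM c1 If))); rewrite sE; ring.
- by apply: (ideal_eq (ID (ID (IM u3 I1) (IM (- u1) I3)) (IM c2 If))); rewrite sE; ring.
- by apply: (ideal_eq (ID (ID (IM u1 I2) (IM (- u2) I1)) (IM c3 If))); rewrite sE; ring.
Qed.

End Step.

Definition zero_ideal : R -> Prop := fun f => f = 0.

Lemma zero_ideal_ideal : is_ideal zero_ideal.
Proof. by split=> [|_ _ -> ->|f _ ->]; rewrite /zero_ideal ?addr0 ?mulr0. Qed.

Definition in_span3 f := exists c1 c2 c3, f = c1 * u1 + c2 * u2 + c3 * u3.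

Definition koszul_exact :=
  [/\ koszul3 zero_ideal, koszul2 zero_ideal & koszul1 zero_ideal].

(** Depth sensitivity of the Koszul complex: each regular element of [(u1, u2, u3)] trades one
    homological degree, so exactness in degree 3 modulo [(r1, r2)] gives degree 2 modulo [r1], and
    then degree 1 modulo 0. *)
Lemma koszul_exact_of_regular r1 r2 r3 :
  regular_mod zero_ideal r1 -> regular_mod (adjoin zero_ideal r1) r2 ->
  regular_mod (adjoin (adjoin zero_ideal r1) r2) r3 ->
  in_span3 r1 -> in_span3 r2 -> in_span3 r3 -> koszul_exact.
Proof.
move=> reg1 reg2 reg3 [c1 [c2 [c3 cE]]] [d1 [d2 [d3 dE]]] [e1 [e2 [e3 eE]]].
have id0 := zero_ideal_ideal; have id1 := adjoin_ideal r1 id0.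
have id2 := adjoin_ideal r2 id1.
have K31 := koszul3_regular id1 reg2 dE.
split; first exact: koszul3_regular id0 reg1 cE.
  exact: koszul2_regular id0 reg1 cE K31.
apply: koszul1_regular id0 reg1 cE _; apply: koszul2_regular id1 reg2 dE _.
exact: koszul3_regular id2 reg3 eE.
Qed.

End Koszul.

(** * Perfection from a free resolution of length three *)

Section Resolution.
Variable R : comNzRingType.

Lemma projective_regular_module : projective R^o.
Proof.
move=> A B q h q_surj; have [a qa] := q_surj (h 1).
have lin : linear (fun e : R^o => e *: a) by move=> c e f; rewrite scalerDl scalerA.
pose L := GRing.isLinear.Build R R^o A _ _ lin.
pose l : {linear R^o -> A} := HB.pack (fun e : R^o => e *: a) L.
by exists l => e /=; rewrite linearZ /= qa -linearZ /=; congr (h _); exact: mulr1.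
Qed.

Lemma projective_prod (E F : lmodType R) :
  projective E -> projective F -> projective (E * F)%type.
Proof.
move=> pE pF A B q h q_surj.
have linl : linear (fun x : E => h (x, 0)).
  move=> c x y; rewrite -linearP; congr (h _).
  by apply: injective_projections; rewrite /= ?scaler0 ?addr0.
have linr : linear (fun x : F => h (0, x)).
  move=> c x y; rewrite -linearP; congr (h _).
  by apply: injective_projections; rewrite /= ?scaler0 ?addr0.
pose hl : {linear E -> B} :=
  HB.pack (fun x : E => h (x, 0)) (GRing.isLinear.Build R E B _ _ linl).
pose hr : {linear F -> B} :=
  HB.pack (fun x : F => h (0, x)) (GRing.isLinear.Build R F B _ _ linr).
have [gl glE] := pE A B q hl q_surj; have [gr grE] := pF A B q hr q_surj.
have lin : linear (fun x : E * F => gl x.1 + gr x.2).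
  by move=> c x y; rewrite !linearP /= scalerDr addrACA.
pose g : {linear (E * F)%type -> A} :=
  HB.pack (fun x : E * F => gl x.1 + gr x.2) (GRing.isLinear.Build R (E * F)%type A _ _ lin).
exists g => -[x y] /=; rewrite linearD /= glE grE /= -linearD.
by congr (h _); apply: injective_projections; rewrite /= ?addr0 ?add0r.
Qed.

Lemma projective_rV0 : projective 'rV[R]_0.
Proof.
move=> A B q h _; exists (\0 : {linear 'rV[R]_0 -> A}) => e.
by rewrite [e]thinmx0 !linear0.
Qed.

Section Length3.
Variables (I : R -> Prop) (F1 F2 F3 : lmodType R).
Variables (d1 : {linear F1 -> R^o}) (d2 : {linear F2 -> F1}) (d3 : {linear F3 -> F2}).
Hypotheses (pF1 : projective F1) (pF2 : projective F2) (pF3 : projective F3).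
Hypothesis im_d1 : forall f, I f <-> exists w, d1 w = f.
Hypothesis ker_d1 : forall v, d1 v = 0 <-> exists w, d2 w = v.
Hypothesis ker_d2 : forall v, d2 v = 0 <-> exists w, d3 w = v.
Hypothesis ker_d3 : forall v, d3 v = 0 -> v = 0.

Definition resolution3_module (i : nat) : lmodType R :=
  match i with
  | 0%N => R^o | 1%N => F1 | 2%N => F2 | 3%N => F3 | _ => 'rV[R]_0
  end.

Definition resolution3_map (i : nat) :
    {linear resolution3_module i.+1 -> resolution3_module i} :=
  match i as i
    return {linear resolution3_module i.+1 -> resolution3_module i} with
  | 0%N => d1 | 1%N => d2 | 2%N => d3 | _ => \0
  end.

Lemma resolution3 (M : lmodType R) (pi : {linear R^o -> M}) :
  is_quotient I pi -> has_proj_resolution M 3.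
Proof.
move=> [pi_surj kerpi].
exists resolution3_module, resolution3_map, pi; split; [|split; [|split; [|split]]] => //.
- move=> [|[|[|[|i]]]] //=; first exact: projective_regular_module.
  exact: projective_rV0.
- by move=> [|[|[|[|i]]]] //= v _; exact: thinmx0.
- by move=> v; split=> [/kerpi/im_d1|/im_d1/kerpi].
- move=> [|[|[|i]]] v //=.
    by split=> [/ker_d3 ->|[w wv]]; [exists 0 | rewrite -wv linear0].
  by split=> // _; exists 0; rewrite [v]thinmx0.
Qed.

(** One inequality is used twice: the resolution bounds all regular sequences in [I] from above, and
    the regular sequence [s] bounds all resolutions from below. *)
Lemma perfect_of_resolution3 (s : seq R) : is_ideal I -> ~ I 1 ->
  size s = 3%N -> (forall f, f \in s -> I f) -> regular_seq s ->
  perfect_ideal I /\ grade I 3.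
Proof.
move=> idI I1 sz_s sI reg_s; have [M [pi quotI]] := quotient_exists idI I1.
have res := resolution3 quotI.
have gr : grade I 3.
  split; first by exists s.
  by move=> t tI reg_t; exact: (size_regular_seq_le_projdim quotI I1 res tI reg_t).
split=> //; split=> //; exists M, pi, 3%N; split=> //; split=> // m resm.
by rewrite -sz_s; exact: (size_regular_seq_le_projdim quotI I1 resm sI reg_s).
Qed.

End Length3.
End Resolution.

(** * The linked ideals of a 3 x 3 matrix *)

Definition sum_gen (R : comNzRingType) (e v1 v2 v3 u1 u2 u3 delta f : R) : Prop :=
  exists f1 f2 f3 p1 p2 p3 g,
    f = e * (f1 * v1 + f2 * v2 + f3 * v3) + p1 * u1 + p2 * u2 + p3 * u3 + g * delta.

Lemma sum_gen_ideal (R : comNzRingType) (e v1 v2 v3 u1 u2 u3 delta : R) :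
  is_ideal (sum_gen e v1 v2 v3 u1 u2 u3 delta).
Proof.
split=> [|_ _ [f1 [f2 [f3 [p1 [p2 [p3 [g ->]]]]]]] [h1 [h2 [h3 [q1 [q2 [q3 [h ->]]]]]]]|].
- by exists 0, 0, 0, 0, 0, 0, 0; ring.
- by exists (f1 + h1), (f2 + h2), (f3 + h3), (p1 + q1), (p2 + q2), (p3 + q3), (g + h); ring.
- move=> c _ [f1 [f2 [f3 [p1 [p2 [p3 [g ->]]]]]]].
  by exists (c * f1), (c * f2), (c * f3), (c * p1), (c * p2), (c * p3), (c * g); ring.
Qed.

Section Linkage.
Variable R : comNzRingType.
Variables (e v1 v2 v3 m11 m12 m13 m21 m22 m23 m31 m32 m33 u1 u2 u3 : R).
Hypothesis u1E : u1 = m11 * v1 + m12 * v2 + m13 * v3.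
Hypothesis u2E : u2 = m21 * v1 + m22 * v2 + m23 * v3.
Hypothesis u3E : u3 = m31 * v1 + m32 * v2 + m33 * v3.

Let a11 := m22 * m33 - m23 * m32.
Let a12 := m13 * m32 - m12 * m33.
Let a13 := m12 * m23 - m13 * m22.
Let a21 := m23 * m31 - m21 * m33.
Let a22 := m11 * m33 - m13 * m31.
Let a23 := m13 * m21 - m11 * m23.
Let a31 := m21 * m32 - m22 * m31.
Let a32 := m12 * m31 - m11 * m32.
Let a33 := m11 * m22 - m12 * m21.
Let delta := m11 * a11 + m12 * a21 + m13 * a31.

Hypothesis Kv : koszul_exact v1 v2 v3.
Hypothesis Ku : koszul_exact u1 u2 u3.
Hypothesis Ke : koszul_exact u1 u2 e.
Hypothesis reg_e : regular_mod (@zero_ideal R) e.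
Hypothesis reg_u1 : regular_mod (@zero_ideal R) u1.
Hypothesis reg_u2 : regular_mod (adjoin (@zero_ideal R) u1) u2.

Lemma eq0_trans (t x : R) : x = t -> t = 0 -> x = 0. Proof. by move=> ->. Qed.

(* [combine t] proves x = 0 by writing x as a combination t of left-hand sides
   of equations with right-hand side 0. *)
Definition lhs (x : R) (_ : x = 0) := x.
Lemma lhs0 x (x0 : x = 0) : lhs x0 = 0. Proof. by []. Qed.

Ltac unfold_ring := rewrite /delta /a11 /a12 /a13 /a21 /a22 /a23 /a31 /a32 /a33
  ?u1E ?u2E ?u3E; ring.
Ltac combine t := apply: (@eq0_trans t); [by rewrite /lhs; unfold_ring | by rewrite !lhs0; ring].

(** With the next lemma, the two classical colon formulas for [u = M v]: [(u) : det M = (v)] and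
    [(u) : (v) = (u, det M)]. The matrix [A = (a_ij)] is the adjugate, and [A u = delta v] turns the
    hypothesis into three syzygies of [u], the rows of [g A - v f^T]. *)
Lemma det_colon_span g f1 f2 f3 : g * delta = f1 * u1 + f2 * u2 + f3 * u3 ->
  in_span3 v1 v2 v3 g.
Proof.
have [K3 K2 K1] := Ku.
move=> /eqP; rewrite -subr_eq0 => /eqP gE.
have [|x1 [x2 [x3 [X1 X2 X3]]]] := K1 (g * a11 - v1 * f1) (g * a12 - v1 * f2) (g * a13 - v1 * f3).
  by combine (v1 * lhs gE).
have [|y1 [y2 [y3 [Y1 Y2 Y3]]]] := K1 (g * a21 - v2 * f1) (g * a22 - v2 * f2) (g * a23 - v2 * f3).
  by combine (v2 * lhs gE).
have [|z1 [z2 [z3 [Z1 Z2 Z3]]]] := K1 (g * a31 - v3 * f1) (g * a32 - v3 * f2) (g * a33 - v3 * f3).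
  by combine (v3 * lhs gE).
(* For the rows [A_i] of the adjugate and the first column [M_1] of [M],
   [v3 A_2 - v2 A_3 = u x M_1]. The terms in [f] cancel, so [u x (g M_1 - (v3 y - v2 z)) = 0]; the
   other two columns follow cyclically. *)
have [|||t1 [T11 T12 T13]] := K2 (g * m11 - (v3 * y1 - v2 * z1))
    (g * m21 - (v3 * y2 - v2 * z2)) (g * m31 - (v3 * y3 - v2 * z3)).
- by combine (v3 * lhs Y1 - v2 * lhs Z1).
- by combine (v3 * lhs Y2 - v2 * lhs Z2).
- by combine (v3 * lhs Y3 - v2 * lhs Z3).
have [|||t2 [T21 T22 T23]] := K2 (g * m12 - (v1 * z1 - v3 * x1))
    (g * m22 - (v1 * z2 - v3 * x2)) (g * m32 - (v1 * z3 - v3 * x3)).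
- by combine (v1 * lhs Z1 - v3 * lhs X1).
- by combine (v1 * lhs Z2 - v3 * lhs X2).
- by combine (v1 * lhs Z3 - v3 * lhs X3).
have [|||t3 [T31 T32 T33]] := K2 (g * m13 - (v2 * x1 - v1 * y1))
    (g * m23 - (v2 * x2 - v1 * y2)) (g * m33 - (v2 * x3 - v1 * y3)).
- by combine (v2 * lhs X1 - v1 * lhs Y1).
- by combine (v2 * lhs X2 - v1 * lhs Y2).
- by combine (v2 * lhs X3 - v1 * lhs Y3).
(* Summing the columns against [v] cancels the terms in [x, y, z] and leaves [g u = (t.v) u]. *)
exists t1, t2, t3; apply/eqP; rewrite -subr_eq0; apply/eqP.
apply: K3.
- by combine (v1 * lhs T11 + v2 * lhs T21 + v3 * lhs T31).
- by combine (v1 * lhs T12 + v2 * lhs T22 + v3 * lhs T32).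
- by combine (v1 * lhs T13 + v2 * lhs T23 + v3 * lhs T33).
Qed.

(** If [g v_i = f_i . u], each [v_j f_i - v_i f_j] is a syzygy of [u], hence a cross product with
    [u]. These cross products determine a multiple [c] of [delta]; once [c A] is removed, and up to
    syzygies of [u], the matrix of the [f_i] has the form [v t^T]. *)
Lemma span_colon_det g : in_span3 u1 u2 u3 (g * v1) -> in_span3 u1 u2 u3 (g * v2) ->
  in_span3 u1 u2 u3 (g * v3) ->
  exists f1 f2 f3 c, g = f1 * u1 + f2 * u2 + f3 * u3 + c * delta.
Proof.
have [K3 K2 K1] := Kv; have [_ L2 L1] := Ku.
have norm (a b : R) : a = b -> a - b = 0 by move=> ->; rewrite subrr.
move=> [f11 [f12 [f13 /norm F1]]] [f21 [f22 [f23 /norm F2]]] [f31 [f32 [f33 /norm F3]]].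
have [|x1 [x2 [x3 [X1 X2 X3]]]] := L1 (v3 * f21 - v2 * f31) (v3 * f22 - v2 * f32) (v3 * f23 - v2 * f33).
  by combine (v2 * lhs F3 - v3 * lhs F2).
have [|y1 [y2 [y3 [Y1 Y2 Y3]]]] := L1 (v1 * f31 - v3 * f11) (v1 * f32 - v3 * f12) (v1 * f33 - v3 * f13).
  by combine (v3 * lhs F1 - v1 * lhs F3).
have [|z1 [z2 [z3 [Z1 Z2 Z3]]]] := L1 (v2 * f11 - v1 * f21) (v2 * f12 - v1 * f22) (v2 * f13 - v1 * f23).
  by combine (v1 * lhs F2 - v2 * lhs F1).
(* Origin of the coefficient of [delta]: combined with [v1, v2, v3] the three syzygies cancel, so
   [v1 x + v2 y + v3 z] is a multiple [c u = c M v]. *)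
have [|||c [C1 C2 C3]] := L2 (v1 * x1 + v2 * y1 + v3 * z1) (v1 * x2 + v2 * y2 + v3 * z2) (v1 * x3 + v2 * y3 + v3 * z3).
- by combine (- v1 * lhs X1 - v2 * lhs Y1 - v3 * lhs Z1).
- by combine (- v1 * lhs X2 - v2 * lhs Y2 - v3 * lhs Z2).
- by combine (- v1 * lhs X3 - v2 * lhs Y3 - v3 * lhs Z3).
have [|p1 [q1 [r1 [P1 Q1 R1]]]] := K1 (x1 - c * m11) (y1 - c * m12) (z1 - c * m13).
  by combine (lhs C1).
have [|p2 [q2 [r2 [P2 Q2 R2]]]] := K1 (x2 - c * m21) (y2 - c * m22) (z2 - c * m23).
  by combine (lhs C2).
have [|p3 [q3 [r3 [P3 Q3 R3]]]] := K1 (x3 - c * m31) (y3 - c * m32) (z3 - c * m33).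
  by combine (lhs C3).
have [|||t1 [T11 T12 T13]] := K2 (f11 - c * a11 + (u2 * p3 - u3 * p2))
    (f21 - c * a21 + (u2 * q3 - u3 * q2)) (f31 - c * a31 + (u2 * r3 - u3 * r2)).
- by combine (- lhs X1 - u2 * lhs P3 + u3 * lhs P2).
- by combine (- lhs Y1 - u2 * lhs Q3 + u3 * lhs Q2).
- by combine (- lhs Z1 - u2 * lhs R3 + u3 * lhs R2).
have [|||t2 [T21 T22 T23]] := K2 (f12 - c * a12 + (u3 * p1 - u1 * p3))
    (f22 - c * a22 + (u3 * q1 - u1 * q3)) (f32 - c * a32 + (u3 * r1 - u1 * r3)).
- by combine (- lhs X2 - u3 * lhs P1 + u1 * lhs P3).
- by combine (- lhs Y2 - u3 * lhs Q1 + u1 * lhs Q3).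
- by combine (- lhs Z2 - u3 * lhs R1 + u1 * lhs R3).
have [|||t3 [T31 T32 T33]] := K2 (f13 - c * a13 + (u1 * p2 - u2 * p1))
    (f23 - c * a23 + (u1 * q2 - u2 * q1)) (f33 - c * a33 + (u1 * r2 - u2 * r1)).
- by combine (- lhs X3 - u1 * lhs P2 + u2 * lhs P1).
- by combine (- lhs Y3 - u1 * lhs Q2 + u2 * lhs Q1).
- by combine (- lhs Z3 - u1 * lhs R2 + u2 * lhs R1).
exists t1, t2, t3, c; apply/eqP; rewrite -subr_eq0; apply/eqP; apply: K3.
- by combine (lhs F1 + u1 * lhs T11 + u2 * lhs T21 + u3 * lhs T31).
- by combine (lhs F2 + u1 * lhs T12 + u2 * lhs T22 + u3 * lhs T32).
- by combine (lhs F3 + u1 * lhs T13 + u2 * lhs T23 + u3 * lhs T33).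
Qed.

Lemma ideal_gen_nil (f : R) : ideal_gen [::] f <-> f = 0.
Proof. by split=> [[c ->]|->]; [rewrite big_ord0 | exists (fun=> 0); rewrite big_ord0]. Qed.

Lemma ideal_gen_cons a s (f : R) :
  ideal_gen (a :: s) f <-> exists c, ideal_gen s (f - c * a).
Proof.
split=> [[c ->]|[c0 [c fE]]].
  exists (c 0%N); exists (fun i => c i.+1).
  by rewrite big_ord_recl /= addrAC subrr add0r.
exists (fun i => if i is i'.+1 then c i' else c0).
by rewrite big_ord_recl /= -fE addrC subrK.
Qed.

Definition linked_I : R -> Prop := fun f => exists f1 f2 f3 p q,
  f = e * (f1 * v1 + f2 * v2 + f3 * v3) + p * u1 + q * u2.
Definition linked_J : R -> Prop := fun f => exists f1 f2 f3 g,
  f = f1 * u1 + f2 * u2 + f3 * u3 + g * delta.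
Definition link_seq := [:: u1; u2; e * u3].

Lemma linked_I_ideal : is_ideal linked_I.
Proof.
split=> [|_ _ [f1 [f2 [f3 [p [q ->]]]]] [g1 [g2 [g3 [r [t ->]]]]]|g _ [f1 [f2 [f3 [p [q ->]]]]]].
- by exists 0, 0, 0, 0, 0; ring.
- by exists (f1 + g1), (f2 + g2), (f3 + g3), (p + r), (q + t); ring.
- by exists (g * f1), (g * f2), (g * f3), (g * p), (g * q); ring.
Qed.

Lemma linked_J_ideal : is_ideal linked_J.
Proof.
split=> [|_ _ [f1 [f2 [f3 [p ->]]]] [g1 [g2 [g3 [r ->]]]]|g _ [f1 [f2 [f3 [p ->]]]]].
- by exists 0, 0, 0, 0; ring.
- by exists (f1 + g1), (f2 + g2), (f3 + g3), (p + r); ring.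
- by exists (g * f1), (g * f2), (g * f3), (g * p); ring.
Qed.

Lemma link_seqP f : ideal_gen link_seq f <->
  exists p q r, f = p * u1 + q * u2 + r * (e * u3).
Proof.
split=> [/ideal_gen_cons[p /ideal_gen_cons[q /ideal_gen_cons[r /ideal_gen_nil fE]]]|].
  by exists p, q, r; apply/eqP; rewrite -subr_eq0 -fE; apply/eqP; ring.
move=> [p [q [r ->]]]; apply/ideal_gen_cons; exists p; apply/ideal_gen_cons; exists q.
by apply/ideal_gen_cons; exists r; apply/ideal_gen_nil; ring.
Qed.

(** A syzygy of [(u1, u2, e)] is a cross product with it, so its last entry lies in [(u1, u2)]. *)
Lemma e_regular_mod_u12 f p q : e * f = p * u1 + q * u2 ->
  exists p' q', f = p' * u1 + q' * u2.
Proof.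
move=> fE; have [_ _ /(_ p q (- f))[]] := Ke.
  by rewrite /zero_ideal -fE; ring.
move=> g1 [g2 [g3 [_ _ fg]]]; exists (- g2), g1; apply/eqP; rewrite -subr_eq0.
by apply/eqP; combine (- lhs fg).
Qed.

Lemma u3_regular_mod_u12 f p q : u3 * f = p * u1 + q * u2 ->
  exists p' q', f = p' * u1 + q' * u2.
Proof.
move=> fE; have [_ _ /(_ p q (- f))[]] := Ku.
  by rewrite /zero_ideal -fE; ring.
move=> g1 [g2 [g3 [_ _ fg]]]; exists (- g2), g1; apply/eqP; rewrite -subr_eq0.
by apply/eqP; combine (- lhs fg).
Qed.

Hypothesis linked_I1 : ~ linked_I 1.
Hypothesis linked_J1 : ~ linked_J 1.

Lemma link_seq_sub_I f : f \in link_seq -> linked_I f.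
Proof.
rewrite !inE => /or3P[] /eqP->.
- by exists 0, 0, 0, 1, 0; ring.
- by exists 0, 0, 0, 0, 1; ring.
- by exists m31, m32, m33, 0, 0; rewrite u3E; ring.
Qed.

Lemma link_seq_sub_J f : f \in link_seq -> linked_J f.
Proof.
rewrite !inE => /or3P[] /eqP->.
- by exists 1, 0, 0, 0; ring.
- by exists 0, 1, 0, 0; ring.
- by exists 0, 0, e, 0; ring.
Qed.

Lemma link_seq_regular : regular_seq link_seq.
Proof.
split=> [/link_seqP[p [q [r E]]]|].
  by apply: linked_J1; exists p, q, (r * e), 0; rewrite E; ring.
move=> [|[|[|i]]] //= _ f.
- by move=> /ideal_gen_nil E; apply/ideal_gen_nil; apply: reg_u1.
- move=> /ideal_gen_cons[p /ideal_gen_nil E].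
  have [|g fg] := reg_u2 (f := f); first by exists p; rewrite /zero_ideal [u1 * p]mulrC.
  by apply/ideal_gen_cons; exists g; apply/ideal_gen_nil; rewrite [g * _]mulrC.
- move=> /ideal_gen_cons[p /ideal_gen_cons[q /ideal_gen_nil E]].
  have [|p' [q' /u3_regular_mod_u12[p'' [q'' ->]]]] := @e_regular_mod_u12 (u3 * f) p q.
    by apply/eqP; rewrite -subr_eq0 -E; apply/eqP; ring.
  apply/ideal_gen_cons; exists p''; apply/ideal_gen_cons; exists q''.
  by apply/ideal_gen_nil; ring.
Qed.

(** Since [u3] is in [J], [f = r e] modulo [(u1, u2)]. Since [delta] is in [J], cancelling [e] gives
    [r delta] in [(u)], so [r] is in [(v)] by [det_colon_span]. *)
Lemma link_colon_J f : ideal_colon (ideal_gen link_seq) linked_J f <-> linked_I f.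
Proof.
split=> [fJ|[f1 [f2 [f3 [p [q ->]]]]] _ [g1 [g2 [g3 [g ->]]]]].
  have /link_seqP[p [q [r E]]] : ideal_gen link_seq (f * u3).
    by apply: fJ; exists 0, 0, 1, 0; ring.
  have [|p1 [q1 fE]] := @u3_regular_mod_u12 (f - r * e) p q.
    by rewrite mulrBr [u3 * f]mulrC E; ring.
  have /link_seqP[x [y [z D]]] : ideal_gen link_seq (f * delta).
    by apply: fJ; exists 0, 0, 0, 1; ring.
  have [|x' [y' D']] := @e_regular_mod_u12 (r * delta - z * u3) (x - p1 * delta) (y - q1 * delta).
    apply/eqP; rewrite -subr_eq0; apply/eqP; move/eqP: D; rewrite -subr_eq0 => /eqP D.
    by move/eqP: fE; rewrite -subr_eq0 => /eqP fE; combine (lhs D - delta * lhs fE).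
  have [|w1 [w2 [w3 rE]]] := @det_colon_span r x' y' z.
    by rewrite -D'; ring.
  exists w1, w2, w3, p1, q1; apply/eqP; rewrite -subr_eq0; apply/eqP.
  by rewrite -rE -(subrK (r * e) f) fE; ring.
apply/link_seqP.
(* The coefficients come from [delta v_i = a_i1 u1 + a_i2 u2 + a_i3 u3]. *)
exists ((f1 * v1 + f2 * v2 + f3 * v3) * e * g1 + g * e * (f1 * a11 + f2 * a21 + f3 * a31) + p * (g1 * u1 + g2 * u2 + g3 * u3 + g * delta)).
exists ((f1 * v1 + f2 * v2 + f3 * v3) * e * g2 + g * e * (f1 * a12 + f2 * a22 + f3 * a32) + q * (g1 * u1 + g2 * u2 + g3 * u3 + g * delta)).
exists ((f1 * v1 + f2 * v2 + f3 * v3) * g3 + g * (f1 * a13 + f2 * a23 + f3 * a33)).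
by unfold_ring.
Qed.

(** The inclusion of [J] is [link_colon_J] read backwards. Conversely, [e v_i] in [I] gives [f v_i]
    in [(u)] once [e] is cancelled modulo [(u1, u2)], and [span_colon_det] applies. *)
Lemma link_colon_I f : ideal_colon (ideal_gen link_seq) linked_I f <-> linked_J f.
Proof.
split=> [fI|fJ g Ig]; last first.
  by rewrite mulrC; have /link_colon_J := Ig; apply.
have key x y z : in_span3 u1 u2 u3 (f * (x * v1 + y * v2 + z * v3)).
  have /link_seqP[p [q [r E]]] : ideal_gen link_seq (f * (e * (x * v1 + y * v2 + z * v3))).
    by apply: fI; exists x, y, z, 0, 0; ring.
  have [|p' [q' E']] := @e_regular_mod_u12 (f * (x * v1 + y * v2 + z * v3) - r * u3) p q.
    by rewrite mulrBr mulrCA E; ring.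
  by exists p', q', r; rewrite -E'; ring.
have [|||f1 [f2 [f3 [c ->]]]] := @span_colon_det f; last by exists f1, f2, f3, c.
- by have := key 1 0 0; congr (in_span3 _ _ _ _); ring.
- by have := key 0 1 0; congr (in_span3 _ _ _ _); ring.
- by have := key 0 0 1; congr (in_span3 _ _ _ _); ring.
Qed.

Local Notation Ro := (R^o : lmodType R).

(** The mapping cone of the dual of the map that [M] induces from the Koszul complex of [u] to that
    of [v], with the two copies of [R] at its end cancelled. It is a complex because
    [cof(M) (v x l) = M v x M l], where [cof(M)] is the transposed adjugate. *)
Definition J_map1 (w : Ro * Ro * Ro * Ro) : Ro :=
  let: (f1, f2, f3, g) := w in f1 * u1 + f2 * u2 + f3 * u3 + g * delta.
Definition J_map2 (w : Ro * Ro * Ro * Ro * Ro * Ro) : Ro * Ro * Ro * Ro :=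
  let: (h1, h2, h3, k1, k2, k3) := w in
  (u2 * k3 - u3 * k2 - (h1 * a11 + h2 * a21 + h3 * a31),
   u3 * k1 - u1 * k3 - (h1 * a12 + h2 * a22 + h3 * a32),
   u1 * k2 - u2 * k1 - (h1 * a13 + h2 * a23 + h3 * a33),
   h1 * v1 + h2 * v2 + h3 * v3).
Definition J_map3 (w : Ro * Ro * Ro) : Ro * Ro * Ro * Ro * Ro * Ro :=
  let: (l1, l2, l3) := w in
  (v2 * l3 - v3 * l2, v3 * l1 - v1 * l3, v1 * l2 - v2 * l1,
   m11 * l1 + m12 * l2 + m13 * l3, m21 * l1 + m22 * l2 + m23 * l3,
   m31 * l1 + m32 * l2 + m33 * l3).

Fact J_map1_is_linear : linear J_map1.
Proof. by move=> c [[[? ?] ?] ?] [[[? ?] ?] ?]; rewrite /J_map1 /= /GRing.scale /=; ring. Qed.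
Fact J_map2_is_linear : linear J_map2.
Proof.
by move=> c [[[[[? ?] ?] ?] ?] ?] [[[[[? ?] ?] ?] ?] ?]; rewrite /J_map2 /=;
   congr (_, _, _, _); rewrite /= /GRing.scale /=; ring.
Qed.
Fact J_map3_is_linear : linear J_map3.
Proof.
move=> c [[? ?] ?] [[? ?] ?]; rewrite /J_map3.
do 5 (apply: injective_projections; last by rewrite /= /GRing.scale /=; ring).
by rewrite /= /GRing.scale /=; ring.
Qed.
HB.instance Definition _ := GRing.isLinear.Build R _ _ _ J_map1 J_map1_is_linear.
HB.instance Definition _ := GRing.isLinear.Build R _ _ _ J_map2 J_map2_is_linear.
HB.instance Definition _ := GRing.isLinear.Build R _ _ _ J_map3 J_map3_is_linear.

(** Here [k] carries the Koszul relations of [v] and [g] those of [(u1, u2, e)], in which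
    [g2 u1 - g1 u2] is spread over [v] by the first two rows [M_1], [M_2] of [M]. The product
    [M_1 x M_2] enters [I_map3] because [v x (M_1 x M_2) = u2 M_1 - u1 M_2]. *)
Definition I_map1 (w : Ro * Ro * Ro * Ro * Ro) : Ro :=
  let: (f1, f2, f3, p, q) := w in
  e * (f1 * v1 + f2 * v2 + f3 * v3) + p * u1 + q * u2.
Definition I_map2 (w : Ro * Ro * Ro * Ro * Ro * Ro) : Ro * Ro * Ro * Ro * Ro :=
  let: (k1, k2, k3, g1, g2, g3) := w in
  (v2 * k3 - v3 * k2 + g2 * m11 - g1 * m21,
   v3 * k1 - v1 * k3 + g2 * m12 - g1 * m22,
   v1 * k2 - v2 * k1 + g2 * m13 - g1 * m23,
   u2 * g3 - e * g2, e * g1 - u1 * g3).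
Definition I_map3 (w : Ro * Ro) : Ro * Ro * Ro * Ro * Ro * Ro :=
  let: (t, r) := w in
  (r * v1 - t * (m12 * m23 - m13 * m22), r * v2 - t * (m13 * m21 - m11 * m23),
   r * v3 - t * (m11 * m22 - m12 * m21), t * u1, t * u2, t * e).

Fact I_map1_is_linear : linear I_map1.
Proof. by move=> c [[[[? ?] ?] ?] ?] [[[[? ?] ?] ?] ?]; rewrite /I_map1 /= /GRing.scale /=; ring. Qed.
Fact I_map2_is_linear : linear I_map2.
Proof.
by move=> c [[[[[? ?] ?] ?] ?] ?] [[[[[? ?] ?] ?] ?] ?]; rewrite /I_map2 /=;
   congr (_, _, _, _, _); rewrite /= /GRing.scale /=; ring.
Qed.
Fact I_map3_is_linear : linear I_map3.
Proof.
move=> c [? ?] [? ?]; rewrite /I_map3.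
do 5 (apply: injective_projections; last by rewrite /= /GRing.scale /=; ring).
by rewrite /= /GRing.scale /=; ring.
Qed.
HB.instance Definition _ := GRing.isLinear.Build R _ _ _ I_map1 I_map1_is_linear.
HB.instance Definition _ := GRing.isLinear.Build R _ _ _ I_map2 I_map2_is_linear.
HB.instance Definition _ := GRing.isLinear.Build R _ _ _ I_map3 I_map3_is_linear.

Let norm (a b : R) : a = b -> a - b = 0. Proof. by move=> ->; rewrite subrr. Qed.
Let unnorm (a b : R) : a - b = 0 -> a = b. Proof. by move=> /eqP; rewrite subr_eq0 => /eqP. Qed.

Lemma J_exact1 (f1 f2 f3 g : R) : f1 * u1 + f2 * u2 + f3 * u3 + g * delta = 0 ->
  exists h1 h2 h3 k1 k2 k3 : R, J_map2 (h1, h2, h3, k1, k2, k3) = (f1, f2, f3, g).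
Proof.
move=> E; have [|h1 [h2 [h3 gE]]] := @det_colon_span g (- f1) (- f2) (- f3).
  by apply: unnorm; combine (lhs E).
have [_ _ K1] := Ku; have gE' := norm gE.
have [|k1 [k2 [k3 [X1 X2 X3]]]] := K1 (f1 + (h1 * a11 + h2 * a21 + h3 * a31))
    (f2 + (h1 * a12 + h2 * a22 + h3 * a32)) (f3 + (h1 * a13 + h2 * a23 + h3 * a33)).
  by combine (lhs E - delta * lhs gE').
exists h1, h2, h3, k1, k2, k3; rewrite /J_map2 -gE.
congr (_, _, _, _); apply/esym; apply: unnorm.
- by combine (lhs X1).
- by combine (lhs X2).
- by combine (lhs X3).
Qed.

Lemma J_exact2 (h1 h2 h3 k1 k2 k3 : R) : J_map2 (h1, h2, h3, k1, k2, k3) = 0 ->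
  exists l1 l2 l3 : R, J_map3 (l1, l2, l3) = (h1, h2, h3, k1, k2, k3).
Proof.
move=> [E1 E2 E3 E4]; have [_ _ K1] := Kv; have [_ L2 _] := Ku.
have [l1 [l2 [l3 [X1 X2 X3]]]] := K1 h1 h2 h3 E4.
have [|||t [Y1 Y2 Y3]] := L2 (k1 - (m11 * l1 + m12 * l2 + m13 * l3))
  (k2 - (m21 * l1 + m22 * l2 + m23 * l3)) (k3 - (m31 * l1 + m32 * l2 + m33 * l3)).
- by combine (lhs E1 + a11 * lhs X1 + a21 * lhs X2 + a31 * lhs X3).
- by combine (lhs E2 + a12 * lhs X1 + a22 * lhs X2 + a32 * lhs X3).
- by combine (lhs E3 + a13 * lhs X1 + a23 * lhs X2 + a33 * lhs X3).
exists (l1 + t * v1), (l2 + t * v2), (l3 + t * v3); rewrite /J_map3.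
congr (_, _, _, _, _, _); apply/esym; apply: unnorm.
- by combine (lhs X1).
- by combine (lhs X2).
- by combine (lhs X3).
- by combine (lhs Y1).
- by combine (lhs Y2).
- by combine (lhs Y3).
Qed.

Lemma J_exact3 (l1 l2 l3 : R) : J_map3 (l1, l2, l3) = 0 -> (l1, l2, l3) = 0 :> Ro * Ro * Ro.
Proof.
move=> [E1 E2 E3 E4 E5 E6]; have [_ K2 _] := Kv; have [L3 _ _] := Ku.
have [t [X1 X2 X3]] := K2 l1 l2 l3 E1 E2 E3.
have t0 : t = 0.
  apply: L3.
  - by combine (lhs E4 - m11 * lhs X1 - m12 * lhs X2 - m13 * lhs X3).
  - by combine (lhs E5 - m21 * lhs X1 - m22 * lhs X2 - m23 * lhs X3).
  - by combine (lhs E6 - m31 * lhs X1 - m32 * lhs X2 - m33 * lhs X3).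
congr (_, _, _).
- by combine (lhs X1 + lhs t0 * v1).
- by combine (lhs X2 + lhs t0 * v2).
- by combine (lhs X3 + lhs t0 * v3).
Qed.

Lemma I_exact1 (f1 f2 f3 p q : R) :
  e * (f1 * v1 + f2 * v2 + f3 * v3) + p * u1 + q * u2 = 0 ->
  exists k1 k2 k3 g1 g2 g3 : R, I_map2 (k1, k2, k3, g1, g2, g3) = (f1, f2, f3, p, q).
Proof.
move=> E; have [_ _ K1] := Ke; have [_ _ L1] := Kv.
have [|g1 [g2 [g3 [X1 X2 X3]]]] := K1 p q (f1 * v1 + f2 * v2 + f3 * v3).
  by combine (lhs E).
have [|k1 [k2 [k3 [Y1 Y2 Y3]]]] := L1 (f1 - g2 * m11 + g1 * m21)
    (f2 - g2 * m12 + g1 * m22) (f3 - g2 * m13 + g1 * m23).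
  by combine (lhs X3).
exists k1, k2, k3, g1, g2, g3; rewrite /I_map2.
congr (_, _, _, _, _); apply/esym; apply: unnorm.
- by combine (lhs Y1).
- by combine (lhs Y2).
- by combine (lhs Y3).
- by combine (lhs X1).
- by combine (lhs X2).
Qed.

Lemma I_exact2 (k1 k2 k3 g1 g2 g3 : R) : I_map2 (k1, k2, k3, g1, g2, g3) = 0 ->
  exists t r : R, I_map3 (t, r) = (k1, k2, k3, g1, g2, g3).
Proof.
move=> [E1 E2 E3 E4 E5]; have [_ K2 _] := Ke; have [_ L2 _] := Kv.
have [|||t [X1 X2 X3]] := K2 g1 g2 g3.
- by combine (lhs E4).
- by combine (lhs E5).
- by combine (v1 * lhs E1 + v2 * lhs E2 + v3 * lhs E3).
have [|||r [Y1 Y2 Y3]] := L2 (k1 + t * (m12 * m23 - m13 * m22))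
    (k2 + t * (m13 * m21 - m11 * m23)) (k3 + t * (m11 * m22 - m12 * m21)).
- by combine (lhs E1 - m11 * lhs X2 + m21 * lhs X1).
- by combine (lhs E2 - m12 * lhs X2 + m22 * lhs X1).
- by combine (lhs E3 - m13 * lhs X2 + m23 * lhs X1).
exists t, r; rewrite /I_map3; congr (_, _, _, _, _, _); apply/esym; apply: unnorm.
- by combine (lhs Y1).
- by combine (lhs Y2).
- by combine (lhs Y3).
- by combine (lhs X1).
- by combine (lhs X2).
- by combine (lhs X3).
Qed.

Lemma I_exact3 (t r : R) : I_map3 (t, r) = 0 -> (t, r) = 0 :> Ro * Ro.
Proof.
move=> [E1 E2 E3 E4 E5 E6]; have [L3 _ _] := Kv.
have t0 : t = 0 by apply: reg_e; combine (lhs E6).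
have r0 : r = 0.
  apply: L3.
  - by combine (lhs E1 + (m12 * m23 - m13 * m22) * lhs t0).
  - by combine (lhs E2 + (m13 * m21 - m11 * m23) * lhs t0).
  - by combine (lhs E3 + (m11 * m22 - m12 * m21) * lhs t0).
by rewrite t0 r0.
Qed.

Lemma J_complex1 (h1 h2 h3 k1 k2 k3 : R) : J_map1 (J_map2 (h1, h2, h3, k1, k2, k3)) = 0.
Proof. by rewrite /J_map1 /=; unfold_ring. Qed.

Lemma J_complex2 (l1 l2 l3 : R) : J_map2 (J_map3 (l1, l2, l3)) = 0.
Proof. by rewrite /J_map2 /=; congr (_, _, _, _); unfold_ring. Qed.

Lemma I_complex1 (k1 k2 k3 g1 g2 g3 : R) : I_map1 (I_map2 (k1, k2, k3, g1, g2, g3)) = 0.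
Proof. by rewrite /I_map1 /=; unfold_ring. Qed.

Lemma I_complex2 (t r : R) : I_map2 (I_map3 (t, r)) = 0.
Proof. by rewrite /I_map2 /=; congr (_, _, _, _, _); unfold_ring. Qed.

Lemma linked_J_perfect : perfect_ideal linked_J /\ grade linked_J 3.
Proof.
have pR := @projective_regular_module R.
apply: (@perfect_of_resolution3 _ _ _ _ _ J_map1 J_map2 J_map3 _ _ _ _ _ _ _ link_seq) => //.
- by do !apply: projective_prod.
- by do !apply: projective_prod.
- by do !apply: projective_prod.
- move=> f; split=> [[f1 [f2 [f3 [g ->]]]]|[[[[f1 f2] f3] g] <-]].
    by exists (f1, f2, f3, g).
  by exists f1, f2, f3, g.
- move=> [[[f1 f2] f3] g]; split=> [/J_exact1[h1 [h2 [h3 [k1 [k2 [k3 E]]]]]]|].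
    by exists (h1, h2, h3, k1, k2, k3).
  by move=> [[[[[[h1 h2] h3] k1] k2] k3] <-]; exact: J_complex1.
- move=> [[[[[h1 h2] h3] k1] k2] k3]; split=> [/J_exact2[l1 [l2 [l3 E]]]|].
    by exists (l1, l2, l3).
  by move=> [[[l1 l2] l3] <-]; exact: J_complex2.
- by move=> [[l1 l2] l3] /J_exact3.
- exact: linked_J_ideal.
- exact: link_seq_sub_J.
- exact: link_seq_regular.
Qed.

Lemma linked_I_perfect : perfect_ideal linked_I /\ grade linked_I 3.
Proof.
have pR := @projective_regular_module R.
apply: (@perfect_of_resolution3 _ _ _ _ _ I_map1 I_map2 I_map3 _ _ _ _ _ _ _ link_seq) => //.
- by do !apply: projective_prod.
- by do !apply: projective_prod.
- by do !apply: projective_prod.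
- move=> f; split=> [[f1 [f2 [f3 [p [q ->]]]]]|[[[[[f1 f2] f3] p] q] <-]].
    by exists (f1, f2, f3, p, q).
  by exists f1, f2, f3, p, q.
- move=> [[[[f1 f2] f3] p] q]; split=> [/I_exact1[h1 [h2 [h3 [k1 [k2 [k3 E]]]]]]|].
    by exists (h1, h2, h3, k1, k2, k3).
  by move=> [[[[[[h1 h2] h3] k1] k2] k3] <-]; exact: I_complex1.
- move=> [[[[[h1 h2] h3] k1] k2] k3]; split=> [/I_exact2[t [r E]]|].
    by exists (t, r).
  by move=> [[t r] <-]; exact: I_complex2.
- by move=> [t r] /I_exact3.
- exact: linked_I_ideal.
- exact: link_seq_sub_I.
- exact: link_seq_regular.
Qed.

Lemma linked_I_J : linked linked_I linked_J.
Proof.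
exists 3%N; split; [exact: (proj2 linked_I_perfect) | exact: (proj2 linked_J_perfect) |].
exists link_seq; split=> //.
- by move=> f fs; split; [exact: link_seq_sub_I | exact: link_seq_sub_J].
- exact: link_seq_regular.
- exact: link_colon_I.
- exact: link_colon_J.
Qed.

Lemma linked_sumP f :
  ideal_add linked_I linked_J f <-> sum_gen e v1 v2 v3 u1 u2 u3 delta f.
Proof.
split.
  move=> [_ [_ [[f1 [f2 [f3 [p [q ->]]]]] [g1 [g2 [g3 [g ->]]]] ->]]].
  by exists f1, f2, f3, (p + g1), (q + g2), g3, g; ring.
move=> [f1 [f2 [f3 [p1 [p2 [p3 [g ->]]]]]]].
exists (e * (f1 * v1 + f2 * v2 + f3 * v3) + p1 * u1 + p2 * u2), (p3 * u3 + g * delta).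
by split; [exists f1, f2, f3, p1, p2 | exists 0, 0, p3, g; ring | ring].
Qed.

End Linkage.

(** * Regular sequences of monic polynomials *)

Section PolyExt.
Variable E : comNzRingType.
Implicit Types (I : E -> Prop) (p q h : {poly E}).

Definition poly_ext I : {poly E} -> Prop := fun p => forall i, I p`_i.

Lemma poly_ext_zero : poly_ext (@zero_ideal E) = @zero_ideal {poly E}.
Proof.
apply/funext=> p; apply/propext; split=> [p0|-> i]; last exact: coef0.
by apply/polyP => i; rewrite coef0 p0.
Qed.

Lemma adjoin_poly_ext I c : is_ideal I ->
  adjoin (poly_ext I) c%:P = poly_ext (adjoin I c).
Proof.
move=> [I0 _ _]; apply/funext=> p; apply/propext; split=> [[q Iq] i|].
  by exists q`_i; have := Iq i; rewrite coefB coefCM.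
move=> /choice[b Ib]; exists (\poly_(i < size p) b i) => i.
rewrite coefB coefCM coef_poly; case: ltnP => // le_pi.
by rewrite nth_default // mulr0 subr0.
Qed.

Lemma regular_mod_polyC I c : regular_mod I c -> regular_mod (poly_ext I) c%:P.
Proof. by move=> reg p Ip i; apply: reg; have := Ip i; rewrite coefCM. Qed.

(** Descending induction on coefficients: if [h] has degree [n], the coefficient of [h q] in degree
    [n + i] is [q_i] plus multiples of the [q_j] with [j > i]. *)
Lemma regular_mod_monic I h : is_ideal I -> h \is monic ->
  regular_mod (poly_ext I) h.
Proof.
move=> [I0 ID IM] /monicP h1 q Ihq.
have n_gt0 : (0 < size h)%N.
  by rewrite lt0n size_poly_eq0; apply/eqP => h0; move/eqP: h1; rewrite h0 lead_coef0 eq_sym oner_eq0.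
have IN f : I f -> I (- f) by rewrite -mulN1r; apply: IM.
have Isum (J : finType) (P : pred J) (F : J -> E) :
    (forall j, P j -> I (F j)) -> I (\sum_(j | P j) F j).
  by move=> IF; elim/big_ind: _.
suff ind d i : (size q <= i + d)%N -> I q`_i by move=> i; apply: (ind (size q)); rewrite leq_addl.
elim: d i => [|d IHd] i lt_qi; first by rewrite addn0 in lt_qi; rewrite nth_default.
have := Ihq ((size h).-1 + i)%N; rewrite coefM.
have lt_n : ((size h).-1 < ((size h).-1 + i).+1)%N by rewrite ltnS leq_addr.
rewrite (bigD1 (Ordinal lt_n)) //= -/(lead_coef h) h1 mul1r addKn => Iq.
rewrite -[q`_i](addrK (\sum_(j < ((size h).-1 + i).+1 | j != Ordinal lt_n) h`_j * q`_((size h).-1 + i - j))).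
apply: ID => //; apply: IN; apply: Isum => j ne_jn.
have [lt_hj|le_jh] := ltnP (size h).-1 j.
  by rewrite [h`_j]nth_default ?mul0r //; rewrite prednK in lt_hj.
apply: IM; apply: IHd.
have {ne_jn}lt_jh : (j < (size h).-1)%N by rewrite ltn_neqAle le_jh andbT.
rewrite -addSnnS in lt_qi; apply: leq_trans lt_qi _; rewrite leq_add2r.
by rewrite ltn_subRL ltn_add2r.
Qed.

End PolyExt.

Section Iso.
Variables (A R : comNzRingType) (eta : {rmorphism A -> R}) (theta : {rmorphism R -> A}).
Hypotheses (etaK : cancel eta theta) (thetaK : cancel theta eta).

Definition pull (I : A -> Prop) : R -> Prop := fun f => I (theta f).

Lemma pull_zero : pull (@zero_ideal A) = @zero_ideal R.
Proof.
apply/funext=> f; apply/propext; rewrite /pull /zero_ideal; split=> [f0|->].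
  by rewrite -[f]thetaK f0 rmorph0.
exact: rmorph0.
Qed.

Lemma adjoin_pull I a : adjoin (pull I) (eta a) = pull (adjoin I a).
Proof.
apply/funext=> f; apply/propext; split=> -[g Ig].
  by exists (theta g); move: Ig; rewrite /pull rmorphB rmorphM /= etaK.
by exists (eta g); rewrite /pull rmorphB rmorphM /= !etaK.
Qed.

Lemma regular_mod_pull I a : regular_mod I a -> regular_mod (pull I) (eta a).
Proof. by move=> reg f; rewrite /pull rmorphM /= etaK; apply: reg. Qed.

End Iso.

Section MonicSequences.
Variables (D : idomainType) (R : comNzRingType).
Variables (eta : {rmorphism {poly {poly D}} -> R}) (theta : {rmorphism R -> {poly {poly D}}}).
Hypotheses (etaK : cancel eta theta) (thetaK : cancel theta eta).

(** [R] is [D[S][T]] through [eta], with [S] the inner and [T] the outer variable. For [N] nonzero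
    in [D] and [g], [h] monic, each of [N], [g(S)], [h(T)] is regular modulo the preceding ones. *)
Definition cst (c : D) : R := eta c%:P%:P.
Definition evalS (g : {poly D}) : R := eta g%:P.
Definition evalT (h : {poly D}) : R := eta (map_poly polyC h).
HB.instance Definition _ := GRing.RMorphism.copy cst (eta \o polyC \o polyC).
HB.instance Definition _ := GRing.RMorphism.copy evalS (eta \o polyC).
HB.instance Definition _ := GRing.RMorphism.copy evalT (eta \o map_poly polyC).

Let zeroR := @zero_ideal R.

Let zero_pull : zeroR = pull theta (poly_ext (poly_ext (@zero_ideal D))).
Proof. by rewrite !poly_ext_zero (pull_zero thetaK). Qed.

Lemma regular_cst N : N != 0 -> regular_mod zeroR (cst N).
Proof.
move=> N0; rewrite zero_pull; apply: (regular_mod_pull etaK).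
do 2 apply: regular_mod_polyC.
by move=> f /eqP; rewrite mulf_eq0 (negPf N0) => /eqP.
Qed.

Lemma poly_ext_ideal (E : comNzRingType) (I : E -> Prop) : is_ideal I -> is_ideal (poly_ext I).
Proof.
move=> [I0 ID IM]; split=> [i|p q Ip Iq i|p q Iq i].
- by rewrite coef0.
- by rewrite coefD; apply: ID.
- by rewrite coefM; elim/big_ind: _ => // j _; apply: IM.
Qed.

Let id0 : is_ideal (@zero_ideal D). Proof. exact: zero_ideal_ideal. Qed.
Let id1 : is_ideal (poly_ext (@zero_ideal D)). Proof. exact: poly_ext_ideal. Qed.

Lemma regular_evalS_mod N g : g \is monic -> regular_mod (adjoin zeroR (cst N)) (evalS g).
Proof.
move=> g1; rewrite zero_pull (adjoin_pull etaK) !adjoin_poly_ext //.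
apply: (regular_mod_pull etaK); apply: regular_mod_polyC.
by apply: regular_mod_monic => //; apply: adjoin_ideal.
Qed.

Lemma regular_evalT_mod N g h : h \is monic ->
  regular_mod (adjoin (adjoin zeroR (cst N)) (evalS g)) (evalT h).
Proof.
have id2 : is_ideal (poly_ext (adjoin (@zero_ideal D) N)).
  by apply: poly_ext_ideal; apply: adjoin_ideal.
move=> h1; rewrite zero_pull !(adjoin_pull etaK) !adjoin_poly_ext //.
apply: (regular_mod_pull etaK); apply: regular_mod_monic; last exact: monic_map.
exact: adjoin_ideal.
Qed.

Let S := evalS 'X.
Let T := evalT 'X.

Lemma evalSC c : evalS c%:P = cst c. Proof. by []. Qed.
Lemma evalTC c : evalT c%:P = cst c.
Proof. by rewrite /evalT map_polyC. Qed.

Section Quadrics.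
Variables (b1 c1 d1 b2 c2 d2 : D) (u1 u2 : R).
Hypothesis u1E : u1 = S ^+ 2 + cst b1 * S + cst c1 * T + cst d1.
Hypothesis u2E : u2 = T ^+ 2 + cst b2 * S + cst c2 * T + cst d2.

(** Elimination of one variable between the quadrics: with [w = S^2 + b1 S + d1], [c1 T = - w]
    modulo [u1], and substitution in [c1^2 u2] leaves a monic quartic in [S]. The roles of [S] and
    [T] can be exchanged. *)
Let quartic (b d c e f g : D) : {poly D} :=
  ('X ^+ 2 + (b%:P * 'X + d%:P)) ^+ 2 - ((c * e)%:P * ('X ^+ 2 + (b%:P * 'X + d%:P))
   - ((c ^+ 2 * f)%:P * 'X + (c ^+ 2 * g)%:P)).

Let quartic_monic b d c e f g : quartic b d c e f g \is monic.
Proof.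
have szlin (x y : D) : (size (x%:P * 'X + y%:P)%R <= 2)%N.
  rewrite (leq_trans (size_polyD _ _)) // geq_max (leq_trans (size_polyC_leq1 _)) //.
  by rewrite andbT mul_polyC (leq_trans (size_scale_leq _ _)) ?size_polyX.
rewrite /quartic; set w := 'X ^+ 2 + _; have szw : size w = 3%N by rewrite size_polyDl size_polyXn // ltnS szlin.
have w1 : w \is monic by rewrite monicE lead_coefDl ?lead_coefXn // size_polyXn ltnS szlin.
rewrite monicE lead_coefDl ?(monicP (monic_exp _ w1)) //.
rewrite (size_monicM _ (monic_neq0 _)) // szw size_polyN.
rewrite (leq_ltn_trans (size_polyD _ _)) // gtn_max size_polyN.
rewrite (leq_ltn_trans (szlin _ _)) // andbT mul_polyC.
by rewrite (leq_ltn_trans (size_scale_leq _ _)) ?szw.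
Qed.

Lemma evalS_span : exists2 g, g \is monic & exists p q, evalS g = p * u1 + q * u2.
Proof.
exists (quartic b1 d1 c1 c2 b2 d2); first exact: quartic_monic.
exists (S ^+ 2 + cst b1 * S + cst d1 - cst c1 * T - cst c1 * cst c2), (cst c1 ^+ 2).
rewrite /quartic !(rmorphD, rmorphN, rmorphM, rmorphXn) /= !evalSC.
by rewrite -/S u1E u2E; ring.
Qed.

Lemma evalT_span : exists2 h, h \is monic & exists p q, evalT h = p * u1 + q * u2.
Proof.
exists (quartic c2 d2 b2 b1 c1 d1); first exact: quartic_monic.
exists (cst b2 ^+ 2), (T ^+ 2 + cst c2 * T + cst d2 - cst b2 * S - cst b2 * cst b1).
rewrite /quartic !(rmorphD, rmorphN, rmorphM, rmorphXn) /= !evalTC.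
by rewrite -/T u1E u2E; ring.
Qed.

Lemma quadrics_koszul N u3 : N != 0 -> in_span3 u1 u2 u3 (cst N) ->
  koszul_exact u1 u2 u3.
Proof.
move=> N0 uN; have [g g1 [p [q gE]]] := evalS_span; have [h h1 [p' [q' hE]]] := evalT_span.
apply: (koszul_exact_of_regular (regular_cst N0) (@regular_evalS_mod N g g1)
          (@regular_evalT_mod N g h h1) uN).
  by exists p, q, 0; rewrite gE; ring.
by exists p', q', 0; rewrite hE; ring.
Qed.

Lemma quadrics_regular2 : regular_mod (adjoin zeroR u1) u2.
Proof.
have [g g1 [p [q gE]]] := evalS_span; have [h h1 [p' [q' hE]]] := evalT_span.
(* Taking [N = 0] makes the ideal [(N)] zero, so [g(S)], [h(T)] is a regular pair in [R] itself. *)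
have reg_g f : evalS g * f = 0 -> f = 0.
  have := @regular_evalS_mod 0 g g1 f; rewrite /adjoin /zeroR /zero_ideal rmorph0.
  by move=> reg gf; have [|x] := reg; [exists 0; rewrite gf mul0r subr0 | rewrite mul0r subr0].
have reg_h f x : evalT h * f = evalS g * x -> exists y, f = evalS g * y.
  have := @regular_evalT_mod 0 g h h1 f; rewrite /adjoin /zeroR /zero_ideal rmorph0.
  move=> reg hf; have [|y [z]] := reg; first by exists x, 0; rewrite hf subrr mul0r subr0.
  by rewrite mul0r subr0 => /eqP; rewrite subr_eq0 => /eqP ->; exists y.
move=> f [x /eqP]; rewrite subr_eq0 => /eqP E.
(* Built so that [u1 y = g(S) f] and [u2 y = g(S) x]. Then [h(T) y] is a multiple of [g(S)], hence
   so is [y]. *)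
pose y := p * f + q * x.
have yu1 : u1 * y = evalS g * f by rewrite gE /y mulrDr [u1 * (q * x)]mulrCA -E; ring.
have yu2 : u2 * y = evalS g * x by rewrite gE /y mulrDr [u2 * (p * f)]mulrCA E; ring.
have [|z yE] := @reg_h y (p' * f + q' * x).
  by rewrite hE mulrDl -!mulrA yu1 yu2; ring.
exists z; apply: reg_g; rewrite mulrBr -yu1 yE; ring.
Qed.

End Quadrics.

Lemma variables_koszul N : N != 0 -> koszul_exact (cst N) S T.
Proof.
move=> N0.
apply: (koszul_exact_of_regular (regular_cst N0) (@regular_evalS_mod N 'X (monicX _))
          (@regular_evalT_mod N 'X 'X (monicX _))).
- by exists 1, 0, 0; ring.
- by exists 0, 1, 0; ring.
- by exists 0, 0, 1; ring.
Qed.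

End MonicSequences.

(** The determinant trick: by the adjugate of [x - m], its determinant kills every [g i] modulo [J],
    in particular [g i0 = 1]. *)
Lemma integral_mod_ideal (D R : comNzRingType) (psi : {rmorphism D -> R}) (J : R -> Prop)
    (x : R) n (g : 'I_n -> R) (m : 'M[D]_n) i0 :
  is_ideal J -> g i0 = 1 -> (forall i, J (x * g i - \sum_j psi (m i j) * g j)) ->
  J (map_poly psi (char_poly m)).[x].
Proof.
move=> [J0 JD JM] g1 Jx.
pose A : 'M[R]_n := x%:M - map_mx psi m.
pose ev : {rmorphism {poly D} -> R} := horner_eval x \o map_poly psi.
have -> : (map_poly psi (char_poly m)).[x] = \det A.
  rewrite -[LHS]/(ev (char_poly m)) /char_poly -det_map_mx; congr (\det _).
  apply/matrixP => i j; rewrite !mxE /= /horner_eval rmorphB /= rmorphMn /=.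
  by rewrite map_polyX map_polyC hornerD hornerN hornerMn hornerX hornerC.
have -> : \det A = \sum_i (\adj A) i0 i * (x * g i - \sum_j psi (m i j) * g j).
  transitivity ((\adj A *m A *m \col_i g i) i0 0).
    by rewrite mul_adj_mx mul_scalar_mx !mxE g1 mulr1.
  rewrite -mulmxA mxE; apply: eq_bigr => i _; congr (_ * _).
  rewrite mxE; under eq_bigr => j _ do rewrite !mxE mulrBl.
  rewrite big_split /= -sumrN; congr (_ + _).
  rewrite (bigD1 i) //= eqxx mulr1n big1 ?addr0 // => j ne_ji.
  by rewrite eq_sym (negPf ne_ji) mul0r.
by elim/big_ind: _ => // i _; apply: JM.
Qed.

(** * Linear forms and polynomial coordinates on P *)

Section LinearForms.
Variables (k : fieldType) (n : nat) (U : vectType k) (dimU : \dim {:U} = n.+1).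
Local Notation P := {mpoly k[n.+1]}.
Local Notation V := (symv dimU).
Local Notation b := (tcast dimU (vbasis {:U})).

Lemma symv_homog u : V u \is 1.-homog.
Proof.
by apply: rpred_sum => j _; apply: rpredZ; rewrite dhomogX; apply/eqP; exact: mdeg1.
Qed.

Lemma symv2_homog u v : V u * V v \is 2.-homog.
Proof. by rewrite -[2%N]/(1 + 1)%N dhomogM // symv_homog. Qed.

Lemma symv3_homog u v w : V u * V v * V w \is 3.-homog.
Proof. by rewrite -[3%N]/(2 + 1)%N dhomogM ?symv2_homog // symv_homog. Qed.

Lemma tcast_basis : basis_of {:U} b.
Proof. by rewrite val_tcast; exact: vbasisP. Qed.

Lemma symv_basis i : V (tnth b i) = 'X_i.
Proof.
rewrite /symv (bigD1 i) //= (tnth_nth 0) coord_free ?(basis_free tcast_basis) //.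
rewrite eqxx scale1r big1 ?addr0 // => j ne_ji.
by rewrite coord_free ?(basis_free tcast_basis) // eq_sym (negPf ne_ji) scale0r.
Qed.

Lemma homog1_symv p : p \is 1.-homog -> exists u, V u = p.
Proof.
move=> p1; exists (\sum_i p@_(U_(i)) *: tnth b i).
rewrite linear_sum; apply/mpolyP => m; rewrite raddf_sum /=.
under eq_bigr => i _ do rewrite linearZ /= symv_basis mcoeffZ mcoeffX.
have [/eqP/mdeg1P[i /eqP ->]|ne_m1] := eqVneq (mdeg m) 1%N.
  rewrite (bigD1 i) //= eqxx mulr1 big1 ?addr0 // => j ne_ji.
  by rewrite eq_mnm1 (negPf ne_ji) mulr0.
rewrite (dhomog_nemf_coeff p1) // big1 // => i _.
by case: eqVneq => [E|_]; rewrite ?mulr0 //; move: ne_m1; rewrite -E mdeg1 eqxx.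
Qed.

Lemma symv_inj u : V u = 0 -> u = 0.
Proof.
move=> Vu; rewrite [u](coord_basis tcast_basis (memvf u)) big1 // => i _.
have := congr1 (fun p : P => p@_(U_(i))) Vu; rewrite /symv raddf_sum mcoeff0 /=.
rewrite (bigD1 i) //= mcoeffZ mcoeffXU eqxx mulr1 big1 ?addr0 => [->|j ne_ji].
  by rewrite scale0r.
by rewrite mcoeffZ mcoeffXU (negPf ne_ji) mulr0.
Qed.

Lemma symv_ind (Q : P -> Prop) : Q 1 -> (forall f g, Q f -> Q g -> Q (f + g)) ->
  (forall (c : k) f, Q f -> Q (c *: f)) -> (forall u f, Q f -> Q (V u * f)) ->
  forall f, Q f.
Proof.
move=> Q1 QD QZ QM; elim/mpolyind => [|c m f _ _ Qf]; first by rewrite -(scale0r 1); apply: QZ.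
apply: QD Qf; apply: QZ; rewrite mpolyXE_id; elim/big_rec: _ => // i x _ Qx.
by elim: (m i) => [|d IHd]; rewrite ?expr0 ?mul1r // exprS -mulrA -{1}symv_basis; apply: QM.
Qed.

Lemma symv_generators (S : comNzRingType) (f g : {rmorphism P -> S}) :
  (forall c : k, f c%:MP = g c%:MP) -> (forall u, f (V u) = g (V u)) -> f =1 g.
Proof.
move=> fgC fgV p0; elim/symv_ind: p0 => [|p q Ep Eq|c p Ep|u p Ep]; first by rewrite !rmorph1.
- by rewrite !rmorphD /= Ep Eq.
- by rewrite -mul_mpolyC !rmorphM /= fgC Ep.
- by rewrite !rmorphM /= fgV Ep.
Qed.

End LinearForms.

Lemma poly_generators (E S : nzRingType) (f g : {rmorphism {poly E} -> S}) :
  (forall c, f c%:P = g c%:P) -> f 'X = g 'X -> f =1 g.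
Proof.
move=> fgC fgX; elim/poly_ind => [|p c Ep]; first by rewrite !rmorph0.
by rewrite !rmorphD !rmorphM /= fgC fgX Ep.
Qed.

Lemma horner_section (E P S : comNzRingType) (phi : {rmorphism E -> P}) (y : P)
    (theta : {rmorphism P -> S}) (iota : {rmorphism {poly E} -> S}) :
  (forall c, theta (phi c) = iota c%:P) -> theta y = iota 'X ->
  forall q, theta (map_poly phi q).[y] = iota q.
Proof.
move=> thC thX; pose f : {rmorphism {poly E} -> S} := theta \o (horner_eval y \o map_poly phi).
apply: (poly_generators (f := f)) => [c|].
  by rewrite /f /= /horner_eval map_polyC hornerC thC.
by rewrite /f /= /horner_eval map_polyX hornerX thX.
Qed.

Section Substitution.
Variables (k : fieldType) (n : nat) (U : vectType k) (dimU : \dim {:U} = n.+1).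
Local Notation P := {mpoly k[n.+1]}.
Local Notation V := (symv dimU).
Variables (A : comNzRingType) (c : {rmorphism k -> A}) (bt : n.+1.-tuple U) (var : 'I_n.+1 -> A).
Hypothesis bas : basis_of {:U} bt.

Let lin (u : U) : A := \sum_i c (coord bt i u) * var i.

Definition subst_basis : {rmorphism P -> A} :=
  mmap c (fun i => lin (tnth (tcast dimU (vbasis {:U})) i)).

Lemma subst_basisC a : subst_basis a%:MP = c a.
Proof. exact: mmapC. Qed.

Lemma subst_basisV i : subst_basis (V (tnth bt i)) = var i.
Proof.
have linD : {morph lin : u v / u + v}.
  by move=> u v; rewrite -big_split; apply: eq_bigr => j _; rewrite linearD rmorphD mulrDl.
have linZ a u : lin (a *: u) = c a * lin u.
  by rewrite mulr_sumr; apply: eq_bigr => j _; rewrite linearZ rmorphM mulrA.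
have lin0 : lin 0 = 0 by rewrite -(scale0r 0) linZ rmorph0 mul0r.
transitivity (lin (tnth bt i)).
  rewrite /symv rmorph_sum /= [in RHS](coord_basis (tcast_basis dimU) (memvf (tnth bt i))).
  rewrite (big_morph _ linD lin0); apply: eq_bigr => j _.
  by rewrite -mul_mpolyC rmorphM subst_basisC linZ -tnth_nth; congr (_ * _); rewrite /= mmapX mmap1U.
have cE j : coord bt j (tnth bt i) = (j == i)%:R.
  by rewrite (tnth_nth 0) coord_free ?(basis_free bas) // eq_sym.
rewrite /lin (bigD1 i) // cE eqxx rmorph1 mul1r big1 => [|j ne_ji]; first exact: addr0.
by rewrite cE (negPf ne_ji) rmorph0 mul0r.
Qed.

Lemma basis_generators (S : comNzRingType) (f g : {rmorphism P -> S}) :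
  (forall a : k, f a%:MP = g a%:MP) -> (forall i, f (V (tnth bt i)) = g (V (tnth bt i))) ->
  f =1 g.
Proof.
move=> fgC fgV; apply: (symv_generators (dimU := dimU)) => // u.
rewrite (coord_basis bas (memvf u)) linear_sum !rmorph_sum; apply: eq_bigr => i _.
by rewrite linearZ /= -mul_mpolyC !rmorphM /= fgC -tnth_nth fgV.
Qed.

End Substitution.

Section Coordinates.
Variables (k : fieldType) (U : vectType k) (dimU : \dim {:U} = 4%N).
Local Notation P := {mpoly k[4]}.
Local Notation V := (symv dimU).
Local Notation A1 := {poly k}.
Local Notation A2 := {poly A1}.
Local Notation A3 := {poly A2}.
Local Notation A4 := {poly A3}.

Variables (x e s t : U).
Hypothesis bas : basis_of {:U} [tuple e; x; s; t].

(** The nesting serves the monic arguments: [s] and [t] are outermost, so that [k[e, x]] plays the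
    role of [D], and [x] lies above [e] because finiteness over [k[e]] yields a monic polynomial in
    [x]. *)
Definition eval1 : {rmorphism A1 -> P} := horner_eval (V e) \o map_poly (@mpolyC 4 k).
Definition eval2 : {rmorphism A2 -> P} := horner_eval (V x) \o map_poly eval1.
Definition eval3 : {rmorphism A3 -> P} := horner_eval (V s) \o map_poly eval2.
Definition eval4 : {rmorphism A4 -> P} := horner_eval (V t) \o map_poly eval3.

Lemma eval1C c : eval1 c%:P = c%:MP.
Proof. by rewrite /= map_polyC /horner_eval hornerC. Qed.
Lemma eval2C c : eval2 c%:P = eval1 c.
Proof. by rewrite [LHS]/= map_polyC /horner_eval hornerC. Qed.
Lemma eval3C c : eval3 c%:P = eval2 c.
Proof. by rewrite [LHS]/= map_polyC /horner_eval hornerC. Qed.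
Lemma eval4C c : eval4 c%:P = eval3 c.
Proof. by rewrite [LHS]/= map_polyC /horner_eval hornerC. Qed.
Lemma eval1X : eval1 'X = V e.
Proof. by rewrite /= map_polyX /horner_eval hornerX. Qed.
Lemma eval2X : eval2 'X = V x.
Proof. by rewrite [LHS]/= map_polyX /horner_eval hornerX. Qed.
Lemma eval3X : eval3 'X = V s.
Proof. by rewrite [LHS]/= map_polyX /horner_eval hornerX. Qed.
Lemma eval4X : eval4 'X = V t.
Proof. by rewrite [LHS]/= map_polyX /horner_eval hornerX. Qed.

Definition evalE := (eval4C, eval3C, eval2C, eval1C, eval4X, eval3X, eval2X, eval1X).

Lemma eval4_bij : exists theta : {rmorphism P -> A4}, cancel eval4 theta /\ cancel theta eval4.
Proof.
pose c4 : {rmorphism k -> A4} := polyC \o polyC \o polyC \o polyC.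
pose var : 'I_4 -> A4 := tnth [tuple 'X%:P%:P%:P; 'X%:P%:P; 'X%:P; 'X].
pose theta := subst_basis dimU c4 [tuple e; x; s; t] var.
have thC a : theta a%:MP = a%:P%:P%:P%:P := subst_basisC _ _ _ _ a.
have thV i : theta (V (tnth [tuple e; x; s; t] i)) = var i := subst_basisV dimU c4 var bas i.
have the : theta (V e) = 'X%:P%:P%:P := thV 0.
have thx : theta (V x) = 'X%:P%:P := thV 1.
have ths : theta (V s) = 'X%:P := thV 2%:R.
have tht : theta (V t) = 'X := thV 3%:R.
exists theta; split.
  have th1 q : theta (eval1 q) = q%:P%:P%:P.
    exact: (@horner_section _ _ _ (@mpolyC 4 k) (V e) theta (polyC \o polyC \o polyC)).
  have th2 q : theta (eval2 q) = q%:P%:P.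
    exact: (@horner_section _ _ _ eval1 (V x) theta (polyC \o polyC)).
  have th3 q : theta (eval3 q) = q%:P.
    exact: (@horner_section _ _ _ eval2 (V s) theta polyC).
  exact: (@horner_section _ _ _ eval3 (V t) theta idfun).
pose f : {rmorphism P -> P} := eval4 \o theta.
have fE q : f q = eval4 (theta q) by [].
apply: (basis_generators (dimU := dimU) bas (f := f) (g := idfun)) => [a|i].
  by rewrite fE thC !evalE.
have f0 : f (V e) = V e by rewrite fE the !evalE.
have f1 : f (V x) = V x by rewrite fE thx !evalE.
have f2 : f (V s) = V s by rewrite fE ths !evalE.
have f3 : f (V t) = V t by rewrite fE tht !evalE.
by case: i => -[|[|[|[|i]]]] // lt_i; rewrite (tnth_nth 0).
Qed.

End Coordinates.

(** * The algebra structure on U *)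

Section CubicForm.
Variables (k : fieldType) (n : nat) (U : vectType k) (dimU : \dim {:U} = n.+1).
Variable Phi3 : divpow k n 3.
Local Notation P := {mpoly k[n.+1]}.
Local Notation V := (symv dimU).

(** [Phi3] extended by zero to all degrees; [ann Phi3] becomes the radical of the form
    [(f, g) |-> cform (f g)] on [P]. *)
Definition cform (f : P) : k^o := Phi3 (hcomp 3 f).

Fact cform_is_linear : linear cform.
Proof. by move=> a f g; rewrite /cform !linearP. Qed.
HB.instance Definition _ := GRing.isLinear.Build k P k^o _ cform cform_is_linear.

Lemma cform_homog d f : f \is d.-homog -> d != 3%N -> cform f = 0.
Proof.
move=> fd d3; rewrite /cform (_ : hcomp 3 f = 0) ?linear0 //.
by apply: val_inj; rewrite /= (pihomog_ne0 d3 fd).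
Qed.

Lemma annE f : ann Phi3 f <-> forall g, cform (f * g) = 0.
Proof.
split=> [fnu g|fnu c]; last first.
  by apply/lfunP => g; rewrite actE zero_lfunE; exact: fnu.
rewrite [g in _ * g](pihomog_partitionE (mf := mdeg) (leqnn (msize g))) mulr_sumr linear_sum big1 // => d _.
have := congr1 (fun l : divpow k n d => l (hcomp d g)) (fnu d).
by rewrite actE zero_lfunE.
Qed.

Lemma ann_ideal : is_ideal (ann Phi3).
Proof.
split; first by apply/annE => g; rewrite mul0r linear0.
  move=> f g /annE fnu /annE gnu; apply/annE => h.
  by rewrite mulrDl linearD /= fnu gnu addr0.
by move=> f g /annE gnu; apply/annE => h; rewrite -mulrA mulrCA gnu.
Qed.

Lemma ann_homog d f : (d <= 3)%N -> f \is d.-homog ->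
  (forall g, g \is (3 - d).-homog -> cform (f * g) = 0) -> ann Phi3 f.
Proof.
move=> d3 fd fnu; apply/annE => g.
rewrite [g in _ * g](pihomog_partitionE (mf := mdeg) (leqnn (msize g))) mulr_sumr linear_sum big1 // => c _.
have gc := pihomogP mdeg c g.
have [cd|ne_cd] := eqVneq (nat_of_ord c) (3 - d)%N; first by apply: fnu; rewrite -cd.
apply: (cform_homog (dhomogM fd gc)); apply: contra_neq ne_cd => <-.
by rewrite addnC addnK.
Qed.

Definition tri u v w : k := cform (V u * V v * V w).

Lemma triC u v w : tri u v w = tri v u w.
Proof. by rewrite /tri [V u * V v]mulrC. Qed.
Lemma triCA u v w : tri u v w = tri u w v.
Proof. by rewrite /tri mulrAC. Qed.

Lemma tri_linear u v : linear (tri u v : U -> k^o).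
Proof. by move=> a w w'; rewrite /tri linearP mulrDr -scalerAr linearP. Qed.

Section Product.
Variable x : U.

Definition mu (u v : U) : U :=
  ((Defs.pmap dimU Phi3 x)^-1)%VF (to_dual dimU (act 1 (V u * V v) Phi3)).

Lemma pmap_tri u v : Defs.pmap dimU Phi3 x u v = tri x u v.
Proof. by rewrite pmapE mulrA. Qed.

Hypothesis pmap_inj : lker (Defs.pmap dimU Phi3 x) == 0%VS.

Lemma tri_nondegenerate u : (forall v, tri x u v = 0) -> u = 0.
Proof.
move=> xu0; apply: (lker0P pmap_inj); rewrite linear0; apply/lfunP => v.
by rewrite pmap_tri xu0 zero_lfunE.
Qed.

Lemma tri_mu u v w : tri x (mu u v) w = tri u v w.
Proof.
have dim_dual : \dim {:'Hom(U, k^o)} = \dim {:U} by rewrite !dimvf /dim /= muln1.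
have surj : limg (Defs.pmap dimU Phi3 x) = fullv.
  apply/eqP; rewrite eqEdim subvf dim_dual limg_dim_eq ?leqnn //.
  by rewrite (eqP pmap_inj) capv0.
rewrite -pmap_tri /mu limg_lfunVK ?surj ?memvf // to_dualE actE /tri /cform /=.
by rewrite (pihomog_dE (symv_homog dimU w)).
Qed.

Lemma muC u v : mu u v = mu v u.
Proof. by rewrite /mu [V u * V v]mulrC. Qed.

Lemma eq_mu u v : (forall w, tri x u w = tri x v w) -> u = v.
Proof.
move=> uv; apply/eqP; rewrite -subr_eq0; apply/eqP; apply: tri_nondegenerate => w.
have L : linear (fun u => tri x u w : k^o).
  by move=> a u1 u2; rewrite ![tri x _ w]triCA tri_linear.
pose l : {linear U -> k^o} := HB.pack (fun u => tri x u w : k^o) (GRing.isLinear.Build k U k^o _ _ L).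
by have := linearB l u v; rewrite /= => ->; rewrite uv subrr.
Qed.

Lemma mu_linear u : linear (mu u).
Proof.
move=> a v w; apply: eq_mu => r.
rewrite tri_mu ![tri x _ r]triCA ![tri u _ r]triCA !tri_linear.
by rewrite ![tri x r _]triCA !tri_mu ![tri u r _]triCA.
Qed.

Lemma mu1 u : mu x u = u.
Proof. by apply: eq_mu => w; rewrite tri_mu. Qed.

End Product.

(** In the quotient, degree 2 embeds into the dual of degree 1, so maximal rank in degree 1 makes
    multiplication by [x] onto. If [p(u) = 0], then [Phi3] vanishes on [u x U], hence on all of
    [u Sym_2 U], and [u] annihilates [Phi3]. *)
Lemma weak_lefschetz_injective x : (forall l, ann Phi3 (V l) -> l = 0) ->
  weak_lefschetz dimU Phi3 x -> lker (Defs.pmap dimU Phi3 x) == 0%VS.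
Proof.
move=> ann1 /(_ 1%N); rewrite /mul_rank /quot_dim.
have ker1 : annv Phi3 1 = 0%VS.
  apply/eqP; rewrite -subv0; apply/subvP => f /annvP annf; rewrite memv0; apply/eqP.
  have [l Vl] := homog1_symv dimU (valP f).
  by apply: val_inj; rewrite /= -Vl (ann1 l) ?linear0 // Vl.
have le21 : (\dim {:Sym k n 2} - \dim (annv Phi3 2) <= \dim {:Sym k n 1} - \dim (annv Phi3 1))%N.
  rewrite ker1 dimv0 subn0 leq_subLR /annv; set h := linfun _.
  rewrite -[X in (X <= _)%N](limg_ker_dim h fullv) capfv leq_add2l.
  by rewrite (leq_trans (dimvS (subvf _))) // !dimvf /dim /= muln1.
rewrite (minn_idPr le21) => /eqP; rewrite eqn_sub2rE ?dimvS ?addvSr ?subvf // => /eqP dim_full.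
have full : (limg (mulsym dimU x 1) + annv Phi3 2)%VS = fullv.
  by apply/eqP; rewrite eqEdim subvf dim_full leqnn.
rewrite -subv0; apply/subvP => u; rewrite memv_ker memv0 => /eqP pu0.
apply/eqP; apply: ann1; apply: (@ann_homog 1 _ _ (symv_homog _ _)) => // g g2.
have : DHomog g2 \in (limg (mulsym dimU x 1) + annv Phi3 2)%VS by rewrite full memvf.
move=> /memv_addP[_ /memv_imgP[f _ ->]] [h /annvP/annE annh /(congr1 val) /= ->].
rewrite mulrDr linearD /= mulrC [V u * val h]mulrC annh addr0 mulsymE.
have [v <-] := homog1_symv dimU (valP f).
have := congr1 (fun l : 'Hom(U, k^o) => l v) pu0; rewrite pmap_tri zero_lfunE /tri => <-.
by rewrite mulrAC.
Qed.

End CubicForm.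

(** * Commutative algebras with a nondegenerate associative form *)

Section FrobeniusAlgebra.
Variables (k : fieldType) (U : vectType k) (B : U -> U -> k) (m : U -> U -> U) (x : U).
Hypotheses (BC : forall u v, B u v = B v u).
Hypotheses (B_linear : forall u, linear (B u : U -> k^o)).
Hypotheses (mC : forall u v, m u v = m v u).
Hypotheses (m_linear : forall u, linear (m u)).
Hypotheses (mx : forall u, m x u = u).
Hypotheses (BA : forall u v w, B (m u v) w = B u (m v w)).
Hypotheses (Bnd : forall u, (forall v, B u v = 0) -> u = 0).

Lemma BDr u : {morph B u : v w / v + w}.
Proof. by move=> v w; have := B_linear u 1 v w; rewrite !scale1r. Qed.
Lemma BDl u : {morph B^~ u : v w / v + w}.
Proof. by move=> v w /=; rewrite ![B _ u]BC BDr. Qed.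
Lemma B0r u : B u 0 = 0.
Proof. by apply: (addrI (B u 0)); rewrite -BDr !addr0. Qed.
Lemma B0l u : B 0 u = 0. Proof. by rewrite BC B0r. Qed.
Lemma BZr u a v : B u (a *: v) = a * B u v.
Proof. by have := B_linear u a v 0; rewrite addr0 B0r addr0. Qed.
Lemma BZl u a v : B (a *: v) u = a * B v u. Proof. by rewrite BC BZr BC. Qed.
Lemma BNr u v : B u (- v) = - B u v. Proof. by rewrite -scaleN1r BZr mulN1r. Qed.
Lemma BNl u v : B (- v) u = - B v u. Proof. by rewrite BC BNr BC. Qed.
Lemma mDr u : {morph m u : v w / v + w}.
Proof. by move=> v w; have := m_linear u 1 v w; rewrite !scale1r. Qed.
Lemma mDl u : {morph m^~ u : v w / v + w}.
Proof. by move=> v w /=; rewrite ![m _ u]mC mDr. Qed.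
Lemma m0r u : m u 0 = 0. Proof. by apply: (addrI (m u 0)); rewrite -mDr !addr0. Qed.
Lemma mZr u a v : m u (a *: v) = a *: m u v.
Proof. by have := m_linear u a v 0; rewrite addr0 m0r addr0. Qed.
Lemma mZl u a v : m (a *: v) u = a *: m v u. Proof. by rewrite mC mZr mC. Qed.
Lemma mNr u v : m u (- v) = - m u v. Proof. by rewrite -scaleN1r mZr scaleN1r. Qed.
Lemma mNl u v : m (- v) u = - m v u. Proof. by rewrite mC mNr mC. Qed.
Lemma m1 u : m u x = u. Proof. by rewrite mC mx. Qed.

Definition BE := (BDl, BDr, BZl, BZr, BNl, BNr, B0l, B0r).
Definition mE := (mDl, mDr, mZl, mZr, mNl, mNr, mx, m1).

Lemma B_inj u v : (forall w, B u w = B v w) -> u = v.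
Proof.
by move=> uv; apply/eqP; rewrite -subr_eq0; apply/eqP; apply: Bnd => w; rewrite !BE uv subrr.
Qed.

Lemma BmC u v w : B (m u v) w = B (m u w) v.
Proof. by rewrite mC BA BC mC. Qed.

Lemma Badj u a b : B (m u a) b = B a (m u b).
Proof. by rewrite mC BA. Qed.

Definition basis4 (a b c d : U) :=
  (forall u, exists p q r s, u = p *: a + q *: b + r *: c + s *: d) /\
  (forall p q r s, p *: a + q *: b + r *: c + s *: d = 0 -> [/\ p = 0, q = 0, r = 0 & s = 0]).

(* A diagonal entry of SM, and also the value of B at t and the associator
   (s o s) o t - s o (s o t). *)
Definition gram_minor s t := B (m s s) (m t t) - B (m s t) (m s t).

Section Nucleus.
Variables (y z w : U).
Hypothesis bas : basis4 x y z w.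
Hypothesis gram_zw : gram_minor z w != 0.
Hypothesis gram_yw : gram_minor y w = 0.
Hypothesis gram_yz : gram_minor y z = 0.
Hypothesis off12 : B (m z w) (m y w) = B (m y z) (m w w).
Hypothesis off13 : B (m y z) (m z w) = B (m z z) (m y w).
Hypothesis off23 : B (m y z) (m y w) = B (m y y) (m z w).

Let al := gram_minor z w.

Let span (f : U -> k) : (forall a u v, f (a *: u + v) = a * f u + f v) ->
  f x = 0 -> f y = 0 -> f z = 0 -> f w = 0 -> forall u, f u = 0.
Proof.
move=> lf fx fy fz fw u; have [[sp _] f0] := (bas, lf (-1) 0 0).
have {}f0 : f 0 = 0 by move: f0; rewrite scaler0 addr0 mulN1r addNr.
have [p [q [r [s ->]]]] := sp u.
have fZ a v : f (a *: v) = a * f v by rewrite -[a *: v]addr0 lf f0 addr0.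
by rewrite -!addrA !lf !fZ fx fy fz fw; ring.
Qed.

Let alternating (f : U -> U -> k) : (forall a u v w, f (a *: u + v) w = a * f u w + f v w) ->
  (forall u, f u u = 0) -> (forall u v, f u v = - f v u) -> (forall u, f x u = 0) ->
  f y z = 0 -> f y w = 0 -> f z w = 0 -> forall u v, f u v = 0.
Proof.
move=> lf fuu fC fx fyz fyw fzw.
have lfr u a v v' : f u (a *: v + v') = a * f u v + f u v'.
  by rewrite fC lf [f u v]fC [f u v']fC; ring.
have fxr u : f u x = 0 by rewrite fC fx oppr0.
have fy u : f y u = 0 by apply: (span (f := f y)).
have fz u : f z u = 0 by apply: (span (f := f z)) => //; rewrite fC fyz oppr0.
have fw u : f w u = 0.
  by apply: (span (f := f w)) => //; rewrite fC ?fyw ?fzw oppr0.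
by move=> u v; apply: (span (f := f^~ v)).
Qed.

(** The difference of the two sides is linear in [r], alternating in [s, t], and zero when one of
    the three is [x] or when [r = y]. The six values left, with [r] in [{z, w}] and [s, t] among
    [y, z, w], are up to sign the five vanishing entries of the matrix. *)
Lemma nucleus_form s t r : B (m y s) (m t r) = B (m y t) (m s r).
Proof.
pose F r s t := B (m y s) (m t r) - B (m y t) (m s r).
have alt r' : F r' y z = 0 -> F r' y w = 0 -> F r' z w = 0 -> forall s t, F r' s t = 0.
  apply: alternating => [a u v u'|u|u v|u]; rewrite /F.
  - by rewrite !mE !BE; ring.
  - by rewrite subrr.
  - by rewrite opprB.
  - by rewrite !mE BA subrr.
suff {s t r} F0 r' s t : F r' s t = 0.
  by apply/eqP; rewrite -subr_eq0; apply/eqP; exact: F0.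
have [gyw gyz] : B (m y y) (m w w) = B (m y w) (m y w) /\
    B (m y y) (m z z) = B (m y z) (m y z).
  split=> //; apply/eqP; rewrite -subr_eq0; first by rewrite -/(gram_minor y w) gram_yw.
  by rewrite -/(gram_minor y z) gram_yz.
apply: (span (f := fun r' => F r' s t)) => [a u v||||].
- by rewrite /F !mE !BE; ring.
- by rewrite /F !m1 BmC subrr.
- by rewrite /F [m t y]mC [m s y]mC BC subrr.
- apply: alt; rewrite /F.
  + by rewrite gyz [m y z]mC subrr.
  + by rewrite [m w z]mC -off23 BC subrr.
  + by rewrite [m w z]mC off13 BC subrr.
- apply: alt; rewrite /F.
  + by rewrite -off23 subrr.
  + by rewrite gyw subrr.
  + by rewrite -off12 [B (m y w) _]BC subrr.
Qed.

Lemma nucleus s r : m y (m s r) = m (m y s) r.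
Proof.
apply: B_inj => t; rewrite BmC nucleus_form [RHS]BA.
by rewrite [m r t]mC.
Qed.

(** Two associators that read off coordinates: both are orthogonal to [x] and [y], while pairing
    with [A1] gives [al] times the coefficient of [w], and with [A2] that of [z]. *)
Let A1 := m (m z z) w - m z (m z w).
Let A2 := m z (m w w) - m (m z w) w.

Let BA1 u : B A1 u = B (m z z) (m w u) - B (m z w) (m z u).
Proof. by rewrite /A1 BDl BNl BA [B (m z (m z w)) u]Badj. Qed.
Let BA2 u : B A2 u = B (m w w) (m z u) - B (m z w) (m w u).
Proof. by rewrite /A2 BDl BNl Badj [B (m (m z w) w) u]BA. Qed.

Let A1E p q r s : B A1 (p *: x + q *: y + r *: z + s *: w) = al * s.
Proof.
have E0 : B A1 x = 0 by rewrite BA1 !m1 BmC subrr.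
have E1 : B A1 y = 0 by rewrite BA1 [m w y]mC [m z y]mC BC nucleus_form BC [m w z]mC subrr.
have E2 : B A1 z = 0 by rewrite BA1 [m w z]mC BC subrr.
have E3 : B A1 w = al by rewrite BA1.
by rewrite !BDr !BZr E0 E1 E2 E3; ring.
Qed.

Let A2E p q r s : B A2 (p *: x + q *: y + r *: z + s *: w) = al * r.
Proof.
have E0 : B A2 x = 0 by rewrite BA2 !m1 [B (m w w) z]Badj [m w z]mC BC subrr.
have E1 : B A2 y = 0 by rewrite BA2 [m w y]mC [m z y]mC BC nucleus_form BC subrr.
have E3 : B A2 w = 0 by rewrite BA2 BC subrr.
have E2 : B A2 z = al by rewrite BA2 [m w z]mC BC.
by rewrite !BDr !BZr E0 E1 E2 E3; ring.
Qed.

Let nuc := nucleus.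
Let nucr u v : m u (m y v) = m y (m u v).
Proof. by rewrite mC -nuc [m v u]mC. Qed.

Let al_inj a b : al * a = al * b -> a = b.
Proof. exact: mulfI. Qed.

(** Pairing [y o z] and [y o w] with [A1] and [A2] shows that, modulo the span of [x] and [y], [y]
    multiplies [z] and [w] by one scalar [c]. Hence [e = y - c x] maps [U] into the span of [x] and
    [e]; the component on [x] is then excluded by the nonzero vector [A1], which [e] kills. *)
Lemma nucleus_eigenvalue : exists c, let e := y - c *: x in
  basis4 e x z w /\ forall u, exists q, m e u = q *: e.
Proof.
have [sp fr] := bas.
have [p1 [q1 [c [s1 yz]]]] := sp (m y z); have [p2 [q2 [r2 [s2 yw]]]] := sp (m y w).
have [p0 [q0 [r0 [s0 yy]]]] := sp (m y y).
have s1E : s1 = 0.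
  apply: al_inj; rewrite -(A1E p1 q1 c s1) -yz BA1 !nucr [m w z]mC mulr0.
  by rewrite -Badj BC subrr.
have r2E : r2 = 0.
  apply: al_inj; rewrite -(A2E p2 q2 r2 s2) -yw BA2 !nucr mulr0.
  by rewrite -Badj BC subrr.
have s2E : s2 = c.
  apply: al_inj; rewrite -(A1E p2 q2 r2 s2) -yw -(A2E p1 q1 c s1) -yz BA1 BA2 !nucr.
  by rewrite [m w z]mC -Badj BC.
have yyzero v v' : B (m v v) (m v' (m y y)) - B (m v v') (m v (m y y)) = 0.
  rewrite !nucr ![m _ y]mC -!Badj.
  by rewrite [m y (m v v)]nuc [m y (m (m y v) v)]nuc BA [B (m y (m y (m v v'))) v]Badj Badj BC subrr.
have s0E : s0 = 0.
  by apply: al_inj; rewrite -(A1E p0 q0 r0 s0) -yy BA1 yyzero mulr0.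
have r0E : r0 = 0.
  by apply: al_inj; rewrite -(A2E p0 q0 r0 s0) -yy BA2 [m z w]mC yyzero mulr0.
exists c => e.
have eE p q : q *: e + (p + q * c) *: x = p *: x + q *: y.
  by rewrite /e scalerBr scalerA scalerDl addrC addrACA subrr addr0.
have yE : y = 1 *: e + (0 + 1 * c) *: x by rewrite eE scale0r scale1r add0r.
move: yz yw yy; rewrite s1E r2E s2E s0E r0E !scale0r !addr0 => yz yw yy.
have base : basis4 e x z w.
  split=> [u|p q r s E].
    by have [p [q [r [s ->]]]] := sp u; exists q, (p + q * c), r, s; rewrite eE.
  have [|] := fr (q - p * c) p r s; last first.
    by move=> qpc p0' -> ->; move: qpc; rewrite p0' mul0r subr0.
  by rewrite -E -eE subrK.
pose N u := exists p q, m e u = p *: x + q *: e.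
have ND u v : N u -> N v -> N (u + v).
  move=> [p [q E]] [p' [q' E']]; exists (p + p'), (q + q').
  by rewrite mDr E E' !scalerDl addrACA.
have NZ a u : N u -> N (a *: u).
  by move=> [p [q E]]; exists (a * p), (a * q); rewrite mZr E scalerDr !scalerA.
have eN u : N u.
  have [p [q [r [s ->]]]] := sp u.
  apply: (ND _ _); [apply: (ND _ _); [apply: (ND _ _)|]|]; apply: (NZ _ _).
  - by exists 0, 1; rewrite m1 scale0r scale1r add0r.
  - exists (p0 + (q0 - c) * c), (q0 - c).
    by rewrite addrC eE mDl mNl mZl mx yy scalerBl addrA.
  - by exists (p1 + q1 * c), q1; rewrite addrC eE mDl mNl mZl mx yz addrK.
  - by exists (p2 + q2 * c), q2; rewrite addrC eE mDl mNl mZl mx yw addrK.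
have nue u v : m e (m u v) = m (m e u) v.
  by rewrite /e !(mDl, mNl, mZl) !mx nuc.
have [b [a ee]] := eN e.
(* [B(e o A1, u) = B(A1, e o u)], and [A1] is orthogonal to the span of [x] and [y]. *)
have eA1 : m e A1 = 0.
  apply: Bnd => u; rewrite Badj; have [p [q ->]] := eN u.
  have := A1E (p - q * c) q 0 0; rewrite !scale0r !addr0 -eE subrK addrC mulr0.
  by [].
have A1_0 : A1 != 0.
  apply/eqP => A10; have := A1E 0 0 0 1; rewrite A10 B0l mulr1 => E.
  by move: gram_zw; rewrite -/al -E eqxx.
(* [0 = e o (e o A1) = (e o e) o A1 = b A1]. *)
have b0 : b = 0.
  have : m (m e e) A1 = 0 by rewrite -nue !eA1 m0r.
  rewrite ee mDl !mZl mx eA1 scaler0 addr0 => /eqP; rewrite scaler_eq0 (negPf A1_0) orbF.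
  by move/eqP.
split=> // u; have [p [q eu]] := eN u; exists q; clearbody e.
(* Now [e o e = a e]; comparing the coefficients of [e] in [e o (e o u) = a (e o u)] gives
   [p = 0]. *)
have : m e (m e u) = m (m e e) u by rewrite nue.
rewrite {1}eu mDr !mZr m1 ee b0 scale0r add0r mZl eu scalerDr !scalerA => /eqP.
rewrite -subr_eq0 => /eqP E.
have [|p_0 _ _ _] := proj2 base (p + q * a - a * q) (- (a * p)) 0 0.
  rewrite !scale0r !addr0 -[RHS]E opprD scalerBl scalerDl scaleNr -addrA.
  by congr (_ + _); rewrite addrC.
have p0E : p = 0 by move: p_0; rewrite [a * q]mulrC addrK.
by rewrite p0E scale0r add0r.
Qed.

End Nucleus.

Lemma basis4_shear e z w c a b a' b' : basis4 e x z w -> c != 0 ->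
  basis4 (c *: e) x (z + (a *: x + b *: e)) (w + (a' *: x + b' *: e)).
Proof.
move=> [sp fr] c0; pose L p q r s : U := p *: e + q *: x + r *: z + s *: w.
have LD p q r s p' q' r' s' : L p q r s + L p' q' r' s' = L (p + p') (q + q') (r + r') (s + s').
  by rewrite /L !scalerDl addrACA; congr (_ + _); rewrite addrACA; congr (_ + _); rewrite addrACA.
have LZ d p q r s : d *: L p q r s = L (d * p) (d * q) (d * r) (d * s).
  by rewrite /L !scalerDr !scalerA.
have eL : e = L 1 0 0 0 by rewrite /L !scale0r scale1r !addr0.
have xL : x = L 0 1 0 0 by rewrite /L !scale0r scale1r !addr0 add0r.
have zL : z = L 0 0 1 0 by rewrite /L !scale0r scale1r !addr0 !add0r.
have wL : w = L 0 0 0 1 by rewrite /L !scale0r scale1r !add0r.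
have E p q r s : p *: (c *: e) + q *: x + r *: (z + (a *: x + b *: e)) + s *: (w + (a' *: x + b' *: e))
    = L (p * c + r * b + s * b') (q + r * a + s * a') r s.
  by rewrite [in LHS]zL [in LHS]wL [in LHS]eL [in LHS]xL !(LD, LZ); congr L; ring.
split=> [u|p q r s].
  have [p [q [r [s ->]]]] := sp u.
  exists ((p - r * b - s * b') / c), (q - r * a - s * a'), r, s.
  by rewrite E divfK // /L; congr (_ *: _ + _ *: _ + _ + _); ring.
rewrite E => /fr[P Q r0 s0]; move: P Q; rewrite r0 s0 !mul0r !addr0 => /eqP.
by rewrite mulf_eq0 (negPf c0) orbF => /eqP -> ->.
Qed.

Definition in_nucleus n := forall u v, m n (m u v) = m (m n u) v.

Lemma gram_minorC s t : gram_minor s t = gram_minor t s.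
Proof. by rewrite /gram_minor BC [m s t]mC. Qed.

(** This allows [z] and [w] to be corrected by multiples of [x] and [e] without losing the nonzero
    minor. *)
Lemma gram_minor_nucleus n s t : in_nucleus n -> gram_minor (s + n) t = gram_minor s t.
Proof.
move=> nn; rewrite /gram_minor !(mDl, mDr) !(BDl, BDr) [m s n]mC.
have E1 : B (m n s) (m t t) = B (m s t) (m n t).
  by rewrite Badj nn [B (m s t) _]BA; congr B; rewrite mC.
have E2 : B (m n n) (m t t) = B (m n t) (m n t).
  by rewrite BA nn [B (m n t) _]BA; congr B; rewrite mC.
by rewrite E1 E2 [B (m n t) (m s t)]BC; ring.
Qed.

(** [B e x] is nonzero because each [B(e, u) = B(e o u, x)] is a multiple of it. Subtracting
    multiples of [x] moves [z] and [w] into [ker lam]. If [B e e] is nonzero, [e] is rescaled to an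
    idempotent. Otherwise [e] itself lies in [ker lam], and adding multiples of [e] makes [s] and
    [t] orthogonal to [x] as well. *)
Lemma nucleus_frame e z w : basis4 e x z w -> (forall u, exists q, m e u = q *: e) ->
  gram_minor z w != 0 ->
  exists e' s t,
    [/\ basis4 e' x s t, B e' x != 0, forall u, m e' u = (B e' u / B e' x) *: e',
        B e' s = 0 /\ B e' t = 0 & gram_minor s t != 0] /\
    (B e' e' = B e' x \/ [/\ B e' e' = 0, B x s = 0 & B x t = 0]).
Proof.
move=> bas em gram.
have Bex : B e x != 0.
  apply/eqP => Bex0; have e0 : e = 0.
    apply: Bnd => u; have [q eu] := em u.
    have <- : B (m e u) x = B e u by rewrite BA m1.
    by rewrite eu BZl Bex0 mulr0.
  have [//|p _ _ _] := proj2 bas 1 0 0 0; last by move/eqP: p; rewrite oner_eq0.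
  by rewrite e0 scaler0 !scale0r !addr0.
have {}em u : m e u = (B e u / B e x) *: e.
  have [q eu] := em u; rewrite eu; congr (_ *: _); apply: (mulIf Bex).
  by rewrite divfK // -BZl -eu BA m1.
have nx : in_nucleus x by move=> u v; rewrite !mx.
have ne : in_nucleus e.
  move=> u v; rewrite [LHS]em -BA (em u) BZl mZl em scalerA.
  by congr (_ *: _); rewrite mulrA.
have nD n n' : in_nucleus n -> in_nucleus n' -> in_nucleus (n + n').
  by move=> Nn Nn' u v; rewrite !mDl Nn Nn'.
have nZ a n : in_nucleus n -> in_nucleus (a *: n).
  by move=> Nn u v; rewrite !mZl Nn.
pose s rho := z + (- (B e z / B e x) *: x + rho *: e).
pose t rho := w + (- (B e w / B e x) *: x + rho *: e).
have gram_st r r' : gram_minor (s r) (t r') != 0.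
  have n a b : in_nucleus (a *: x + b *: e) by apply: (nD _ _ (nZ _ _ nx) (nZ _ _ ne)).
  by rewrite gram_minor_nucleus // gram_minorC gram_minor_nucleus // gram_minorC.
have [Bee|Bee] := eqVneq (B e e) 0.
  pose rz := (B e z / B e x * B x x - B x z) / B e x.
  pose rw := (B e w / B e x * B x x - B x w) / B e x.
  exists e, (s rz), (t rw); split.
    split=> //; first by rewrite -[e]scale1r; apply: basis4_shear => //; exact: oner_neq0.
    by rewrite /s /t !BE Bee; split; field.
  by right; split=> //; rewrite /s /t /rz /rw !BE [B x e]BC; field.
exists ((B e x / B e e) *: e), (s 0), (t 0).
have lam u : B ((B e x / B e e) *: e) u / B ((B e x / B e e) *: e) x = B e u / B e x.
  by rewrite !BZl; field; rewrite Bex Bee.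
have c0 : B e x / B e e != 0 by rewrite mulf_neq0 ?invr_eq0.
split; last by left; rewrite !BE; field.
split=> //.
- exact: basis4_shear.
- by rewrite BZl mulf_neq0.
- by move=> u; rewrite lam mZl em scalerA scalerA mulrC.
- by rewrite /s /t !BE; split; field; rewrite Bex Bee.
Qed.

End FrobeniusAlgebra.

(** * Adapted bases and second minors of rank one *)

Lemma rank1_mx (F : fieldType) p q (M : 'M[F]_(p, q)) : \rank M = 1%N ->
  exists a b, forall i j, M i j = a i * b j.
Proof.
move=> rkM; move: (col_base M) (row_base M) (mulmx_base M); rewrite rkM => C D <-.
by exists (fun i => C i 0), (fun j => D 0 j) => i j; rewrite mxE big_ord1.
Qed.

Lemma basis4_basis_of (k : fieldType) (U : vectType k) (a b c d : U) :
  \dim {:U} = 4%N -> basis4 a b c d -> basis_of {:U} [tuple a; b; c; d].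
Proof.
move=> dimU [sp _]; rewrite basisEdim dimU leqnn andbT; apply/subvP => u _.
have [p [q [r [s ->]]]] := sp u.
by do !apply: rpredD; apply: rpredZ; apply: memv_span; rewrite !inE eqxx ?orbT.
Qed.

Lemma basis_of_lker_basis4 (k : fieldType) (U : vectType k) (xs : 'Hom(U, k^o)) x y z w :
  xs x = 1 -> basis_of (lker xs) [:: y; z; w] -> basis4 x y z w.
Proof.
move=> xsx bas; have basT : basis_of (lker xs) [tuple y; z; w] by [].
split=> [u|p q r s E].
  have uk : u - xs u *: x \in lker xs by rewrite memv_ker linearB linearZ /= xsx [_ *: _]mulr1 subrr.
  have := coord_basis basT uk; rewrite !big_ord_recr big_ord0 /= add0r => uE.
  eexists (xs u), _, _, _; rewrite -!addrA; apply/eqP; rewrite addrC -subr_eq uE addrA; apply/eqP.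
  reflexivity.
have ker v : v \in [:: y; z; w] -> xs v = 0.
  by move=> /(basis_mem bas); rewrite memv_ker => /eqP.
have p0 : p = 0.
  have : xs (p *: x + q *: y + r *: z + s *: w) = 0 by rewrite E linear0.
  rewrite !linearD !linearZ /= xsx !ker ?inE ?eqxx ?orbT //.
  by rewrite !scaler0 !addr0 [_ *: _]mulr1.
move: E; rewrite p0 scale0r add0r => E.
have /freeP fr := basis_free basT.
pose c (i : 'I_3) := nth 0 [:: q; r; s] i.
have c0 : forall i, c i = 0.
  by apply: fr; rewrite !big_ord_recr big_ord0 /= add0r.
by split=> //; [exact: (c0 0) | exact: (c0 1) | exact: (c0 2%:R)].
Qed.

Lemma basis_of_shear (k : fieldType) (U : vectType k) (W : {vspace U}) y z w y' z' w' a b c :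
  basis_of W [:: y; z; w] -> perm_eq [:: y'; z'; w'] [:: y; z; w] -> a != 0 ->
  basis_of W [:: a *: y' + b *: z' + c *: w'; z'; w'].
Proof.
move=> bas perm a0; have {}bas : basis_of W [:: y'; z'; w'] by rewrite (perm_basis W perm).
have dimW : \dim W = 3%N .
  by rewrite -(span_basis bas) (eqnP (basis_free bas)).
rewrite basisEdim dimW leqnn andbT -(span_basis bas).
set y2 := _ + _; have z2 : z' \in <<[:: y2; z'; w']>>%VS by apply: memv_span; rewrite !inE eqxx ?orbT.
have w2 : w' \in <<[:: y2; z'; w']>>%VS by apply: memv_span; rewrite !inE eqxx ?orbT.
apply/span_subvP => v; rewrite !inE => /or3P[] /eqP-> //.
have -> : y' = a^-1 *: (y2 - c *: w' - b *: z') by rewrite addrK addrK scalerK.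
by apply: rpredZ; do 2 (apply: rpredB; last exact: rpredZ); apply: memv_span; rewrite !inE eqxx.
Qed.

Lemma ord3 (l : 'I_3) : [\/ l = 0, l = 1 | l = 2%:R].
Proof.
by case: l => -[|[|[|]]] // ?; [constructor 1 | constructor 2 | constructor 3]; apply: val_inj.
Qed.

Section SecondMinors.
Variables (k : fieldType) (U : vectType k) (B : U -> U -> k) (m : U -> U -> U).

(** With [B] symmetric and [m] commutative, the Gram matrix, in the basis [z ^ w], [w ^ y], [y ^ z]
    of the exterior square, of the form [(a ^ b, c ^ d) |-> B(ac, bd) - B(ad, bc)]. The formulas for
    a new [y] and for cyclic permutations are read from this. *)
Definition minors_mx (y z w : U) : 'M[k]_3 :=
  let q a b c d := B (m a b) (m c d) in
  \matrix_(i, j) nth 0 (nth [::]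
    [:: [:: q z z w w - q z w z w; q z w y w - q y z w w; q y z z w - q z z y w];
        [:: q y w z w - q y z w w; q y y w w - q y w y w; q y z y w - q y y z w];
        [:: q y z z w - q y w z z; q y w y z - q y y z w; q y y z z - q y z y z]]
    i) j.

Hypotheses (BC : forall u v, B u v = B v u).
Hypotheses (B_linear : forall u, linear (B u : U -> k^o)).
Hypotheses (mC : forall u v, m u v = m v u).
Hypotheses (m_linear : forall u, linear (m u)).

Let BX := BE BC B_linear.
Let mX := (mDl mC m_linear, mDr m_linear, mZl mC m_linear, mZr m_linear).

Lemma matrix3P (M N : 'M[k]_3) :
  M 0 0 = N 0 0 -> M 0 1 = N 0 1 -> M 0 2%:R = N 0 2%:R ->
  M 1 0 = N 1 0 -> M 1 1 = N 1 1 -> M 1 2%:R = N 1 2%:R ->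
  M 2%:R 0 = N 2%:R 0 -> M 2%:R 1 = N 2%:R 1 -> M 2%:R 2%:R = N 2%:R 2%:R -> M = N.
Proof.
move=> *; apply/matrixP => i j.
by have [->|->|->] := ord3 i; have [->|->|->] := ord3 j.
Qed.

Definition corner_mx (al : k) : 'M[k]_3 :=
  \matrix_(i < 3, j < 3) (if (i == 0) && (j == 0) then al else 0).

Lemma minors_mx_shear p q r y z w (M := minors_mx y z w)
    (N := minors_mx (p *: y + q *: z + r *: w) z w) :
  [/\ N 0 0 = M 0 0, N 0 1 = p * M 0 1 - q * M 0 0, N 0 2%:R = p * M 0 2%:R - r * M 0 0 &
   [/\ N 1 1 = p ^+ 2 * M 1 1 - p * q * M 0 1 *+ 2 + q ^+ 2 * M 0 0,
       N 1 2%:R = p ^+ 2 * M 1 2%:R - p * r * M 0 1 - p * q * M 0 2%:R + q * r * M 0 0 &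
       N 2%:R 2%:R = p ^+ 2 * M 2%:R 2%:R - p * r * M 0 2%:R *+ 2 + r ^+ 2 * M 0 0]].
Proof.
have E (u : U) : m (p *: y + q *: z + r *: w) u = p *: m y u + q *: m z u + r *: m w u.
  by rewrite !mX.
split; last split; rewrite !mxE /= ?E ?[m _ (p *: y + _ + _)]mC ?E ?mX ?BX ?[m z y]mC ?[m w y]mC ?[m w z]mC
  ?[B (m y z) (m y y)]BC ?[B (m y w) (m y y)]BC ?[B (m z z) (m y y)]BC ?[B (m z w) (m y y)]BC ?[B (m w w) (m y y)]BC
  ?[B (m y w) (m y z)]BC ?[B (m z z) (m y z)]BC ?[B (m z w) (m y z)]BC ?[B (m w w) (m y z)]BC
  ?[B (m z z) (m y w)]BC ?[B (m z w) (m y w)]BC ?[B (m w w) (m y w)]BC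
  ?[B (m z w) (m z z)]BC ?[B (m w w) (m z z)]BC
  ?[B (m w w) (m z w)]BC; ring.
Qed.

Lemma minors_mx_sym y z w i j : minors_mx y z w i j = minors_mx y z w j i.
Proof.
by have [->|->|->] := ord3 i; have [->|->|->] := ord3 j; rewrite !mxE //=; congr (_ - _);
   rewrite BC.
Qed.

Lemma minors_mx_cycle y z w i j : minors_mx z w y i j = minors_mx y z w (i + 1) (j + 1).
Proof.
have S : [/\ 0 + 1 = 1 :> 'I_3, 1 + 1 = 2%:R :> 'I_3 & 2%:R + 1 = 0 :> 'I_3].
  by split; apply: val_inj.
have [S0 S1 S2] := S.
have [->|->|->] := ord3 i; have [->|->|->] := ord3 j; rewrite ?S0 ?S1 ?S2 !mxE /=
  ?[m z y]mC ?[m w y]mC ?[m w z]mC; congr (_ - _); by rewrite ?[m z y]mC ?[m w y]mC ?[m w z]mC // BC.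
Qed.

(** Gaussian elimination: the new [y] alters [w ^ y] and [y ^ z] by multiples of [z ^ w] that clear
    the first row, and the rank one relations then clear the rest. *)
Lemma minors_mx_diagonal y z w (M := minors_mx y z w) : M 0 0 != 0 ->
  (forall i j, M i j * M 0 0 = M 0 i * M 0 j) ->
  minors_mx (M 0 0 *: y + M 0 1 *: z + M 0 2%:R *: w) z w = corner_mx (M 0 0).
Proof.
move=> M0 Mij.
have sym := minors_mx_sym.
have [N00 N01 N02 [N11 N12 N22]] := minors_mx_shear (M 0 0) (M 0 1) (M 0 2%:R) y z w.
have E01 : M 0 0 * M 0 1 - M 0 1 * M 0 0 = 0 by ring.
have E02 : M 0 0 * M 0 2%:R - M 0 2%:R * M 0 0 = 0 by ring.
have E11 : M 0 0 ^+ 2 * M 1 1 - M 0 0 * M 0 1 * M 0 1 *+ 2 + M 0 1 ^+ 2 * M 0 0 = 0.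
  transitivity (M 0 0 * (M 1 1 * M 0 0 - M 0 1 * M 0 1)); first by ring.
  by rewrite Mij subrr mulr0.
have E12 : M 0 0 ^+ 2 * M 1 2%:R - M 0 0 * M 0 2%:R * M 0 1 - M 0 0 * M 0 1 * M 0 2%:R + M 0 1 * M 0 2%:R * M 0 0 = 0.
  transitivity (M 0 0 * (M 1 2%:R * M 0 0 - M 0 1 * M 0 2%:R)); first by ring.
  by rewrite Mij subrr mulr0.
have E22 : M 0 0 ^+ 2 * M 2%:R 2%:R - M 0 0 * M 0 2%:R * M 0 2%:R *+ 2 + M 0 2%:R ^+ 2 * M 0 0 = 0.
  transitivity (M 0 0 * (M 2%:R 2%:R * M 0 0 - M 0 2%:R * M 0 2%:R)); first by ring.
  by rewrite Mij subrr mulr0.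
apply: matrix3P; rewrite [RHS]mxE /= ?[minors_mx _ _ _ 1 0]sym ?[minors_mx _ _ _ 2%:R 0]sym
  ?[minors_mx _ _ _ 2%:R 1]sym.
- exact: N00.
- by rewrite N01.
- by rewrite N02.
- by rewrite N01.
- by rewrite N11.
- by rewrite N12.
- by rewrite N02.
- by rewrite N12.
- by rewrite N22.
Qed.

(* A symmetric matrix of rank one has a nonzero diagonal entry. *)
Lemma minors_mx_rank1 (W : {vspace U}) y z w : basis_of W [:: y; z; w] ->
  \rank (minors_mx y z w) = 1%N ->
  exists y' z' w' al, [/\ basis_of W [:: y'; z'; w'], al != 0 &
    minors_mx y' z' w' = corner_mx al].
Proof.
move=> bas rk; have [f [g M_fg]] := rank1_mx rk.
have sym i j : f i * g j = f j * g i by rewrite -!M_fg minors_mx_sym.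
have prop p i j : minors_mx y z w i j * minors_mx y z w p p =
    minors_mx y z w p i * minors_mx y z w p j.
  rewrite !M_fg; transitivity ((f i * g p) * (f p * g j)); first by ring.
  by rewrite sym.
have [p Mpp] : exists p, minors_mx y z w p p != 0.
  apply/existsP; apply: contraT => /existsPn M0.
  suff M_0 : minors_mx y z w = 0 by move: rk; rewrite M_0 mxrank0.
  (* Rank one and symmetry give [M_ij ^ 2 = M_ii M_jj]. *)
  apply/matrixP => i j; rewrite [RHS]mxE; apply/eqP; rewrite -sqrf_eq0 expr2.
  rewrite [X in _ * X]minors_mx_sym !M_fg; apply/eqP.
  transitivity ((f i * g i) * (f j * g j)); first by ring.
  by rewrite -M_fg (eqP (negbNE (M0 i))) mul0r.
have concl a b c : perm_eq [:: a; b; c] [:: y; z; w] -> minors_mx a b c 0 0 != 0 ->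
    (forall i j, minors_mx a b c i j * minors_mx a b c 0 0 =
       minors_mx a b c 0 i * minors_mx a b c 0 j) ->
    exists y' z' w' al, [/\ basis_of W [:: y'; z'; w'], al != 0 &
      minors_mx y' z' w' = corner_mx al].
  move=> pm M0 Mij; do 4 eexists; split; last exact: (minors_mx_diagonal M0 Mij) => //.
    exact: basis_of_shear bas pm M0.
  exact: M0.
(* A cyclic permutation of [y, z, w] brings the nonzero diagonal entry to the corner. *)
have [p0|p1|p2] := ord3 p; move: Mpp; rewrite ?p0 ?p1 ?p2 => Mpp.
- exact: (concl y z w (perm_refl _) Mpp (prop 0)).
- have cyc i j : minors_mx z w y i j = minors_mx y z w (i + 1) (j + 1) by exact: minors_mx_cycle.
  apply: (concl z w y); rewrite ?cyc ?add0r //; last by move=> i j; rewrite !cyc !add0r; exact: prop.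
  by rewrite perm_sym -(perm_rot 1).
- have cyc i j : minors_mx w y z i j = minors_mx y z w (i + 2%:R) (j + 2%:R).
    by rewrite minors_mx_cycle minors_mx_cycle -!addrA.
  apply: (concl w y z); rewrite ?cyc ?add0r //; last by move=> i j; rewrite !cyc !add0r; exact: prop.
  by rewrite perm_sym -(perm_rot 2).
Qed.

End SecondMinors.

(** * The annihilator of Phi3 *)

Section IdealTools.
Variables (R : comNzRingType) (I : R -> Prop).
Hypothesis idI : is_ideal I.

Lemma ideal0 : I 0. Proof. by have [? _ _] := idI. Qed.
Lemma idealD f g : I f -> I g -> I (f + g). Proof. by have [_ h _] := idI; apply: h. Qed.
Lemma idealM f g : I g -> I (f * g). Proof. by have [_ _ h] := idI; apply: h. Qed.
Lemma idealN f : I f -> I (- f). Proof. by rewrite -mulN1r; apply: idealM. Qed.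
Lemma idealB f g : I f -> I g -> I (f - g).
Proof. by move=> If Ig; apply: idealD => //; apply: idealN. Qed.

End IdealTools.

Section Annihilator.
Variables (k : fieldType) (U : vectType k) (dimU : \dim {:U} = 4%N).
Variables (Phi3 : divpow k 3 3) (x : U).
Local Notation P := {mpoly k[4]}.
Local Notation V := (symv dimU).
Local Notation B := (tri dimU Phi3 x).
Local Notation m := (mu dimU Phi3 x).
Hypothesis pmap_inj : lker (Defs.pmap dimU Phi3 x) == 0%VS.

Lemma triBC u v : B u v = B v u. Proof. exact: triCA. Qed.
Lemma triBA u v w : B (m u v) w = B u (m v w).
Proof. by rewrite tri_mu // [RHS]triBC tri_mu // [RHS]triCA [in RHS]triC. Qed.

Lemma ann_mu u v : ann Phi3 (V u * V v - V x * V (m u v)).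
Proof.
apply: (@ann_homog _ _ _ 2) => //; first by rewrite rpredB // symv2_homog.
move=> g /homog1_symv -/(_ U dimU) [w <-].
by rewrite mulrBl linearB /= -/(tri _ _ _ _ _) -/(tri _ _ _ _ _) tri_mu // subrr.
Qed.

Let BX := BE triBC (tri_linear dimU Phi3 x).
Let mX := mE (@muC _ _ _ _ Phi3 x) (mu_linear pmap_inj) (mu1 pmap_inj).

Variables (e s t : U).
Hypothesis bas : basis4 e x s t.
Hypothesis Bex : B e x != 0.
Hypothesis em : forall u, m e u = (B e u / B e x) *: e.

Lemma symvZ c u : V (c *: u) = c%:MP * V u.
Proof. by rewrite linearZ /= mul_mpolyC. Qed.

(** Otherwise [B e] would be a multiple of [B x], against the independence of [e] and [x]. *)
Lemma exists_perp : exists w, B x w = 0 /\ B e w != 0.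
Proof.
pose a := e - (B e e / B e x) *: x.
have [[u Bau]|none] := pselect (exists u, B a u != 0).
  exists (u - (B x u / B e x) *: e); rewrite !BX [B x e]triBC; split; first by field.
  by move: Bau; rewrite /a !BX; apply: contra_neq => E; rewrite -E; field.
have a0 : a = 0.
  apply: (tri_nondegenerate pmap_inj) => u; apply/eqP/contraT => Bau.
  by case: none; exists u.
have [|p _ _ _] := proj2 bas 1 (- (B e e / B e x)) 0 0.
  by rewrite scale1r scaleNr !scale0r !addr0.
by move/eqP: p; rewrite oner_eq0.
Qed.

Section Generators.
Variable G : P -> Prop.
Hypothesis idG : is_ideal G.
Hypothesis G_mu : forall u v, G (V u * V v - V x * V (m u v)).
Hypothesis G_perp : forall w, B x w = 0 -> G (V x * V x * V w).

(** For [w] from [exists_perp], [x^2 w e] lies in [G], and modulo [G] it is a nonzero multiple of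
    [x^3 e]. *)
Lemma G_x3e : G (V x * V x * V x * V e).
Proof.
have [w [xw ew]] := exists_perp.
have c0 : B e w / B e x != 0 by rewrite mulf_neq0 ?invr_eq0.
have Gw := idealM idG (V e) (G_perp xw).
have := idealM idG (V x * V x) (G_mu e w); rewrite em symvZ => Gew.
have := idealM idG ((B e w / B e x)^-1%:MP) (idealB idG Gw Gew).
set c := B e w / B e x in c0 *; congr G.
have cc : c^-1%:MP * c%:MP = 1 :> P by rewrite -mpolyCM mulVf.
transitivity (c^-1%:MP * c%:MP * (V x * V x * V x * V e)); first by ring.
by rewrite cc mul1r.
Qed.

(** The normal forms have dimensions 1, 4, 4, 1 in degrees 0 to 3, the Hilbert function of
    [P / ann Phi3]. So [G] cannot be strictly contained in the annihilator. *)
Lemma normal_form f : exists c0 l l' c,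
  G (f - (c0%:MP + V l + V x * V l' + c%:MP * (V x * V x * V e))).
Proof.
elim/(symv_ind (dimU := dimU)): f => [|f g|a f|u f].
- by exists 1, 0, 0, 0; rewrite !linear0 mpolyC0 mulr0 mul0r !addr0 subrr; exact: ideal0.
- move=> [c0 [l [l' [c Gf]]]] [d0 [n [n' [d Gg]]]].
  exists (c0 + d0), (l + n), (l' + n'), (c + d); have := idealD idG Gf Gg; congr G.
  by rewrite !mpolyCD !linearD /=; ring.
- move=> [c0 [l [l' [c Gf]]]]; exists (a * c0), (a *: l), (a *: l'), (a * c).
  have := idealM idG a%:MP Gf; congr G.
  by rewrite !mpolyCM !symvZ -mul_mpolyC; ring.
- move=> [c0 [l [l' [c Gf]]]].
  pose w := m u l'; pose d := B x w / B e x.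
  exists 0, (c0 *: u), (m u l), d.
  have Gw : G (V x * V x * V (w - d *: e)).
    by apply: G_perp; rewrite !BX /d [B x e]triBC divfK // subrr.
  have G1 := G_mu u l; have G2 := idealM idG (V x) (G_mu u l').
  have G3 : G (V u * (V x * V x * V e)).
    have := idealD idG (idealM idG (V x * V x) (G_mu e u)) (idealM idG (B e u / B e x)%:MP G_x3e).
    by rewrite em symvZ; congr G; ring.
  have := idealD idG (idealD idG (idealM idG (V u) Gf) (idealD idG G1 G2))
            (idealD idG Gw (idealM idG c%:MP G3)).
  by congr G; rewrite /w mpolyC0 symvZ linearB /= symvZ; ring.
Qed.

(** A normal form in the annihilator is zero: multiplying by [x^2 e], [x v], [v] and 1 and applying
    [Phi3] isolates its components of degrees 0, 1, 2 and 3. *)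
Lemma ann_sub : (forall f, G f -> ann Phi3 f) -> forall f, ann Phi3 f -> G f.
Proof.
move=> Gann f annf; have [c0 [l [l' [c Gf]]]] := normal_form f.
have id_ann := ann_ideal Phi3.
set r := (X in f - X) in Gf; have : ann Phi3 r.
  by have := idealB id_ann annf (Gann _ Gf); rewrite subKr.
have zh d g : g \is d.-homog -> d != 3%N -> cform Phi3 g = 0 by exact: cform_homog.
have h1 := symv_homog dimU; have h2 := symv2_homog dimU; have h3 := symv3_homog dimU.
move=> /annE annr.
have cC (a : k) g : cform Phi3 (a%:MP * g) = a * cform Phi3 g.
  by rewrite mul_mpolyC linearZ.
have xxe : cform Phi3 (V x * V x * V e) = B e x by rewrite -/(tri _ _ _ _ _) triBC.
have c00 : c0 = 0.
  have := annr (V x * V x * V e); rewrite /r !mulrDl !linearD /= -[c%:MP * _ * _]mulrA !cC xxe.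
  rewrite (@zh 4 _ (dhomogM (h1 _) (h3 _ _ _))) // (@zh 5 _ (dhomogM (h2 _ _) (h3 _ _ _))) //.
  rewrite (@zh 6 _ (dhomogM (h3 _ _ _) (h3 _ _ _))) // mulr0 !addr0.
  by move/eqP; rewrite mulf_eq0 (negPf Bex) orbF => /eqP.
have l0 : l = 0.
  apply: (tri_nondegenerate pmap_inj) => v.
  have := annr (V x * V v); rewrite /r c00 mpolyC0 add0r !mulrDl !linearD /= -[c%:MP * _ * _]mulrA cC.
  rewrite (@zh 4 _ (dhomogM (h2 _ _) (h2 _ _))) // (@zh 5 _ (dhomogM (h3 _ _ _) (h2 _ _))) //.
  by rewrite mulr0 !addr0 mulrA -/(tri _ _ _ _ _) triC.
have l'0 : l' = 0.
  apply: (tri_nondegenerate pmap_inj) => v.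
  have := annr (V v); rewrite /r c00 l0 linear0 mpolyC0 !add0r !mulrDl !linearD /= -[c%:MP * _ * _]mulrA cC.
  by rewrite (@zh 4 _ (dhomogM (h3 _ _ _) (h1 _))) // mulr0 !addr0.
have c_0 : c = 0.
  have := annr 1; rewrite /r c00 l0 l'0 !linear0 mpolyC0 mulr0 !add0r mulr1 cC xxe.
  by move/eqP; rewrite mulf_eq0 (negPf Bex) orbF => /eqP.
by move: Gf; rewrite /r c00 l0 l'0 c_0 !linear0 !mpolyC0 mulr0 mul0r !addr0 subr0.
Qed.

End Generators.
End Annihilator.

Lemma pihomogM (R : comNzRingType) n d c (p g : {mpoly R[n]}) : g \is c.-homog ->
  pihomog mdeg d (p * g) = if (c <= d)%N then pihomog mdeg (d - c) p * g else 0.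
Proof.
move=> gc; rewrite [p](pihomog_partitionE (mf := mdeg) (leqnn (msize p))).
rewrite mulr_suml linear_sum /= linear_sum /= mulr_suml.
have hom (i : nat) : pihomog mdeg i p * g \is (i + c).-homog by apply: dhomogM => //; exact: pihomogP.
case: leqP => [le_cd|lt_dc]; last first.
  rewrite big1 // => i _; apply: (pihomog_ne0 _ (hom i)).
  by rewrite gtn_eqF // ltn_addl.
apply: eq_bigr => i _; have [E|ne] := eqVneq (i + c)%N d.
  by rewrite (pihomog_dE (mf := mdeg)) // -E ?hom // addnK pihomog_id.
rewrite (pihomog_ne0 ne (hom i)) (pihomog_ne0 _ (pihomogP _ _ _)) ?mul0r //.
by apply: contra_neq ne => ->; rewrite subnK.
Qed.

Lemma homog0_const (R : comNzRingType) n (p : {mpoly R[n]}) : p \is 0.-homog -> p = (p@_0)%:MP.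
Proof.
move=> p0; apply/mpolyP => q; rewrite mcoeffC.
have [->|q0] := eqVneq q 0%MM; first by rewrite mulr1.
by rewrite mulr0 (dhomog_nemf_coeff p0) // mdeg_eq0.
Qed.

Section Determinant.
Variables (k : fieldType) (U : vectType k) (dimU : \dim {:U} = 4%N).
Local Notation P := {mpoly k[4]}.
Local Notation V := (symv dimU).

Definition det3 (m11 m12 m13 m21 m22 m23 m31 m32 m33 : P) : P :=
  m11 * (m22 * m33 - m23 * m32) + m12 * (m23 * m31 - m21 * m33) + m13 * (m21 * m32 - m22 * m31).

Lemma det3_homog r11 r12 r13 r21 r22 r23 r31 r32 r33 :
  det3 (V r11) (V r12) (V r13) (V r21) (V r22) (V r23) (V r31) (V r32) (V r33) \is 3.-homog.
Proof.
have hom u v w u' v' : V u * (V v * V w - V u' * V v') \is 3.-homog.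
  by rewrite -[3%N]/(1 + 2)%N dhomogM ?symv_homog // rpredB // symv2_homog.
by rewrite /det3; do 2 (apply: rpredD; last exact: hom); exact: hom.
Qed.

End Determinant.

(** * Finiteness of P/J over k[e], and the linkage *)

Section Core.
Variables (k : fieldType) (U : vectType k) (dimU : \dim {:U} = 4%N).
Variables (Phi3 : divpow k 3 3) (x : U).
Local Notation P := {mpoly k[4]}.
Local Notation V := (symv dimU).
Local Notation B := (tri dimU Phi3 x).
Local Notation m := (mu dimU Phi3 x).
Hypothesis pmap_inj : lker (Defs.pmap dimU Phi3 x) == 0%VS.

Variables (e s t : U).
Hypothesis bas : basis4 e x s t.
Hypothesis Bex : B e x != 0.

Local Notation ev1 := (eval1 dimU e).
Local Notation ev2 := (eval2 dimU x e).

Variables (a r11 r12 r13 r21 r22 r23 r31 r32 r33 : U) (u1 u2 u3 : P).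
Variable apoly : {poly {poly k}}.
Hypotheses (aE : ev2 apoly = V a) (a0 : apoly != 0).
Hypothesis u1E : u1 = V r11 * V a + V r12 * V s + V r13 * V t.
Hypothesis u2E : u2 = V r21 * V a + V r22 * V s + V r23 * V t.
Hypothesis u3E : u3 = V r31 * V a + V r32 * V s + V r33 * V t.
Variables b1 c1 d1 b2 c2 d2 : {poly {poly k}}.
Hypothesis u1_monic : u1 = V s ^+ 2 + ev2 b1 * V s + ev2 c1 * V t + ev2 d1.
Hypothesis u2_monic : u2 = V t ^+ 2 + ev2 b2 * V s + ev2 c2 * V t + ev2 d2.

Let delta : P := det3 (V r11) (V r12) (V r13) (V r21) (V r22) (V r23) (V r31) (V r32) (V r33).

Hypothesis annP :
  forall f, ann Phi3 f <-> sum_gen (V e) (V a) (V s) (V t) u1 u2 u3 delta f.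

Let J : P -> Prop := linked_J (V r11) (V r12) (V r13) (V r21) (V r22) (V r23)
  (V r31) (V r32) (V r33) u1 u2 u3.

Let idJ : is_ideal J. Proof. exact: linked_J_ideal. Qed.

Let u_homog : [/\ u1 \is 2.-homog, u2 \is 2.-homog & u3 \is 2.-homog].
Proof.
by split; rewrite ?u1E ?u2E ?u3E; do 2 (apply: rpredD; last exact: symv2_homog); exact: symv2_homog.
Qed.

(** In the component of degree [d] the coefficients of the [e v_i] are forms of degree [d - 2].
    Modulo [J], elements of the annihilator of degree 2 and 3 thus become [e] times a linear form or
    a quadric. *)
Let J_component d f : (1 < d)%N -> f \is d.-homog -> ann Phi3 f ->
  exists f1 f2 f3, J (f - V e * (pihomog mdeg (d - 2) f1 * V a +
    pihomog mdeg (d - 2) f2 * V s + pihomog mdeg (d - 2) f3 * V t)).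
Proof.
move=> le_2d fd /annP[f1 [f2 [f3 [p1 [p2 [p3 [g E]]]]]]].
exists f1, f2, f3; have [h1 h2 h3] := u_homog; have h2V := symv2_homog dimU.
have E' : f = f1 * (V e * V a) + f2 * (V e * V s) + f3 * (V e * V t) + p1 * u1 + p2 * u2 + p3 * u3 + g * delta.
  by rewrite E; ring.
have := congr1 (pihomog mdeg d) E'; rewrite (pihomog_dE fd) !linearD /=.
rewrite !(pihomogM d _ (h2V _ _)) (pihomogM d _ h1) (pihomogM d _ h2) (pihomogM d _ h3) le_2d.
rewrite (pihomogM d _ (det3_homog dimU _ _ _ _ _ _ _ _ _)) => ->.
exists (pihomog mdeg (d - 2) p1), (pihomog mdeg (d - 2) p2), (pihomog mdeg (d - 2) p3).
exists (if (3 <= d)%N then pihomog mdeg (d - 3) g else 0).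
by case: leqP => _; rewrite /delta /det3; ring.
Qed.

Let J_quadric u v : exists y, J (V u * V v - V x * V (m u v) - V e * V y).
Proof.
have [|||f1 [f2 [f3 Jf]]] := @J_component 2 (V u * V v - V x * V (m u v)) => //.
- by rewrite rpredB // symv2_homog.
- exact: ann_mu.
have const (f : P) : exists c : k, pihomog mdeg (2 - 2) f = c%:MP.
  by exists ((pihomog mdeg 0 f)@_0); apply: homog0_const; exact: pihomogP.
have [y1 E1] := const f1; have [y2 E2] := const f2; have [y3 E3] := const f3.
by exists (y1 *: a + y2 *: s + y3 *: t); move: Jf; rewrite E1 E2 E3 !linearD /= !symvZ.
Qed.

Let J_perp w : B x w = 0 -> exists y1 y2 y3,
  J (V x * V x * V w - V e * (V y1 * V a + V y2 * V s + V y3 * V t)).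
Proof.
move=> xw; have [|||f1 [f2 [f3 Jf]]] := @J_component 3 (V x * V x * V w) => //.
- exact: symv3_homog.
- apply: (@ann_homog _ _ _ 3) => //; first exact: symv3_homog.
  by move=> g /homog0_const ->; rewrite mulrC mul_mpolyC linearZ /= -/(tri _ _ _ _ _) xw scaler0.
have lin (f : P) := homog1_symv dimU (pihomogP mdeg 1 f).
by have [y1 E1] := lin f1; have [y2 E2] := lin f2; have [y3 E3] := lin f3;
   exists y1, y2, y3; rewrite E1 E2 E3.
Qed.

(* P/J is spanned over k[e] by these monomials. *)
Let g (i : 'I_7) : P := nth 0 [:: 1; V x; V s; V t; V x * V x; V x * V s; V x * V t] i.

Let W (f : P) : Prop := exists c : 'I_7 -> {poly k}, J (f - \sum_i ev1 (c i) * g i).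

Let WD f f' : W f -> W f' -> W (f + f').
Proof.
move=> [c Jf] [c' Jf']; exists (fun i => c i + c' i); have := idealD idJ Jf Jf'; congr J.
rewrite addrACA -opprD -big_split; congr (_ - _); apply: eq_bigr => i _.
by rewrite rmorphD mulrDl.
Qed.

Let WM (q : {poly k}) f : W f -> W (ev1 q * f).
Proof.
move=> [c Jf]; exists (fun i => q * c i); have := idealM idJ (ev1 q) Jf; congr J.
rewrite mulrBr mulr_sumr; congr (_ - _); apply: eq_bigr => i _.
by rewrite rmorphM mulrA.
Qed.

Let WJ f f' : J (f - f') -> W f' -> W f.
Proof.
move=> Jff' [c Jf]; exists c; have := idealD idJ Jff' Jf; congr J.
by rewrite addrA subrK.
Qed.

Let Wg i : W (g i).
Proof.
exists (fun j => if j == i then 1 else 0); rewrite (bigD1 i) // eqxx rmorph1 mul1r.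
rewrite big1 => [|j /negPf ->]; first by rewrite /= addr0 subrr; exact: ideal0.
by rewrite rmorph0 mul0r.
Qed.

Let We f : W f -> W (V e * f).
Proof. by rewrite -(eval1X dimU e); exact: WM. Qed.

Let WZ c f : W f -> W (c%:MP * f).
Proof. by rewrite -(eval1C dimU e); exact: WM. Qed.

Let Wx f (W1 : W f) (Wxf : W (V x * f)) (Wsf : W (V s * f)) (Wtf : W (V t * f)) u : W (V u * f).
Proof.
have [p [q [r [r' ->]]]] := proj1 bas u.
rewrite !linearD /= !symvZ !mulrDl -!mulrA.
by do 3 (apply: (WD _ _); last exact: (WZ _ _)); apply: (WZ _ _); exact: We.
Qed.

Let W_1 : W 1. Proof. exact: (Wg 0). Qed.
Let W_x : W (V x). Proof. exact: (Wg (@Ordinal 7 1 isT)). Qed.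
Let W_s : W (V s). Proof. exact: (Wg (@Ordinal 7 2 isT)). Qed.
Let W_t : W (V t). Proof. exact: (Wg (@Ordinal 7 3 isT)). Qed.
Let W_xx : W (V x * V x). Proof. exact: (Wg (@Ordinal 7 4 isT)). Qed.
Let W_xs : W (V x * V s). Proof. exact: (Wg (@Ordinal 7 5 isT)). Qed.
Let W_xt : W (V x * V t). Proof. exact: (Wg (@Ordinal 7 6 isT)). Qed.

Let W_V u : W (V u).
Proof. by rewrite -[V u]mulr1; apply: Wx; rewrite ?mulr1. Qed.

Let W_xV u : W (V x * V u).
Proof. by rewrite mulrC; apply: Wx; rewrite // mulrC. Qed.

Let W_VV u v : W (V u * V v).
Proof.
have [y Jy] := J_quadric u v; apply: (WJ (f' := V x * V (m u v) + V e * V y)).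
  by rewrite opprD addrA.
by apply: (WD _ _); [exact: W_xV | exact: We].
Qed.

Hypothesis em : forall u, m e u = (B e u / B e x) *: e.

(** Here the spanning set closes up: modulo [J], [x^2 w] with [B(x, w) = 0] is [e] times a quadric,
    and quadrics are already in [W]. *)
Let W_xxV u : W (V x * (V x * V u)).
Proof.
pose w := u - (B x u / B e x) *: e.
have xw : B x w = 0.
  by rewrite /w !(BE (triBC dimU Phi3 x) (tri_linear dimU Phi3 x)) [B x e]triBC divfK // subrr.
have [y1 [y2 [y3 Jw]]] := J_perp xw.
have -> : V x * (V x * V u) = V x * V x * V w + (B x u / B e x)%:MP * (V e * (V x * V x)).
  by rewrite /w linearB /= symvZ; ring.
apply: (WD _ _); last by apply: WZ; apply: We.
apply: (WJ Jw); apply: We.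
by apply: (WD _ _); [apply: (WD _ _)|]; exact: W_VV.
Qed.

Let Wxg i : W (V x * g i).
Proof.
have [g1 gx gs gt] : [/\ W (V x * 1), W (V x * V x), W (V x * V s) & W (V x * V t)].
  by rewrite mulr1.
case: i => -[|[|[|[|[|[|[|i]]]]]]] //= lt_i; rewrite /g /=.
- exact: W_xxV.
- exact: W_xxV.
- exact: W_xxV.
Qed.

(** Multiplication by [x] preserves, modulo [J], the [k[e]]-span of the [g i], which contains 1; the
    monic polynomial is a characteristic polynomial. *)
Lemma exists_monic_in_J : exists2 p, p \is monic & J (ev2 p).
Proof.
have /choice[M JM] := Wxg; exists (char_poly (\matrix_(i, j) M i j)); first exact: char_poly_monic.
apply: (integral_mod_ideal (psi := ev1) (g := g) (i0 := 0) idJ) => // i.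
by under eq_bigr => j _ do rewrite mxE; exact: JM.
Qed.

(** The value at the origin, which vanishes on the generators and so certifies that [I] and [J] are
    proper. *)
Let ev0 : {rmorphism P -> k} := meval (fun=> 0).

Let ev0V u : ev0 (V u) = 0.
Proof. by rewrite rmorph_sum big1 //= => i _; rewrite mevalZ mevalXU mulr0. Qed.

Theorem linked_sum_of_matrix : exists I J : P -> Prop,
  [/\ perfect_ideal I /\ grade I 3, perfect_ideal J /\ grade J 3, linked I J &
      forall f, ann Phi3 f <-> ideal_add I J f].
Proof.
have [theta [etaK thetaK]] := eval4_bij dimU (basis4_basis_of dimU bas).
pose eta := eval4 dimU x e s t.
have cstE c : cst eta c = ev2 c by rewrite /cst /eta eval4C eval3C.
have SE : evalS eta 'X = V s by rewrite /evalS /eta eval4C eval3X.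
have TE : evalT eta 'X = V t by rewrite /evalT map_polyX /eta eval4X.
have e0 : V e != 0.
  apply: contra_neq Bex => /symv_inj ->.
  by rewrite (B0l (triBC dimU Phi3 x) (tri_linear dimU Phi3 x)).
have Kv : koszul_exact (V a) (V s) (V t).
  by have := variables_koszul etaK thetaK a0; rewrite cstE SE TE aE.
have u1S : u1 = evalS eta 'X ^+ 2 + cst eta b1 * evalS eta 'X + cst eta c1 * evalT eta 'X + cst eta d1.
  by rewrite !cstE SE TE.
have u2S : u2 = evalT eta 'X ^+ 2 + cst eta b2 * evalS eta 'X + cst eta c2 * evalT eta 'X + cst eta d2.
  by rewrite !cstE SE TE.
have Ku : koszul_exact u1 u2 u3.
  (* [p] lies in [(u, delta)], and [a delta] lies in [(u)] by the first row of the adjugate. So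
     [a p] is a nonzero element of [k[e, x]] in [(u)]. *)
  have [p p_monic [f1 [f2 [f3 [g0 pJ]]]]] := exists_monic_in_J.
  apply: (quadrics_koszul etaK thetaK u1S u2S (N := apoly * p)).
    by rewrite mulf_neq0 // monic_neq0.
  rewrite cstE rmorphM aE pJ.
  exists (V a * f1 + g0 * (V r22 * V r33 - V r23 * V r32)).
  exists (V a * f2 + g0 * (V r13 * V r32 - V r12 * V r33)).
  exists (V a * f3 + g0 * (V r12 * V r23 - V r13 * V r22)).
  by rewrite u1E u2E u3E; ring.
have Ke : koszul_exact u1 u2 (V e).
  (* Here [e] itself is the required element of [k[e, x]]. *)
  apply: (quadrics_koszul etaK thetaK u1S u2S (N := 'X%:P)).
    by rewrite polyC_eq0 polyX_eq0.
  by exists 0, 0, 1; rewrite cstE eval2C eval1X; ring.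
have reg (f : P) : f != 0 -> regular_mod (@zero_ideal P) f.
  by move=> f0 h /eqP; rewrite mulf_eq0 (negPf f0) => /eqP.
have ev0u : [/\ ev0 u1 = 0, ev0 u2 = 0 & ev0 u3 = 0].
  by rewrite u1E u2E u3E !rmorphD !rmorphM !ev0V; split; ring.
have [eu1 eu2 eu3] := ev0u.
have one_neq0 := oner_neq0 k.
have u1_0 : u1 != 0.
  apply/eqP => u1_0; have [_ _ K1] := Ke.
  have [|g1 [g2 [g3 [E _ _]]]] := K1 1 0 0; first by rewrite /zero_ideal u1_0; ring.
  have := congr1 ev0 E; rewrite !rmorphB !rmorphM eu2 ev0V rmorph1 rmorph0 => /eqP.
  by rewrite !mul0r !subr0 (negPf one_neq0).
have reg2 := quadrics_regular2 etaK thetaK u1S u2S.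
pose I := linked_I (V e) (V a) (V s) (V t) u1 u2.
have I1 : ~ I 1.
  move=> [f1 [f2 [f3 [p [q E]]]]]; have := congr1 ev0 E.
  rewrite !rmorphD !rmorphM eu1 eu2 ev0V rmorph1 !mulr0 mul0r !addr0 => /eqP.
  by rewrite (negPf one_neq0).
have ev0delta : ev0 delta = 0.
  by rewrite /delta /det3 !rmorphD !rmorphM !ev0V !mul0r !addr0.
have J1 : ~ J 1.
  move=> [f1 [f2 [f3 [p E]]]]; have := congr1 ev0 E.
  rewrite rmorph1 3!rmorphD 3!rmorphM eu1 eu2 eu3 rmorphM /= -/ev0 -/delta ev0delta !mulr0 !addr0 => /eqP.
  by rewrite (negPf one_neq0).
exists I, J; split.
- exact: (linked_I_perfect u1E u2E u3E Kv Ku Ke (reg _ e0) (reg _ u1_0) reg2 I1 J1).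
- exact: (linked_J_perfect u1E u2E u3E Kv Ku Ke (reg _ u1_0) reg2 J1).
- exact: (linked_I_J u1E u2E u3E Kv Ku Ke (reg _ e0) (reg _ u1_0) reg2 I1 J1).
- by move=> f; split=> [/annP|] fE; [exact/linked_sumP | apply/annP/linked_sumP].
Qed.

End Core.

Ltac symv_ring :=
  repeat match goal with |- context [@symv ?k ?n ?U ?d ?u] => generalize (@symv k n U d u) end;
  intros; ring.

(** * From a matrix of linear forms to the annihilator *)

Section Frame.
Variables (k : fieldType) (U : vectType k) (dimU : \dim {:U} = 4%N).
Variables (Phi3 : divpow k 3 3) (x : U).
Local Notation P := {mpoly k[4]}.
Local Notation V := (symv dimU).
Local Notation B := (tri dimU Phi3 x).
Local Notation m := (mu dimU Phi3 x).
Hypothesis pmap_inj : lker (Defs.pmap dimU Phi3 x) == 0%VS.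

Let BX := BE (triBC dimU Phi3 x) (tri_linear dimU Phi3 x).
Let mX := mE (@muC _ _ _ dimU Phi3 x) (mu_linear pmap_inj) (mu1 pmap_inj).
Let BDr' := BDr (tri_linear dimU Phi3 x).
Let BNr' := BNr (tri_linear dimU Phi3 x).
Let BZr' := BZr (tri_linear dimU Phi3 x).
Let BA := triBA pmap_inj.
Let mC := @muC _ _ _ dimU Phi3 x.

Let VD u v : V (u + v) = V u + V v. Proof. exact: linearD. Qed.
Let VN u : V (- u) = - V u. Proof. exact: linearN. Qed.

Variables (e s t : U).
Hypothesis bas : basis4 e x s t.
Hypothesis Bex : B e x != 0.
Hypothesis em : forall u, m e u = (B e u / B e x) *: e.
Hypotheses (Bes : B e s = 0) (Bet : B e t = 0).

Let lam (u : U) : k := B e u / B e x.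

Lemma lam_mu u v : lam (m u v) = lam u * lam v.
Proof. by rewrite /lam -BA em BX mulrA. Qed.

Lemma ann_e u : B e u = 0 -> ann Phi3 (V e * V u).
Proof.
move=> eu; have := ann_mu pmap_inj e u.
by rewrite em eu mul0r scale0r linear0 mulr0 subr0.
Qed.

Lemma perp_decomposition a u : lam a = 0 -> basis4 a x s t -> B e u = 0 ->
  exists p q r, u = p *: a + q *: s + r *: t.
Proof.
move=> lam_a [sp _] eu; have [p [q [r [r' uE]]]] := sp u.
have q0 : q = 0.
  have := congr1 (B e) uE; rewrite eu !BX Bes Bet !mulr0 !addr0 => /esym/eqP.
  have -> : B e a = 0 by rewrite -[LHS](divfK Bex) -/(lam a) lam_a mul0r.
  by rewrite mulr0 add0r mulf_eq0 (negPf Bex) orbF => /eqP.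
by exists p, r, r'; rewrite uE q0 scale0r addr0.
Qed.

(* Evaluation at the point lam of the dual space. *)
Definition eval_lam : {rmorphism P -> k} :=
  meval (fun i => lam (tnth (tcast dimU (vbasis {:U})) i)).

Lemma eval_lamV u : eval_lam (V u) = lam u.
Proof.
rewrite rmorph_sum /= [in RHS](coord_basis (tcast_basis dimU) (memvf u)) /lam.
rewrite (big_morph (B e) (BDr (tri_linear dimU Phi3 x) e)
  (B0r (tri_linear dimU Phi3 x) e)) mulr_suml.
by apply: eq_bigr => i _; rewrite mevalZ mevalXU BX mulrA -tnth_nth.
Qed.

Section Ideal.
Variable G : P -> Prop.
Hypothesis idG : is_ideal G.

Let Gm u v := G (V u * V v - V x * V (m u v)).

Let GmD u v v' : Gm u v -> Gm u v' -> Gm u (v + v').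
Proof.
move=> Guv Guv'; have := idealD idG Guv Guv'; congr G.
by rewrite !mX ?VD; symv_ring.
Qed.

Let GmZ c u v : Gm u v -> Gm u (c *: v).
Proof.
move=> Guv; have := idealM idG c%:MP Guv; congr G.
by rewrite !mX !symvZ; symv_ring.
Qed.

Let Gm_span u : Gm u e -> Gm u x -> Gm u s -> Gm u t -> forall v, Gm u v.
Proof.
move=> Ge Gx Gs Gt v; have [p [q [r [r' ->]]]] := proj1 bas v.
by do 3 (apply: (GmD _ _); last exact: (GmZ _ _)); exact: (GmZ _ _).
Qed.

Let GmC u v : Gm u v -> Gm v u.
Proof. by rewrite /Gm mC mulrC. Qed.

(** By bilinearity only pairs from [e, x, s, t] matter. Those with [x] are trivial, and those with
    [e] reduce to [e ker lam] because [u - lam(u) x] is in [ker lam]; three products remain. *)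
Lemma mu_ideal : (forall u, B e u = 0 -> G (V e * V u)) ->
  G (V s * V s - V x * V (m s s)) -> G (V t * V t - V x * V (m t t)) ->
  G (V s * V t - V x * V (m s t)) ->
  forall u v, G (V u * V v - V x * V (m u v)).
Proof.
move=> Ge Gss Gtt Gst.
have Gx u : Gm x u by rewrite /Gm mu1 // subrr; exact: ideal0.
have Gee u : Gm e u.
  have eu : B e (u - lam u *: x) = 0 by rewrite !BX /lam divfK // subrr.
  by have := Ge _ eu; congr G; rewrite em linearB /= !symvZ /lam; symv_ring.
have Gs := Gm_span (GmC (Gee s)) (GmC (Gx s)) Gss Gst.
have Gt := Gm_span (GmC (Gee t)) (GmC (Gx t)) (GmC Gst) Gtt.
by move=> u v; exact: GmC (Gm_span (GmC (Gee v)) (GmC (Gx v)) (GmC (Gs v)) (GmC (Gt v)) u).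
Qed.

Hypothesis G_mu : forall u v, G (V u * V v - V x * V (m u v)).

Lemma mu3_ideal u v w : G (V u * V v * V w - V x * V x * V (m (m u v) w)).
Proof.
have := idealD idG (idealM idG (V w) (G_mu u v)) (idealM idG (V x) (G_mu (m u v) w)).
by congr G; symv_ring.
Qed.

(** The determinant computed in [(U, o)]. The product need not be associative, so a bracketing is
    fixed; [x^2] times the result represents [det3] modulo [G]. *)
Definition det_mu (r11 r12 r13 r21 r22 r23 r31 r32 r33 : U) : U :=
  (m (m r22 r33) r11 - m (m r23 r32) r11) + (m (m r23 r31) r12 - m (m r21 r33) r12) +
  (m (m r21 r32) r13 - m (m r22 r31) r13).

Lemma det_mu_ideal r11 r12 r13 r21 r22 r23 r31 r32 r33 :
  G (det3 (V r11) (V r12) (V r13) (V r21) (V r22) (V r23) (V r31) (V r32) (V r33) -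
     V x * V x * V (det_mu r11 r12 r13 r21 r22 r23 r31 r32 r33)).
Proof.
have Gs u v w u' v' := idealB idG (mu3_ideal u v w) (mu3_ideal u' v' w).
have := idealD idG (idealD idG (Gs r22 r33 r11 r23 r32) (Gs r23 r31 r12 r21 r33))
  (Gs r21 r32 r13 r22 r31).
by congr G; rewrite /det3 /det_mu 5!VD 3!VN; symv_ring.
Qed.

(** The two bracketings represent the same monomial [u v w]. *)
Lemma associator_ideal u v w : G (V x * V x * V (m (m u v) w - m u (m v w))).
Proof.
have := idealB idG (mu3_ideal v w u) (mu3_ideal u v w).
by rewrite [m u (m v w)]mC; congr G; rewrite VD VN; symv_ring.
Qed.

Hypothesis gram_st : gram_minor B m s t != 0.

(** The hyperplane orthogonal to [x] is spanned by [d] and two associators of [s] and [t], which are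
    orthogonal to [x] and [e] and, up to the minor, dual to [t] and [s]. By [associator_ideal], only
    [x^2 d] has to be supplied. *)
Lemma perp_ideal d : B x d = 0 -> B e d != 0 -> G (V x * V x * V d) ->
  forall w, B x w = 0 -> G (V x * V x * V w).
Proof.
move=> xd ed Gd w xw.
pose A1 := m (m s s) t - m s (m s t); pose A2 := m (m t t) s - m t (m t s).
have GA1 : G (V x * V x * V A1) by exact: associator_ideal.
have GA2 : G (V x * V x * V A2) by exact: associator_ideal.
have adj u v v' : B (m u v) v' = B v (m u v') by rewrite mC BA.
have em0 u : B e u = 0 -> m e u = 0 by move=> eu; rewrite em eu mul0r scale0r.
have A1E u : B u A1 = B (m s s) (m t u) - B (m s t) (m s u).
  by rewrite triBC /A1 BX BX BA [B (m s (m s t)) u]adj.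
have A2E u : B u A2 = B (m t t) (m s u) - B (m s t) (m t u).
  by rewrite triBC /A2 BX BX BA [B (m t (m t s)) u]adj [m t s]mC.
clearbody A1 A2; pose w1 := w - (B e w / B e d) *: d.
pose w2 := w1 - (B s w1 / gram_minor B m s t) *: A2 - (B t w1 / gram_minor B m s t) *: A1.
have w2_0 : w2 = 0.
  apply: (tri_nondegenerate pmap_inj) => u; rewrite triBC.
  have mx u' : m u' x = u' by rewrite mC mu1.
  have xA1 : B x A1 = 0 by rewrite A1E !mx adj triBC subrr.
  have xA2 : B x A2 = 0 by rewrite A2E !mx adj triBC [m t s]mC subrr.
  have [et es] : m t e = 0 /\ m s e = 0 by rewrite ![m _ e]mC !em0.
  have m0 u' : B u' 0 = 0 by exact: (B0r (tri_linear dimU Phi3 x)).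
  have eA1 : B e A1 = 0 by rewrite A1E et es !m0 subrr.
  have eA2 : B e A2 = 0 by rewrite A2E et es !m0 subrr.
  have sA1 : B s A1 = 0 by rewrite A1E [m t s]mC triBC subrr.
  have sA2 : B s A2 = gram_minor B m s t by rewrite A2E triBC [m t s]mC.
  have tA1 : B t A1 = gram_minor B m s t by rewrite A1E.
  have tA2 : B t A2 = 0 by rewrite A2E triBC subrr.
  have [p [q [r [r' ->]]]] := proj1 bas u.
  have w2E u' : B u' w2 = B u' w1 - B s w1 / gram_minor B m s t * B u' A2
      - B t w1 / gram_minor B m s t * B u' A1.
    by rewrite /w2 2!BDr' 2!BNr' 2!BZr'.
  have w1E u' : B u' w1 = B u' w - B e w / B e d * B u' d.
    by rewrite /w1 BDr' BNr' BZr'.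
  have xw2 : B x w2 = 0 by rewrite w2E w1E xw xd xA1 xA2 !mulr0 !subr0.
  have ew2 : B e w2 = 0 by rewrite w2E w1E eA1 eA2 divfK // !mulr0 !subr0 subrr.
  have sw2 : B s w2 = 0 by rewrite w2E sA1 sA2 divfK // mulr0 subr0 subrr.
  have tw2 : B t w2 = 0 by rewrite w2E tA1 tA2 divfK // mulr0 subr0 subrr.
  rewrite triBC 3!BDr' 4!BZr' ![B w2 _]triBC xw2 ew2 sw2 tw2 !mulr0 !addr0 //.
have -> : w = (B e w / B e d) *: d + ((B s w1 / gram_minor B m s t) *: A2
    + ((B t w1 / gram_minor B m s t) *: A1 + w2)).
  by rewrite /w2 [_ *: A1 + _]addrC subrK [_ *: A2 + _]addrC subrK /w1 addrC subrK.
rewrite w2_0 addr0 2!VD 3!symvZ.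
have := idealD idG (idealM idG (B e w / B e d)%:MP Gd) (idealD idG
  (idealM idG (B s w1 / gram_minor B m s t)%:MP GA2)
  (idealM idG (B t w1 / gram_minor B m s t)%:MP GA1)).
by congr G; symv_ring.
Qed.

End Ideal.

Section Matrix.
Variables (a r11 r12 r13 r21 r22 r23 r31 r32 r33 y1 y2 y3 : U) (ca cx : k).
Hypothesis bas_a : basis4 a x s t.
Hypothesis aE : a = ca *: e + cx *: x.
Hypothesis lam_a : lam a = 0.
Hypothesis gram_st : gram_minor B m s t != 0.
Hypotheses (ey1 : B e y1 = 0) (ey2 : B e y2 = 0) (ey3 : B e y3 = 0).

Let u1 : P := V r11 * V a + V r12 * V s + V r13 * V t.
Let u2 : P := V r21 * V a + V r22 * V s + V r23 * V t.
Let u3 : P := V r31 * V a + V r32 * V s + V r33 * V t.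
Let delta : P := det3 (V r11) (V r12) (V r13) (V r21) (V r22) (V r23) (V r31) (V r32) (V r33).

Hypothesis u1E : u1 = V s * V s - V x * V (m s s) + V e * V y1.
Hypothesis u2E : u2 = V t * V t - V x * V (m t t) + V e * V y2.
Hypothesis u3E : u3 = V s * V t - V x * V (m s t) + V e * V y3.
Hypothesis cform_delta : cform Phi3 delta = 0.
Hypothesis eval_delta : eval_lam delta != 0.

Let G : P -> Prop := sum_gen (V e) (V a) (V s) (V t) u1 u2 u3 delta.

Let idG : is_ideal G. Proof. exact: sum_gen_ideal. Qed.

Let Bea : B e a = 0.
Proof. by rewrite -[LHS](divfK Bex) -/(lam a) lam_a mul0r. Qed.

Let Ge u : B e u = 0 -> G (V e * V u).
Proof.
move=> /(perp_decomposition lam_a bas_a)[p [q [r ->]]].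
exists p%:MP, q%:MP, r%:MP, 0, 0, 0, 0; rewrite 2!VD 3!symvZ !mul0r !addr0 //.
Qed.

Let Gu : [/\ G u1, G u2, G u3 & G delta].
Proof.
split.
- by exists 0, 0, 0, 1, 0, 0, 0; rewrite !mul0r !addr0 mulr0 add0r mul1r.
- by exists 0, 0, 0, 0, 1, 0, 0; rewrite !mul0r !addr0 mulr0 !add0r mul1r.
- by exists 0, 0, 0, 0, 0, 1, 0; rewrite !mul0r !addr0 mulr0 !add0r mul1r.
- by exists 0, 0, 0, 0, 0, 0, 1; rewrite !mul0r !addr0 mulr0 !add0r mul1r.
Qed.

Let G_mu : forall u v, G (V u * V v - V x * V (m u v)).
Proof.
have [G1 G2 G3 _] := Gu; apply: mu_ideal => //.
- by have := idealB idG G1 (Ge ey1); rewrite u1E addrK.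
- by have := idealB idG G2 (Ge ey2); rewrite u2E addrK.
- by have := idealB idG G3 (Ge ey3); rewrite u3E addrK.
Qed.

Let annG f : G f -> ann Phi3 f.
Proof.
have id_ann := ann_ideal Phi3.
have ann_u p y v w : B e y = 0 -> ann Phi3 (p * (V v * V w - V x * V (m v w) + V e * V y)).
  by move=> ey; apply/(idealM id_ann)/(idealD id_ann); [exact: ann_mu | exact: ann_e].
have ann_ev p u : B e u = 0 -> ann Phi3 (V e * (p * V u)).
  by move=> eu; rewrite mulrCA; apply/(idealM id_ann)/ann_e.
have ann_delta : ann Phi3 delta.
  apply: (@ann_homog _ _ _ 3) => //; first exact: det3_homog.
  by move=> g /homog0_const ->; rewrite mulrC mul_mpolyC linearZ /= cform_delta scaler0.
move=> [f1 [f2 [f3 [p1 [p2 [p3 [g ->]]]]]]].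
rewrite u1E u2E u3E 2!mulrDr; apply: (idealD id_ann); last exact: (idealM id_ann).
apply: (idealD id_ann); last exact: ann_u.
apply: (idealD id_ann); last exact: ann_u.
apply: (idealD id_ann); last exact: ann_u.
apply: (idealD id_ann); last exact: ann_ev.
by apply: (idealD id_ann); exact: ann_ev.
Qed.

Let ker_lam (f : P) : Prop := eval_lam f = 0.

(** Modulo the relations [u v = x (u o v)], [delta] is [x^2 d]. These relations are killed by [Phi3]
    and, [lam] being multiplicative, by [eval_lam]. So [Phi3(delta) = 0] reads [B(x, d) = 0], and
    [eval_lam delta != 0] reads [B(e, d) != 0]. *)
Let G_perp w : B x w = 0 -> G (V x * V x * V w).
Proof.
pose d := det_mu r11 r12 r13 r21 r22 r23 r31 r32 r33.
have [_ _ _ Gdelta] := Gu; have Gd := det_mu_ideal idG G_mu r11 r12 r13 r21 r22 r23 r31 r32 r33.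
have id_ann := ann_ideal Phi3.
have annd := det_mu_ideal id_ann (ann_mu pmap_inj) r11 r12 r13 r21 r22 r23 r31 r32 r33.
have id_ker : is_ideal ker_lam.
  rewrite /ker_lam; split=> [|f g f0 g0|f g g0]; first exact: rmorph0.
    by rewrite rmorphD f0 g0 addr0.
  by rewrite rmorphM g0 mulr0.
have lam_x : lam x = 1 by rewrite /lam divff.
have ker_mu u v : ker_lam (V u * V v - V x * V (m u v)).
  by rewrite /ker_lam rmorphB !rmorphM !eval_lamV lam_x mul1r lam_mu subrr.
have kerd := det_mu_ideal id_ker ker_mu r11 r12 r13 r21 r22 r23 r31 r32 r33.
apply: (perp_ideal idG G_mu gram_st (d := d)).
- move: annd => /annE /(_ 1); rewrite mulr1 linearB /= -/delta cform_delta sub0r.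
  by rewrite -/(tri _ _ _ _ _) => /eqP; rewrite oppr_eq0 => /eqP.
- apply: contra_neq eval_delta => ed; move: kerd; rewrite /ker_lam -/delta -/d.
  rewrite rmorphB !rmorphM !eval_lamV lam_x !mul1r /lam ed mul0r subr0 //.
- by have := idealB idG Gdelta Gd; rewrite opprB addrC subrK.
Qed.

Let annP f : ann Phi3 f <-> G f.
Proof.
split; last exact: annG.
exact: (ann_sub pmap_inj bas Bex em idG G_mu G_perp annG).
Qed.

Let lin_eval2 c d : eval2 dimU x e (c%:P%:P * 'X%:P + d%:P%:P * 'X) = c%:MP * V e + d%:MP * V x.
Proof.
by rewrite rmorphD !rmorphM; congr (_ * _ + _ * _); rewrite ?eval2X ?eval2C ?eval1X ?eval1C.
Qed.

(** Both [v o w] and [y] lie in [ker lam], spanned by [a, s, t] with [a] in [k[e, x]]. Apart from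
    [v w], everything is therefore of degree at most one in [s, t]. *)
Let monic_shape v w y : B e y = 0 -> lam (m v w) = 0 -> exists b c d,
  V v * V w - V x * V (m v w) + V e * V y =
  V v * V w + eval2 dimU x e b * V s + eval2 dimU x e c * V t + eval2 dimU x e d.
Proof.
move=> ey lvw; have evw : B e (m v w) = 0.
  by rewrite -[LHS](divfK Bex) -/(lam _) lvw mul0r.
have [p [q [r mE']]] := perp_decomposition lam_a bas_a evw.
have [p' [q' [r' yE]]] := perp_decomposition lam_a bas_a ey.
exists (q'%:P%:P * 'X%:P + (- q)%:P%:P * 'X), (r'%:P%:P * 'X%:P + (- r)%:P%:P * 'X).
exists ((p'%:P%:P * 'X%:P + (- p)%:P%:P * 'X) * (ca%:P%:P * 'X%:P + cx%:P%:P * 'X)).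
rewrite rmorphM !lin_eval2 mE' yE 4!VD 6!symvZ aE VD 2!symvZ !mpolyCN; symv_ring.
Qed.

Theorem frame_linked : exists I J : P -> Prop,
  [/\ perfect_ideal I /\ grade I 3, perfect_ideal J /\ grade J 3, linked I J &
      forall f, ann Phi3 f <-> ideal_add I J f].
Proof.
have lam_ss : lam (m s s) = 0 by rewrite lam_mu /lam Bes !mul0r.
have lam_tt : lam (m t t) = 0 by rewrite lam_mu /lam Bet !mul0r.
have [b1 [c1 [d1 E1]]] := monic_shape ey1 lam_ss.
have [b2 [c2 [d2 E2]]] := monic_shape ey2 lam_tt.
have aPE : eval2 dimU x e (ca%:P%:P * 'X%:P + cx%:P%:P * 'X) = V a.
  by rewrite lin_eval2 aE VD 2!symvZ.
have aP0 : ca%:P%:P * 'X%:P + cx%:P%:P * 'X != 0.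
  apply/eqP => a0; have Va0 : V a = 0 by rewrite -aPE a0 rmorph0.
  have [|p _ _ _] := proj2 bas_a 1 0 0 0.
    by rewrite (symv_inj Va0) scaler0 !scale0r !addr0.
  by move/eqP: p; rewrite oner_eq0.
apply: (@linked_sum_of_matrix k U dimU Phi3 x pmap_inj e s t bas Bex a r11 r12 r13 r21 r22 r23
  r31 r32 r33 u1 u2 u3 _ aPE aP0 (erefl _) (erefl _) (erefl _) b1 c1 d1 b2 c2 d2) => //.
- by rewrite u1E E1 expr2.
- by rewrite u2E E2 expr2.
Qed.

End Matrix.
End Frame.

(** * The matrix in the idempotent and in the nilpotent case *)

Section Cases.
Variables (k : fieldType) (U : vectType k) (dimU : \dim {:U} = 4%N).
Variables (Phi3 : divpow k 3 3) (x : U).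
Local Notation P := {mpoly k[4]}.
Local Notation V := (symv dimU).
Local Notation B := (tri dimU Phi3 x).
Local Notation m := (mu dimU Phi3 x).
Hypothesis pmap_inj : lker (Defs.pmap dimU Phi3 x) == 0%VS.

Let B_lin := tri_linear dimU Phi3 x.
Let BX := BE (triBC dimU Phi3 x) (tri_linear dimU Phi3 x).
Let BA := triBA pmap_inj.

Let VD u v : V (u + v) = V u + V v. Proof. exact: linearD. Qed.
Let VN u : V (- u) = - V u. Proof. exact: linearN. Qed.

Variables (e s t : U).
Hypothesis bas : basis4 e x s t.
Hypothesis Bex : B e x != 0.
Hypothesis em : forall u, m e u = (B e u / B e x) *: e.
Hypotheses (Bes : B e s = 0) (Bet : B e t = 0).
Hypothesis gram_st : gram_minor B m s t != 0.

Let lam (u : U) : k := B e u / B e x.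

Let lam_x : lam x = 1. Proof. by rewrite /lam divff. Qed.
Let lam_s : lam s = 0. Proof. by rewrite /lam Bes mul0r. Qed.
Let lam_t : lam t = 0. Proof. by rewrite /lam Bet mul0r. Qed.
Let lamD u v : lam (u + v) = lam u + lam v. Proof. by rewrite /lam BX mulrDl. Qed.
Let lamN u : lam (- u) = - lam u. Proof. by rewrite /lam BX mulNr. Qed.
Let lamZ c u : lam (c *: u) = c * lam u. Proof. by rewrite /lam BX mulrA. Qed.
Let lam0 : lam 0 = 0. Proof. by rewrite /lam BX mul0r. Qed.
Let lamE := (lamD, lamN, lamZ, lam0, lam_x, lam_s, lam_t).

Let lam_mm u v : lam (m u v) = lam u * lam v. Proof. exact: lam_mu. Qed.

Let Be0 u : lam u = 0 -> B e u = 0.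
Proof. by move=> u0; rewrite -[LHS](divfK Bex) -/(lam u) u0 mul0r. Qed.

Lemma eval_det r11 r12 r13 r21 r22 r23 r31 r32 r33 :
  eval_lam dimU Phi3 x e
    (det3 (V r11) (V r12) (V r13) (V r21) (V r22) (V r23) (V r31) (V r32) (V r33)) =
  lam r11 * (lam r22 * lam r33 - lam r23 * lam r32) +
  lam r12 * (lam r23 * lam r31 - lam r21 * lam r33) +
  lam r13 * (lam r21 * lam r32 - lam r22 * lam r31).
Proof. by rewrite /det3 2!rmorphD !rmorphM !rmorphB !rmorphM !eval_lamV. Qed.

Lemma cform_tri u v w : cform Phi3 (V u * (V v * V w)) = B (m u v) w.
Proof. by rewrite mulrA tri_mu. Qed.

Lemma cform_det r11 r12 r13 r21 r22 r23 r31 r32 r33 :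
  cform Phi3
    (det3 (V r11) (V r12) (V r13) (V r21) (V r22) (V r23) (V r31) (V r32) (V r33)) =
  (B (m r11 r22) r33 - B (m r11 r23) r32) + (B (m r12 r23) r31 - B (m r12 r21) r33) +
  (B (m r13 r21) r32 - B (m r13 r22) r31).
Proof. by rewrite /det3 !mulrBr 2!linearD !linearB /= !cform_tri. Qed.

Lemma tri_lam u v : B (m u v) e = lam u * lam v * B e x.
Proof. by rewrite triBC -[in RHS]lam_mm divfK. Qed.

(* With v = (x - e, s, t), the rows of M are (e - s o s, s, 0), (- t o t, e, t) and
   (- s o t, t, r e). *)
Theorem linked_of_idempotent : B e e = B e x -> exists I J : P -> Prop,
  [/\ perfect_ideal I /\ grade I 3, perfect_ideal J /\ grade J 3, linked I J &
      forall f, ann Phi3 f <-> ideal_add I J f].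
Proof.
move=> Bee; have lam_e : lam e = 1 by rewrite /lam Bee divff.
(* The scalar that makes [Phi3(det M)] vanish. As [lam] takes the value [r] on [det M], the nonzero
   minor also gives the second condition. *)
pose r := - (gram_minor B m s t / B e x).
have lam_ss : lam (m s s) = 0 by rewrite lam_mm lam_s mul0r.
have lam_tt : lam (m t t) = 0 by rewrite lam_mm lam_t mul0r.
have lam_st : lam (m s t) = 0 by rewrite lam_mm lam_s mul0r.
(* After the matrix come the [y_i] of the terms [e y_i] in [M v], then the coordinates -1 and 1 of
   [x - e] on [e] and [x]. *)
apply: (@frame_linked k U dimU Phi3 x pmap_inj e s t bas Bex em Bes Bet (x - e)
  (e - m s s) s 0 (- m t t) e t (- m s t) t (r *: e)
  (m s s + (x - e)) (m t t + s) (m s t + r *: t) (-1) 1) => //.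
- have [sp fr] := bas; split=> [u|p q p' q' E0].
    have [p [q [p' [q' ->]]]] := sp u; exists (- p), (q + p), p', q'.
    by rewrite scalerBr scalerDl !scaleNr opprK [- _ + _ + _]addrC addrA addrK [q *: _ + _]addrC.
  have [|p0 qp -> ->] := fr (- p) (q + p) p' q'.
    rewrite -[RHS]E0 scalerBr scalerDl scaleNr; congr (_ + _ + _).
    by rewrite [RHS]addrC [_ - _]addrC [RHS]addrCA.
  by move/eqP: p0; rewrite oppr_eq0 => /eqP p0; move: qp; rewrite p0 addr0 => ->.
- by rewrite scaleN1r scale1r addrC.
- by rewrite -/(lam _) !lamE lam_e subrr.
- by apply: Be0; rewrite !lamE lam_ss lam_e subrr addr0.
- by apply: Be0; rewrite !lamE lam_tt addr0.
- by apply: Be0; rewrite !lamE lam_st mulr0 addr0.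
- by rewrite 4!VD 2!VN linear0; symv_ring.
- by rewrite 2!VD 2!VN; symv_ring.
- by rewrite 2!VD 2!VN 2!symvZ; symv_ring.
- have m0 u v : B (m 0 u) v = 0 by rewrite BA (B0l (triBC dimU Phi3 x) B_lin).
  rewrite cform_det 2!m0 subrr addr0.
  rewrite 2!(BZr B_lin) 2!tri_lam lamD lamN lam_s lam_ss lam_e BA (BNr B_lin) (BDl (triBC dimU Phi3 x) B_lin).
  rewrite (BNl (triBC dimU Phi3 x) B_lin) (Be0 lam_tt) !(mul0r, mulr0, subr0, add0r, mul1r).
  by rewrite opprK mulNr divfK // /gram_minor opprB subrK subrr.
- rewrite eval_det !lamE lam_e lam_tt lam_st lam_ss !(mul0r, mulr0, oppr0, subr0, addr0, mul1r, mulr1).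
  by rewrite oppr_eq0 mulf_neq0 ?invr_eq0.
Qed.

(* With v = (e, s, t) and s o s = a1 e + b1 s + c1 t, the first row of M is (0, s, 0) - x (a1, b1, c1);
   the second row comes from t o t, and the third from s o t with x replaced by
   x + r e, where r makes Phi3 vanish on det M. *)
Theorem linked_of_nilpotent : B e e = 0 -> B x s = 0 -> B x t = 0 -> exists I J : P -> Prop,
  [/\ perfect_ideal I /\ grade I 3, perfect_ideal J /\ grade J 3, linked I J &
      forall f, ann Phi3 f <-> ideal_add I J f].
Proof.
move=> Bee xs xt; have lam_e : lam e = 0 by rewrite /lam Bee mul0r.
have dec u v : lam u = 0 -> exists p q r, m u v = p *: e + q *: s + r *: t.
  move=> u0; apply: (perp_decomposition Bex Bes Bet lam_e bas).
  by apply: Be0; rewrite lam_mm u0 mul0r.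
have [a1 [b1 [c1 ssE]]] := dec s s lam_s; have [a2 [b2 [c2 ttE]]] := dec t t lam_t.
have [a3 [b3 [c3 stE]]] := dec s t lam_s.
have Bx u v : B u v = B x (m u v) by rewrite -BA mu1.
have xE p q r : B x (p *: e + q *: s + r *: t) = p * B e x.
  by rewrite 2!(BDr B_lin) !(BZr B_lin) xs xt triBC !mulr0 !addr0.
have Bss : B s s = a1 * B e x by rewrite Bx ssE xE.
have Bst : B s t = a3 * B e x by rewrite Bx stE xE.
have Btt : B t t = a2 * B e x by rewrite Bx ttE xE.
have Bdec p q r p' q' r' : B (p *: e + q *: s + r *: t) (p' *: e + q' *: s + r' *: t) =
    (q * q' * a1 + (q * r' + r * q') * a3 + r * r' * a2) * B e x.
  rewrite 2!(BDl (triBC dimU Phi3 x) B_lin) 6!(BDr B_lin) !(BZl (triBC dimU Phi3 x) B_lin) !(BZr B_lin).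
  rewrite Bee Bes Bet [B s e]triBC [B t e]triBC [B t s]triBC Bes Bet Bss Bst Btt; ring.
have Bsl p q r : B s (p *: e + q *: s + r *: t) = (q * a1 + r * a3) * B e x.
  by rewrite 2!(BDr B_lin) 3!(BZr B_lin) triBC Bes Bss Bst; ring.
have Btl p q r : B t (p *: e + q *: s + r *: t) = (q * a3 + r * a2) * B e x.
  by rewrite 2!(BDr B_lin) 3!(BZr B_lin) triBC Bet Btt triBC Bst; ring.
(* Associativity of [B]: [B(t, s o s) = B(s, s o t)], and for [E2], [B(t, s o t) = B(s, t o t)]. *)
have E1 : b1 * a3 + c1 * a2 = b3 * a1 + c3 * a3.
  by apply: (mulIf Bex); rewrite -(Btl a1) -(Bsl a3) -ssE -stE [LHS]triBC; exact: BA.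
have E2 : b3 * a3 + c3 * a2 = b2 * a1 + c2 * a3.
  by apply: (mulIf Bex); rewrite -(Btl a3) -(Bsl a2) -ttE -stE [LHS]triBC; exact: BA.
(* The determinant of the structure constants. Since [lam] sends [x] to 1 and [e, s, t] to 0,
   [det M] takes the value [- D] at [lam]. *)
pose D := a1 * (b2 * c3 - c2 * b3) + b1 * (c2 * a3 - a2 * c3) + c1 * (a2 * b3 - b2 * a3).
have gramE : gram_minor B m s t = - D * B e x.
  rewrite /gram_minor ssE ttE stE !Bdec; apply: subr0_eq.
  transitivity (((b3 + c2) * (b1 * a3 + c1 * a2 - (b3 * a1 + c3 * a3))
    - (b1 + c3) * (b3 * a3 + c3 * a2 - (b2 * a1 + c2 * a3))) * B e x).
    by rewrite /D; ring.
  by rewrite E1 E2 !subrr !mulr0 subrr mul0r.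
have D0 : D != 0.
  by apply: contra_neq gram_st => D0; rewrite gramE D0 oppr0 mul0r.
pose q0 := det3 (V (- a1 *: x)) (V (s - b1 *: x)) (V (- c1 *: x))
  (V (- a2 *: x)) (V (- b2 *: x)) (V (t - c2 *: x))
  (V (- a3 *: x)) (V (t - b3 *: x)) (V (- c3 *: x)).
(* [r] enters [Phi3(det M)] linearly through the third row. As
   [B(u o v, e) = lam(u) lam(v) B(e, x)], its coefficient is [- D B(e, x)]. *)
pose r := cform Phi3 q0 / (D * B e x).
apply: (@frame_linked k U dimU Phi3 x pmap_inj e s t bas Bex em Bes Bet e
  (- a1 *: x) (s - b1 *: x) (- c1 *: x) (- a2 *: x) (- b2 *: x) (t - c2 *: x)
  (- a3 *: x + (- r * a3) *: e) (t - b3 *: x + (- r * b3) *: e) (- c3 *: x + (- r * c3) *: e)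
  0 0 (- r *: m s t) 1 0) => //.
- by rewrite scale1r scale0r addr0.
- exact: (B0r B_lin).
- exact: (B0r B_lin).
- by apply: Be0; rewrite !lamE lam_mm lam_s mul0r mulr0.
- by rewrite ssE linear0 3!VD VN 6!symvZ !mpolyCN; symv_ring.
- by rewrite ttE linear0 3!VD VN 6!symvZ !mpolyCN; symv_ring.
- by rewrite stE [V (- r *: _)]symvZ 6!VD VN 9!symvZ !mpolyCM !mpolyCN; symv_ring.
- have split u v c : B u (v + c *: e) = B u v + c * B u e by rewrite (BDr B_lin) (BZr B_lin).
  have rE : cform Phi3 q0 = r * (D * B e x) by rewrite divfK // mulf_neq0.
  rewrite /q0 cform_det in rE; clearbody r.
  have := subrr (r * (D * B e x)); rewrite -{1}rE => {}rE.
  rewrite cform_det 6!split 6!tri_lam 2!lamD 2!lamN 6!lamZ lam_s lam_t lam_x -[RHS]rE /D.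
  repeat match goal with |- context [tri dimU Phi3 ?u ?v ?w] => generalize (tri dimU Phi3 u v w) end.
  move=> *; ring.
- rewrite eval_det !lamE lam_e; move: D0; apply: contra_neq => E.
  by apply: oppr_inj; rewrite oppr0 -[RHS]E /D; ring.
Qed.

End Cases.

Lemma SM_minors (k : fieldType) (U : vectType k) (dimU : \dim {:U} = 4%N)
    (Phi3 : divpow k 3 3) (x y z w : U) : lker (Defs.pmap dimU Phi3 x) == 0%VS ->
  SM dimU Phi3 x y z w = minors_mx (tri dimU Phi3 x) (mu dimU Phi3 x) y z w.
Proof.
move=> pmap_inj; have qE a b c d : pairing dimU Phi3 x (symv dimU a * symv dimU b)
    (symv dimU c * symv dimU d) = tri dimU Phi3 x (mu dimU Phi3 x a b) (mu dimU Phi3 x c d).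
  by rewrite tri_mu.
by rewrite /SM /minors_mx; apply/matrixP => i j; rewrite !mxE !qE.
Qed.

Theorem theorem12p1 (k : fieldType) (U : vectType k) (dimU : \dim {:U} = 4%N)
    (Phi3 : divpow k 3 3) (x : U) (xs : 'Hom(U, k^o)) (y0 z0 w0 : U) :
  (forall l : U, ann Phi3 (symv dimU l) -> l = 0) ->
  weak_lefschetz dimU Phi3 x ->
  xs x = 1 ->
  basis_of (lker xs) [:: y0; z0; w0] ->
  \rank (SM dimU Phi3 x y0 z0 w0) = 1%N ->
  (exists (y z w : U) (alpha : k),
    [/\ basis_of (lker xs) [:: y; z; w], alpha != 0 &
        SM dimU Phi3 x y z w =
          \matrix_(i < 3, j < 3) (if (i == 0) && (j == 0) then alpha else 0)]) /\
  (exists I J : {mpoly k[4]} -> Prop,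
    [/\ perfect_ideal I /\ grade I 3, perfect_ideal J /\ grade J 3, linked I J &
        forall f, ann Phi3 f <-> ideal_add I J f]).
Proof.
move=> annU wl xsx bas0 rk; have pmap_inj := weak_lefschetz_injective annU wl.
have B_C := triBC dimU Phi3 x; have B_lin := tri_linear dimU Phi3 x.
have m_C := @muC _ _ _ dimU Phi3 x; have m_lin := mu_linear pmap_inj.
rewrite SM_minors // in rk.
have [y [z [w [al [bas al0 M_al]]]]] := minors_mx_rank1 B_C B_lin m_C m_lin bas0 rk.
split; first by exists y, z, w, al; rewrite SM_minors.
have bas4 := basis_of_lker_basis4 xsx bas.
have M0 i j : (i != 0) || (j != 0) ->
    minors_mx (tri dimU Phi3 x) (mu dimU Phi3 x) y z w i j = 0.
  by rewrite M_al mxE -negb_and => /negPf ->.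
have B_A := triBA pmap_inj; have B_nd := tri_nondegenerate pmap_inj; have m_1 := mu1 pmap_inj.
have gram_zw : gram_minor (tri dimU Phi3 x) (mu dimU Phi3 x) z w != 0.
  by move/matrixP: M_al => /(_ 0 0); rewrite !mxE /= /gram_minor => ->.
have [c [bas_e em]] : exists c, let e := y - c *: x in basis4 e x z w /\
    forall u, exists q, mu dimU Phi3 x e u = q *: e.
  apply: (nucleus_eigenvalue B_C B_lin m_C m_lin m_1 B_A B_nd bas4 gram_zw).
  - by have := M0 1 1 isT; rewrite !mxE.
  - by have := M0 2%:R 2%:R isT; rewrite !mxE.
  - by have := M0 0 1 isT; rewrite !mxE /= => /subr0_eq.
  - by have := M0 0 2%:R isT; rewrite !mxE /= => /subr0_eq.
  - by have := M0 1 2%:R isT; rewrite !mxE /= => /subr0_eq.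
have [e [s [t [[bas_f Bex e_eig [Bes Bet] gram_st]]]]] :=
  nucleus_frame B_C B_lin m_C m_lin m_1 B_A B_nd bas_e em gram_zw.
case=> [Bee|[Bee xs0 xt0]]; first exact: (linked_of_idempotent pmap_inj bas_f).
exact: (linked_of_nilpotent pmap_inj bas_f).
Qed.
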